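(* Suppose that $E(Y^2)<\infty$, that for all $x\in\mathrm{Supp}(X_c)$ the matrix $E(X^xX^{x\prime}|X_c=x)$ is nonsingular, and that $E(Y|X)=f(X_c)+X_{nc}'\beta_0$ with $X=(X_{nc},X_c)$, for some function $f$ and some $\beta_0\in\mathbb{R}^p$. Then the identified sets $\mathcal{B}^c$ of $\beta_0$ and $\mathcal{F}$ of $f$ satisfy $$\mathcal{B}^c=\left\{\lambda q:\ q\in\mathcal{S},\ 0\le\lambda\le\overline{S}(F_{Y,X_c},F_{X_{nc}'q,X_c})\right\},$$ $$\mathcal{F}=\left\{x\mapsto E(Y|X_c=x)-E(X_{nc}|X_c=x)'\beta:\ \beta\in\mathcal{B}^c\right\},$$ where $\overline{S}(F_{Y,X_c},F_{X_{nc}'q,X_c})=\inf_{x\in\mathrm{Supp}(X_c)}S(F_{Y^x|X_c=x},F_{X^{x\prime}q|X_c=x})$. Moreover, $\mathcal{B}^c$ includes $0_p$, is compact and convex.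
   Context: $Y$ is a real random variable, $X_{nc}$ a random vector in $\mathbb{R}^p$, $X_c$ a random vector. $\mathcal{S}$ is the unit sphere of $\mathbb{R}^p$, $0_p$ the zero vector, $\mathrm{Supp}(A)$ the support of $A$, and $F_{A|X_c=x}$ the conditional cdf of $A$ given $X_c=x$. For $x\in\mathrm{Supp}(X_c)$, $$X^x=X_{nc}-E(X_{nc}|X_c=x),\qquad Y^x=Y-E(Y|X_c=x).$$ For a cdf $F$ on $\mathbb{R}$, $F^{-1}(t)=\inf\{x:F(x)\ge t\}$. For cdfs $F,G$ on $\mathbb{R}$ with expectation $0$ and $\alpha\in(0,1)$, $R(\alpha,F,G)=\int_\alpha^1F^{-1}(t)dt\big/\int_\alpha^1G^{-1}(t)dt$ and $S(F,G)=\inf_{\alpha\in(0,1)}R(\alpha,F,G)$. Only the joint distributions $F_{Y,X_c}$ and $F_{X_{nc},X_c}$ are known (not that of $(Y,X_{nc},X_c)$). The identified set of $(\beta_0,f)$ is the set of all $(\beta,g)$ for which there exist random variables $(\widetilde Y,\widetilde X_{nc},\widetilde X_c)$ such that $(\widetilde Y,\widetilde X_c)$ has the distribution of $(Y,X_c)$, $(\widetilde X_{nc},\widetilde X_c)$ has the distribution of $(X_{nc},X_c)$, and $E(\widetilde Y|\widetilde X_{nc},\widetilde X_c)=g(\widetilde X_c)+\widetilde X_{nc}'\beta$; $\mathcal{B}^c$ and $\mathcal{F}$ are the corresponding sets of $\beta$'s and of $g$'s (functions of $X_c$ being identified when equal almost surely).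
   Formalization: Since laws given X_c=x are determined only for almost every x, the infimum over x in Supp(X_c) is taken as an essential infimum under the law of X_c, and nonsingularity (with finite conditional second moments of X_nc) is required only for almost every x. *)

(* Defs.v *)
(* Random vectors take their values in [n.-tuple R], which carries the product
   (= Borel) sigma-algebra; parameters live in ['rV[R]_n], which carries the
   topology and the linear structure of R^n.  [vec] goes from one to the
   other. *)
From HB Require Import structures.
From mathcomp Require Import all_boot all_order all_algebra.
From mathcomp Require Import all_classical all_reals all_analysis ess_sup_inf.
Set Implicit Arguments.
Unset Strict Implicit.
Unset Printing Implicit Defensive.
Import Order.TTheory GRing.Theory Num.Theory.
Import numFieldNormedType.Exports.
Local Open Scope classical_set_scope.
Local Open Scope ring_scope.

Definition vec (R : realType) (n : nat) (z : n.-tuple R) : 'rV[R]_n :=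
  \row_i tnth z i.

Definition dot (R : realType) (n : nat) (u v : 'rV[R]_n) : R :=
  \sum_i u 0 i * v 0 i.

(* Euclidean: the norm [`|q|] of ['rV[R]_n] is the sup norm. *)
Definition unit_sphere (R : realType) (n : nat) : set 'rV[R]_n :=
  [set q | dot q q = 1].

Section QuantileRatio.
Context {R : realType}.
Implicit Types F G : R -> R.

(* Only used for t in ]0, 1[, where the set is nonempty and bounded below as
   soon as F is a cdf. *)
Definition quantile F (t : R) : R := inf [set x | t <= F x].

Definition tail_ratio (a : R) F G : R :=
  (\int[lebesgue_measure]_(t in `]a, 1[) quantile F t) /
  (\int[lebesgue_measure]_(t in `]a, 1[) quantile G t).

Definition inf_ratio F G : \bar R :=
  ereal_inf [set (tail_ratio a F G)%:E | a in `]0, 1[].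

End QuantileRatio.

(* Cdf of f(Z) for Z distributed according to mu. *)
Definition cdf_of d (T : measurableType d) (R : realType)
    (mu : {measure set T -> \bar R}) (f : T -> R) (t : R) : R :=
  fine (mu [set z | f z <= t]).

(* [k x] is a version of the conditional distribution of A given C = x. *)
Definition is_cond_law d d1 d2 (Omega : measurableType d)
    (T1 : measurableType d1) (T2 : measurableType d2) (R : realType)
    (P : probability Omega R) (A : Omega -> T1) (C : Omega -> T2)
    (k : R.-pker T2 ~> T1) : Prop :=
  forall B D, measurable B -> measurable D ->
  P (A @^-1` B `&` C @^-1` D) = (\int[P]_(w in C @^-1` D) k (C w) B)%E.

(* E(Y | W) = h(W) almost surely. *)
Definition is_cond_exp d d1 (Omega : measurableType d)
    (T1 : measurableType d1) (R : realType) (P : probability Omega R)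
    (Y : Omega -> R) (W : Omega -> T1) (h : T1 -> R) : Prop :=
  [/\ P.-integrable setT (EFin \o Y),
      measurable_fun setT h,
      P.-integrable setT (EFin \o (h \o W)) &
      forall B, measurable B ->
      (\int[P]_(w in W @^-1` B) (Y w)%:E =
       \int[P]_(w in W @^-1` B) (h (W w))%:E)%E].

Definition same_law d d' d1 (Omega : measurableType d)
    (Omega' : measurableType d') (T1 : measurableType d1) (R : realType)
    (P : probability Omega R) (X : Omega -> T1)
    (P' : probability Omega' R) (X' : Omega' -> T1) : Prop :=
  forall B, measurable B -> P (X @^-1` B) = P' (X' @^-1` B).

(* Conditional objects given X_c = x, computed from versions kY and kX of the
   conditional distributions of Y and X_nc given X_c. *)
Section Conditional.
Context {R : realType} {p m : nat}.
Variable kY : R.-pker m.-tuple R ~> R.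
Variable kX : R.-pker m.-tuple R ~> p.-tuple R.
Implicit Type x : m.-tuple R.

Definition cmeanY x : R := \int[kY x]_y y.

Definition cmeanX x : 'rV[R]_p := \row_i \int[kX x]_z tnth z i.

Definition cvarX x : 'M[R]_p :=
  \matrix_(i, j) \int[kX x]_z
    ((vec z - cmeanX x) 0 i * (vec z - cmeanX x) 0 j).

Definition cdfYx x : R -> R := cdf_of (kY x) (fun y => y - cmeanY x).

Definition cdfXxq (q : 'rV[R]_p) x : R -> R :=
  cdf_of (kX x) (fun z => dot (vec z - cmeanX x) q).

(* Conditional distributions given X_c = x are determined only for almost
   every x of the support of X_c (changing them on a null set changes a
   pointwise infimum arbitrarily), so the infimum over the support is the
   essential one with respect to the law muC of X_c.  It is the plain infimum
   over the support when X_c is discrete: see [ess_inf_atoms]. *)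
Definition Sbar (muC : {measure set (m.-tuple R) -> \bar R})
    (q : 'rV[R]_p) : \bar R :=
  ess_inf muC (fun x => inf_ratio (cdfYx x) (cdfXxq q x)).

End Conditional.

Lemma ess_inf_atoms d (T : measurableType d) (R : realType)
    (mu : {measure set T -> \bar R}) (D : set T) (f : T -> \bar R) :
  mu.-negligible (~` D) -> (forall x, D x -> ~ mu.-negligible [set x]) ->
  ess_inf mu f = ereal_inf [set f x | x in D].
Proof.
move=> negD atomD; apply/eqP; rewrite eq_le; apply/andP; split.
- apply: ge_ereal_sup => y /= fy.
  apply: le_ereal_inf_tmp => _ [x Dx <-]; rewrite leNgt; apply/negP => fxy.
  apply: (atomD _ Dx); apply: negligibleS fy => z /= -> /(lt_le_trans fxy).
  by rewrite ltxx.
- apply: ereal_sup_ubound => /=; apply: negligibleS negD => x /= ninf Dx.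
  by apply: ninf; apply: ereal_inf_lbound; exists x.
Qed.

Section IdentifiedSet.
Context d {Omega : measurableType d} {R : realType} {p m : nat}.
Variable P : probability Omega R.
Variables (Y : {RV P >-> R}) (Xnc : {RV P >-> p.-tuple R})
  (Xc : {RV P >-> m.-tuple R}).

Definition partially_linear (b : 'rV[R]_p) (g : m.-tuple R -> R)
  (x : p.-tuple R * m.-tuple R) : R := g x.2 + dot (vec x.1) b.

Definition identified (b : 'rV[R]_p) (g : m.-tuple R -> R) : Prop :=
  exists (d' : measure_display) (Omega' : measurableType d')
    (P' : probability Omega' R) (Y' : {RV P' >-> R})
    (Xnc' : {RV P' >-> p.-tuple R}) (Xc' : {RV P' >-> m.-tuple R}),
  [/\ same_law P' (fun w => (Y' w, Xc' w)) P (fun w => (Y w, Xc w)),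
      same_law P' (fun w => (Xnc' w, Xc' w)) P (fun w => (Xnc w, Xc w)) &
      is_cond_exp P' Y' (fun w => (Xnc' w, Xc' w)) (partially_linear b g)].

Definition Bc : set 'rV[R]_p := [set b | exists g, identified b g].

Definition Fset : set (m.-tuple R -> R) := [set g | exists b, identified b g].

End IdentifiedSet.

(* Main.v *)
(* Let T_Z(a) be the integral over ]a, 1[ of the quantile function of Z.  A vector
   b is identified iff, for almost every x and all a in ]0, 1[, T(a) is at most as
   large for X^x'b as for Y^x (conditionally on X_c = x), that is, X^x'b is
   dominated by Y^x in the convex order.

   Necessity is Jensen's inequality for the functions (. - c)^+, together with
   T_Z(a) = min_c [c (1 - a) + E (Z - c)^+].

   Sufficiency comes from an explicit martingale coupling.  Fix x, let a and c be
   the quantile functions of Y^x and X^x'b, and let U be the (randomized) rank of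
   X^x'b, which is uniform on ]0, 1[ and satisfies c(U) = X^x'b.  The positive and
   negative parts of c - a have the same integral; let phi exchange the points of
   {c > a} and {c < a} having the same cumulated mass of (c - a)^+, respectively
   (c - a)^-.  By dominance, phi moves the points of {c > a} to the right, so
   rho := (c - a) / (a o phi - a) lies in [0, 1].  Replacing U by phi(U) with
   probability rho(U) preserves the uniform law, because phi is an involution
   preserving the measure rho(u) du, and E(a(V) | U) = c(U) for the new rank V.
   Hence a(V) has the law of Y^x and conditional mean X^x'b.

   T is sublinear and continuous in b, and positive for b <> 0 because the
   conditional variance of X is nonsingular: this gives the ratio formula,
   convexity and compactness. *)
Require Import Defs.
From HB Require Import structures.
From mathcomp Require Import all_boot all_order all_algebra.
From mathcomp Require Import all_classical all_reals all_analysis ess_sup_inf.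
From mathcomp Require Import measurable_realfun ring lra.
Set Implicit Arguments.
Unset Strict Implicit.
Unset Printing Implicit Defensive.
Import Order.TTheory GRing.Theory Num.Theory.
Import numFieldNormedType.Exports.
Local Open Scope classical_set_scope.
Local Open Scope ring_scope.

(** * Quantile functions *)

(** Sufficiency is Strassen's theorem, needed for almost all values of [Xc] at once. Abstract
    existence for each [x] would leave a measurable selection to make; the coupling is therefore
    written with quantile functions and ranks, whose formulas are measurable in [(x, u)] jointly.
    The new sample space is [Omega] with two independent uniform variables, one to break the ties of
    the rank, one to decide whether the rank is exchanged. [Xnc] and [Xc] are kept as they are, so
    only the law of [(Y, Xc)] has to be rebuilt.

    Why [phi] overshoots: if [a u < c u] and [v = phi u], then [u <= v] and [c] is nondecreasing, so
    [a u < c u <= c v < a v]. Read from [v], the same chain handles [{c < a}]. These relations hold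
    off null sets only; they are proved in terms of the common cumulated mass [t] and then carried
    back to [u].

    Null sets of [x] are the other difficulty, because they depend on the level and on [b]. Rational
    levels of the stop-loss functions, and sequences of parameters in the topological part, keep the
    unions countable. *)

Section QuantileTransform.
Context {R : realType}.

Lemma measure_bigcap_ge d (T : measurableType d)
    (mu : {measure set T -> \bar R}) (A : (set T)^nat) (s : R) :
  (mu (A 0%N) < +oo)%E -> (forall n, measurable (A n)) ->
  (forall n k, (n <= k)%N -> A k `<=` A n) ->
  (forall n, s%:E <= mu (A n))%E -> (s%:E <= mu (\bigcap_n A n))%E.
Proof.
move=> A0 mA ndA sA.
have cA : mu (A n) @[n --> \oo] --> mu (\bigcap_n A n).
  apply: nonincreasing_cvg_mu => //; first exact: bigcapT_measurable.
  by move=> n k nk; apply/subsetPset; exact: ndA.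
rewrite -(cvg_lim _ cA)//; apply: lime_ge; first by apply/cvg_ex; exists (mu (\bigcap_n A n)).
exact: nearW.
Qed.

Lemma measure_bigcup_le d (T : measurableType d)
    (mu : {measure set T -> \bar R}) (A : (set T)^nat) (s : R) :
  (forall n, measurable (A n)) ->
  (forall n k, (n <= k)%N -> A n `<=` A k) ->
  (forall n, mu (A n) <= s%:E)%E -> (mu (\bigcup_n A n) <= s%:E)%E.
Proof.
move=> mA ndA sA.
have cA : mu (A n) @[n --> \oo] --> mu (\bigcup_n A n).
  apply: nondecreasing_cvg_mu => //; first exact: bigcupT_measurable.
  by move=> n k nk; apply/subsetPset; exact: ndA.
rewrite -(cvg_lim _ cA)//; apply: lime_le; first by apply/cvg_ex; exists (mu (\bigcup_n A n)).
exact: nearW.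
Qed.

Variables (mu : {measure set R -> \bar R}) (M : R) (F : R -> R).
Hypothesis muT : mu setT = M%:E.
Hypothesis muF : forall u, mu `]-oo, u]%classic = (F u)%:E.

Lemma dfun_nd : {homo F : u v / u <= v}.
Proof.
move=> u v uv; rewrite -lee_fin -!muF; apply: le_measure; rewrite ?inE//.
by apply: subset_itvl; rewrite bnd_simp.
Qed.

Lemma dfun_ge0 u : 0 <= F u.
Proof. by rewrite -lee_fin -muF. Qed.

Lemma dfun_leM u : F u <= M.
Proof. by rewrite -lee_fin -muF -muT; apply: le_measure; rewrite ?inE. Qed.

Lemma dfun_unreached s : 0 < s < M -> exists u, s <= F u.
Proof.
move=> /andP[s0 sM]; apply: contrapT => /forallNP h.
suff : (mu (\bigcup_n `]-oo, n%:R%R]%classic) <= s%:E)%E.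
  rewrite (_ : \bigcup_n _ = setT) ?muT ?lee_fin ?leNgt ?sM//.
  rewrite -subTset => x _; exists (Num.truncn `|x|).+1 => //=.
  by rewrite in_itv/= (le_trans (ler_norm x))// ltW// truncnS_gt.
apply: measure_bigcup_le => // [n k nk|n].
  by apply: subset_itvl; rewrite bnd_simp ler_nat.
by rewrite muF lee_fin ltW// ltNge; exact/negP/h.
Qed.

Lemma dfun_bounded_below s : 0 < s < M -> has_lbound [set u | s <= F u].
Proof.
move=> /andP[s0 sM]; apply: contrapT => nlb.
suff : (s%:E <= mu (\bigcap_n `]-oo, (- n%:R)%R]%classic))%E.
  rewrite (_ : \bigcap_n _ = set0) ?measure0 ?lee_fin ?leNgt ?s0//.
  rewrite -subset0 => x /(_ (Num.truncn `|x|).+1 I) /=.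
  rewrite in_itv/= lerNr => h.
  have := lt_le_trans (truncnS_gt `|x|) h.
  by rewrite -normrN ltNge ler_norm.
apply: measure_bigcap_ge => // [|n k nk|n].
- by rewrite muF ltry.
- by apply: subset_itvl; rewrite bnd_simp lerN2 ler_nat.
rewrite muF lee_fin; apply: contrapT => /negP; rewrite -ltNge => Fs.
apply: nlb; exists (- n%:R) => u /= su; rewrite leNgt; apply/negP => un.
by have := le_trans su (dfun_nd (ltW un)); rewrite leNgt Fs.
Qed.

(** The infimum is attained because [F] is right-continuous, which is continuity from above of [mu]
    along []-oo, u + 1/(n+1)]]. The total mass [M] is left arbitrary: besides probability laws, the
    lemma serves the measures with density [(c - a)^+] and [(c - a)^-]. *)
Lemma quantile_le s u : 0 < s < M -> (quantile F s <= u) = (s <= F u).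
Proof.
move=> sM; have lb := dfun_bounded_below sM.
apply/idP/idP => [qu|su]; last exact: ge_inf.
rewrite -lee_fin -muF (itvNycEbigcap false).
apply: measure_bigcap_ge => // [|n k nk|n].
- by rewrite muF ltry.
- by apply: subset_itvl; rewrite bnd_simp lerD2l lef_pV2 ?posrE// ler_nat.
rewrite muF lee_fin.
have qn : quantile F s < u + n.+1%:R^-1 by rewrite (le_lt_trans qu)// ltrDl.
have [v /= sv vu] := inf_lt (dfun_unreached sM) qn.
by rewrite (le_trans sv)// dfun_nd// ltW.
Qed.

Lemma quantile_nd s t : 0 < s -> s <= t -> t < M ->
  quantile F s <= quantile F t.
Proof.
move=> s0 st tM; rewrite quantile_le ?s0 ?(le_lt_trans st)//.
by rewrite (le_trans st)// -quantile_le// tM (lt_le_trans s0).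
Qed.

End QuantileTransform.

(* [quantile] at the level [M * t], set to 0 where its value is not controlled. *)
Definition tquantile (R : realType) (F : R -> R) (M t : R) : R :=
  if [&& 0 < M, 0 < t & t < 1] then quantile F (M * t) else 0.

Section MeasurableQuantile.
Context {R : realType} d (X : measurableType d).
Variables (F : X -> R -> R) (M : X -> R).
Hypothesis mF : forall u, measurable_fun setT (F ^~ u).
Hypothesis mM : measurable_fun setT M.
Hypothesis qF : forall x t u, 0 < M x -> 0 < t < 1 ->
  (quantile (F x) (M x * t) <= u) = (M x * t <= F x u).

(** For fixed [u], the Galois connection [qF] turns [u < quantile] into the single inequality
    [F x u < M x * t]. Joint measurability in [(x, t)] thus only asks for measurability of [F] in
    [x] at each [u]. *)
Lemma measurable_tquantile :
  measurable_fun setT (fun xt : X * R => tquantile (F xt.1) (M xt.1) xt.2).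
Proof.
apply: (measurability (@RGenOInfty.G R)).
  exact: RGenOInfty.measurableE.
move=> /= _ [_ [u ->] <-]; rewrite setTI.
(* The branch [u < 0] accounts for the default value 0 of [tquantile]. *)
have -> : (fun xt : X * R => tquantile (F xt.1) (M xt.1) xt.2) @^-1` `]u, +oo[ =
   (fun xt : X * R => if [&& 0 < M xt.1, 0 < xt.2 & xt.2 < 1] then F xt.1 u < M xt.1 * xt.2
                      else u < 0) @^-1` [set true].
  apply/seteqP; split=> -[x s]/=; rewrite in_itv/= andbT /tquantile;
  case: ifPn => // /andP[M0 t01]; by rewrite !ltNge qF.
rewrite -[X in measurable X]setTI.
have m1 : measurable_fun setT (fst : X * R -> X) by exact: measurable_fst.
have m2 : measurable_fun setT (snd : X * R -> R) by exact: measurable_snd.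
apply: (measurable_fun_ifT _ _ _ _ _) => //.
  apply: measurable_and; last by apply: measurable_and; apply: measurable_fun_ltr.
  by apply: measurable_fun_ltr => //; exact: measurableT_comp mM m1.
apply: measurable_fun_ltr; first exact: measurableT_comp (mF u) m1.
by apply: measurable_funM => //; exact: measurableT_comp mM m1.
Qed.

End MeasurableQuantile.

Section IntegralRestriction.
Context {R : realType} d (T : measurableType d).

Lemma ge0_integral_mrestr (mu : {measure set T -> \bar R}) (D : set T)
    (mD : measurable D) (f : T -> \bar R) :
  measurable_fun setT f -> (forall x, 0 <= f x)%E ->
  (\int[mrestr mu mD]_x f x = \int[mu]_(x in D) f x)%E.
Proof.
move=> mf f0.
rewrite -(setUv D) ge0_integral_setU//=; last 3 first.
- exact: measurableC.
- by rewrite setUv.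
- exact/disj_setPCl.
rewrite [X in (_ + X)%E](_ : _ = 0%E).
  rewrite adde0; apply: eq_measure_integral => A mA AD /=.
  by rewrite /mrestr setIidl.
apply: null_set_integral => //; first exact: measurableC.
- exact: measurable_funTS.
change (mu (~` D `&` D) = 0%E).
by rewrite setICl measure0.
Qed.

End IntegralRestriction.

(* The uniform distribution on ]0, 1[, carried by the Borel space [R] itself
   instead of its alias [measurableTypeR R]. *)
Definition unif01 (R : realType) (A : set R) : \bar R :=
  lebesgue_measure (A `&` `]0, 1[%classic).

Section Uniform.
Context {R : realType}.
Local Notation leb := (@lebesgue_measure R).

Let m01 : @measurable _ (measurableTypeR R) `]0, 1[%classic.
Proof. by []. Qed.

Let unif01_0 : unif01 (set0 : set R) = 0%E.
Proof. by rewrite /unif01 set0I measure0. Qed.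

Let unif01_ge0 (A : set R) : (0 <= unif01 A)%E.
Proof. exact: measure_ge0. Qed.

Let unif01_sigma_additive : semi_sigma_additive (@unif01 R).
Proof. exact: (@measure_semi_sigma_additive _ _ _ (mrestr leb m01)). Qed.

HB.instance Definition _ := isMeasure.Build _ _ _ (@unif01 R)
  unif01_0 unif01_ge0 unif01_sigma_additive.

Let unif01_setT : unif01 [set: R] = 1%:E.
Proof. by rewrite /unif01 setTI lebesgue_measure_itv/= lte_fin ltr01 sube0. Qed.

HB.instance Definition _ := @Measure_isProbability.Build _ _ R
  (@unif01 R) unif01_setT.

Definition unif : probability R R := @unif01 R.

Lemma unif_itv01 : unif `]0, 1[%classic = 1%E.
Proof.
by rewrite /unif/= /unif01 setIid lebesgue_measure_itv/= lte_fin ltr01 sube0.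
Qed.

Lemma unif_itv01C : unif (~` `]0, 1[%classic) = 0%E.
Proof. by rewrite /unif/= /unif01 setICl measure0. Qed.

Lemma unif_le u : 0 <= u <= 1 -> unif `]-oo, u]%classic = u%:E.
Proof.
move=> /andP[u0 u1]; rewrite /unif/= /unif01.
have [->|u1'] := eqVneq u 1.
  rewrite setIidr; first by rewrite lebesgue_measure_itv/= lte_fin ltr01 sube0.
  by move=> x /=; rewrite !in_itv/= => /andP[_ /ltW].
rewrite (_ : _ `&` _ = `]0, u]%classic).
  rewrite lebesgue_measure_itv/= lte_fin; case: ltP => [_|u0']; first by rewrite sube0.
  by congr EFin; apply/eqP; rewrite eq_le u0 u0'.
apply/seteqP; split=> x /=; rewrite !in_itv/=.
  by move=> [xu /andP[-> _]].
move=> /andP[x0 xu]; by rewrite x0 xu (le_lt_trans xu)// lt_neqAle u1'.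
Qed.

Lemma unif_ge u : 0 <= u <= 1 -> unif `]u, +oo[%classic = (1 - u)%:E.
Proof.
move=> /andP[u0 u1]; rewrite /unif/= /unif01.
rewrite (_ : _ `&` _ = `]u, 1[%classic).
  rewrite lebesgue_measure_itv/= lte_fin; case: ltP => [_|u0'] //.
  by congr EFin; apply/esym/eqP; rewrite subr_eq0 eq_le u1 u0'.
apply/seteqP; split=> x /=; rewrite !in_itv/= ?andbT.
  by move=> [-> /andP[_ ->]].
move=> /andP[ux x1]; by rewrite ux x1 (le_lt_trans u0).
Qed.

Lemma unif_set1 u : unif [set u] = 0%E.
Proof.
apply/eqP; rewrite eq_le measure_ge0 andbT.
rewrite -(lebesgue_measure_set1 u); apply: le_measure; rewrite ?inE//.
exact: measurableI.
Qed.

Lemma measureIl01 (A : set R) : measurable A ->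
  unif A = unif (A `&` `]0, 1[%classic).
Proof. by move=> mA; rewrite /unif/= /unif01 -setIA setIid. Qed.

Lemma ge0_integral_unif (f : R -> \bar R) :
  measurable_fun setT f -> (forall x, 0 <= f x)%E ->
  (\int[unif]_x f x = \int[leb]_(x in `]0%R, 1%R[) f x)%E.
Proof.
move=> mf f0.
(* The identity, seen as a map from [measurableTypeR R] to [R], pushes the restricted Lebesgue
   measure to [unif]. *)
have mid : measurable_fun setT (fun x : measurableTypeR R => (x : R)) by [].
rewrite -(ge0_integral_mrestr leb m01)//.
by rewrite -[RHS](ge0_integral_pushforward mid (mrestr leb m01) measurableT).
Qed.

Lemma integral_unif (f : R -> \bar R) : measurable_fun setT f ->
  (\int[unif]_x f x = \int[leb]_(x in `]0%R, 1%R[) f x)%E.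
Proof.
move=> mf; rewrite integralE [RHS]integralE !ge0_integral_unif//.
exact: measurable_funeneg.
exact: measurable_funepos.
Qed.

End Uniform.

Definition mkmfun d d' (T : measurableType d) (T' : measurableType d')
    (f : T -> T') (mf : measurable_fun setT f) : {mfun T >-> T'} :=
  HB.pack f (isMeasurableFun.Build _ _ _ _ f mf).

Section QuantileLaw.
Context {R : realType}.
Variables (mu : {measure set R -> \bar R}) (M : R) (F : R -> R).
Hypothesis M0 : 0 < M.
Hypothesis muT : mu setT = M%:E.
Hypothesis muF : forall u, mu `]-oo, u]%classic = (F u)%:E.

Lemma quantile_scaled_le t u : 0 < t < 1 ->
  (quantile F (M * t) <= u) = (M * t <= F u).
Proof.
move=> /andP[t0 t1]; apply: (quantile_le muT muF).
by rewrite mulr_gt0//= gtr_pMr.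
Qed.

Lemma measurable_tquantile1 : measurable_fun setT (tquantile F M).
Proof.
have := @measurable_tquantile R _ R (fun=> F) (fun=> M).
move=> /(_ (fun=> measurable_cst _) (measurable_cst _)).
move=> /(_ (fun _ t u _ t01 => quantile_scaled_le u t01)).
by move=> /(measurable_fun_pair2 (0 : R)).
Qed.

(** Inverse transform sampling for a measure of mass [M]. The half-lines []u, +oo[] form a
    generating pi-system, and within []0, 1[] the Galois connection identifies the preimage of []u,
    +oo[] with the levels above [F u / M]. *)
Lemma quantile_law (A : set R) : measurable A ->
  mu A = (M%:E * unif (tquantile F M @^-1` A))%E.
Proof.
move=> mA; have mq := measurable_tquantile1.
pose nu : {measure set R -> \bar R} :=
  mscale (NngNum (ltW M0)) (distribution unif (mkmfun mq)).
suff : mu A = nu A by [].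
refine (@measure_unique _ R _ (@RGenOInfty.G R) (fun n => `]- n%:R, +oo[%classic)
  _ _ _ _ mu nu _ _ A mA) => //.
- exact: RGenOInfty.measurableE.
- move=> _ _ [x ->] [y ->]; exists (Num.max x y).
  by apply/seteqP; split => z /=; rewrite !in_itv/= !andbT gt_max => /andP.
- by move=> n; exists (- n%:R).
- rewrite -subTset => x _; exists (Num.truncn `|x|).+1 => //=.
  by rewrite in_itv/= andbT ltrNl (le_lt_trans _ (truncnS_gt _))// -normrN ler_norm.
- move=> _ [u ->].
  have -> : mu `]u, +oo[%classic = (M - F u)%:E.
    have muoo : (mu setT < +oo)%E by rewrite muT ltry.
    rewrite EFinB -muT -muF -setCitvl -setTD.
    by rewrite (measureD measurableT _ muoo)// setTI.
  have FuM : F u / M <= 1 by rewrite ler_pdivrMr// mul1r (dfun_leM muT muF).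
  have Fu0 : 0 <= F u / M by rewrite divr_ge0// ?(dfun_ge0 muF)// ltW.
  suff E : unif (tquantile F M @^-1` `]u, +oo[) = (1 - F u / M)%:E.
    change ((M - F u)%:E = (M%:E * unif (tquantile F M @^-1` `]u, +oo[))%E).
    by rewrite E -EFinM mulrBr mulr1 mulrCA divff ?mulr1// gt_eqF.
  rewrite -unif_ge ?Fu0//.
  (* Both sets are cut down to []0, 1[]: outside, [tquantile] only has its default value. *)
  rewrite (@measureIl01 _ `]F u / M, +oo[%classic)//.
  rewrite [LHS]measureIl01//.
    congr (unif _); apply/seteqP; split => t /=; rewrite !in_itv/= !andbT.
      move=> [] + t01; rewrite /tquantile M0 t01 ltNge quantile_scaled_le// -ltNge.
      by rewrite -ltr_pdivrMl// mulrC.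
    move=> [ut t01]; split=> //; rewrite /tquantile M0 t01 ltNge quantile_scaled_le//.
    by rewrite -ltNge -ltr_pdivrMl// mulrC.
  by rewrite -[X in measurable X]setTI; exact: measurable_tquantile1.
- by move=> k; rewrite (le_lt_trans _ (ltry M))// -muT; apply: le_measure; rewrite ?inE.
Qed.

Lemma quantile_transform (psi : R -> \bar R) :
  measurable_fun setT psi -> (forall x, 0 <= psi x)%E ->
  (\int[mu]_x psi x = M%:E * \int[unif]_t psi (tquantile F M t))%E.
Proof.
move=> mpsi psi0; have mq := measurable_tquantile1.
have := ge0_integral_distribution (mkmfun mq : {RV unif >-> R}) mpsi psi0.
move=> /= <-.
rewrite -(@ge0_integral_mscale _ _ _ (distribution unif (mkmfun mq)) setT measurableT (NngNum (ltW M0)) psi)//.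
by apply: eq_measure_integral => /= A mA _; exact: quantile_law.
Qed.

End QuantileLaw.

Section UnifIntegral.
Context {R : realType}.
Implicit Types f g : R -> R.

Lemma unif_ae01 : \forall t \ae (@unif R), 0 < t < 1.
Proof.
exists (~` `]0, 1[%classic); split=> //=; first exact: measurableC.
  exact: unif_itv01C.
Qed.

Lemma eq_Rintegral_unif f g : measurable_fun setT f -> measurable_fun setT g ->
  (forall t, 0 < t < 1 -> f t = g t) ->
  \int[unif]_t f t = \int[unif]_t g t.
Proof.
move=> mf mg fg; congr fine; apply: ae_eq_integral => //.
- exact/measurable_EFinP.
- exact/measurable_EFinP.
by apply: filterS unif_ae01 => t /fg /= ->.
Qed.

Lemma le_Rintegral_unif f g : unif.-integrable setT (EFin \o f) ->
  unif.-integrable setT (EFin \o g) ->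
  (forall t, 0 < t < 1 -> f t <= g t) ->
  \int[unif]_t f t <= \int[unif]_t g t.
Proof.
move=> intf intg fg.
(* [h] dominates [f] at every point, as monotonicity of the integral requires, and agrees with [g]
   on []0, 1[]. *)
pose h t := Num.max (f t) (g t).
have mf : measurable_fun setT f by move/measurable_int : intf => /measurable_EFinP.
have mg : measurable_fun setT g by move/measurable_int : intg => /measurable_EFinP.
have mh : measurable_fun setT h by exact: measurable_maxr.
have E : \int[unif]_t g t = \int[unif]_t h t.
  by apply: eq_Rintegral_unif => // t /fg; rewrite /h => /max_idPr.
have inth : unif.-integrable setT (EFin \o h).
  apply: (@le_integrable _ _ _ _ _ measurableT _ (fun t => (`|f t| + `|g t|)%:E)) => //.
  - exact/measurable_EFinP.
  - move=> t _ /=; rewrite lee_fin [leRHS]ger0_norm ?addr_ge0// /h.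
    by case: (leP (f t) (g t)) => _; rewrite ?lerDl ?lerDr.
  - under eq_fun do rewrite EFinD.
    by apply: integrableD => //; exact: integrable_norm.
rewrite E; apply: le_Rintegral => // t _.
by rewrite /h le_max lexx.
Qed.

End UnifIntegral.

(** * Upper tail integrals *)

Definition tail_integral (R : realType) (F : R -> R) (a : R) : R :=
  \int[lebesgue_measure]_(t in `]a, 1[) quantile F t.

Section Law.
Context {R : realType} d (T : measurableType d) (mu : probability T R).
Variable zeta : T -> R.
Hypothesis mzeta : measurable_fun setT zeta.

Let F := cdf_of mu zeta.
Let Q := tquantile F 1.
Let law : probability R R := distribution mu (mkmfun mzeta : {RV mu >-> R}).

Lemma lawT : law setT = 1%:E.
Proof. exact: probability_setT. Qed.

Lemma lawF u : law `]-oo, u]%classic = (F u)%:E.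
Proof.
rewrite /F /cdf_of fineK; last first.
  apply: fin_num_measure; rewrite -[X in measurable X]setTI.
  rewrite (_ : [set z | zeta z <= u] = zeta @^-1` `]-oo, u]%classic); first exact: mzeta.
  by apply/seteqP; split => z /=; rewrite in_itv.
congr (mu _); apply/seteqP; split => z /=; by rewrite in_itv.
Qed.

Lemma quantile_cdf_le t u : 0 < t < 1 -> (quantile F t <= u) = (t <= F u).
Proof. exact: (quantile_le lawT lawF u). Qed.

Lemma cdf_nd : {homo F : u v / u <= v}.
Proof. exact: dfun_nd lawF. Qed.

Lemma measurable_quantile_cdf : measurable_fun setT Q.
Proof. exact: (measurable_tquantile1 ltr01 lawT lawF). Qed.

Lemma tquantile_nd s t : 0 < s -> s <= t -> t < 1 -> Q s <= Q t.
Proof.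
move=> s0 st t1; rewrite /Q /tquantile ltr01 s0 t1 (lt_le_trans s0 st) (le_lt_trans st t1) !mul1r/=.
exact: (quantile_nd lawT lawF).
Qed.

Lemma cdf_transform (psi : R -> \bar R) : measurable_fun setT psi ->
  (forall x, 0 <= psi x)%E ->
  (\int[mu]_z psi (zeta z) = \int[unif]_t psi (Q t))%E.
Proof.
move=> mpsi psi0.
have := quantile_transform ltr01 lawT lawF mpsi psi0.
by rewrite mul1e ge0_integral_distribution.
Qed.

Lemma integrable_cdf_transform (g : R -> R) : measurable_fun setT g ->
  mu.-integrable setT (EFin \o g \o zeta) ->
  unif.-integrable setT (EFin \o g \o Q).
Proof.
move=> mg /integrableP[_ ig]; apply/integrableP; split.
  by apply/measurable_EFinP; apply: measurableT_comp => //; exact: measurable_quantile_cdf.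
rewrite -(cdf_transform (psi := fun x => `|(g x)%:E|%E))//.
by apply: measurableT_comp => //; exact/measurable_EFinP.
Qed.

Lemma Rintegral_cdf_transform (g : R -> R) : measurable_fun setT g ->
  mu.-integrable setT (EFin \o g \o zeta) ->
  \int[mu]_z g (zeta z) = \int[unif]_t g (Q t).
Proof.
move=> mg ig; congr fine.
have mg' : measurable_fun setT (EFin \o g) by exact/measurable_EFinP.
have iq := integrable_cdf_transform mg ig.
have := @integral_distribution _ _ _ _ _ mu (mkmfun mzeta) _ mg' ig.
have := @integral_distribution _ _ _ _ _ unif (mkmfun measurable_quantile_cdf) _ mg' iq.
move=> /= <- <-; apply: eq_measure_integral => A mA _.
by have /= := quantile_law ltr01 lawT lawF mA; rewrite mul1e.
Qed.

Lemma tail_integral_unif a : 0 <= a ->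
  tail_integral F a = \int[unif]_(t in `]a, +oo[) Q t.
Proof.
move=> a0; rewrite [RHS]Rintegral_mkcond /tail_integral; congr fine.
have mQ := measurable_quantile_cdf.
rewrite integral_unif; last first.
  apply/measurable_EFinP; apply/(measurable_restrictT _ _).1 => //.
  exact: measurable_funTS.
rewrite (_ : (fun x => ((Q \_ _) x)%:E) = (EFin \o Q) \_ `]a, +oo[%classic); last first.
  by apply/funext => t; rewrite /= !patchE; case: ifPn.
rewrite -integral_mkcondr.
rewrite (_ : _ `&` _ = `]a, 1[%classic).
  apply: eq_integral => t; rewrite inE/= in_itv/= => /andP[ta t1].
  by rewrite /Q /tquantile ltr01 (le_lt_trans a0 ta) t1 mul1r.
apply/seteqP; split => t /=; rewrite !in_itv/= ?andbT.
  by move=> [/andP[_ ->]] ->.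
by move=> /andP[ta ->]; rewrite ta (le_lt_trans a0 ta).
Qed.

Hypothesis izeta : mu.-integrable setT (EFin \o zeta).

Lemma integrable_stop_loss c :
  mu.-integrable setT (EFin \o (fun z => Num.max (zeta z - c) 0)).
Proof.
apply: (@le_integrable _ _ _ _ _ measurableT _ (fun z => (`|zeta z| + `|c|)%:E)) => //.
- apply/measurable_EFinP; apply: measurable_maxr => //.
  exact: measurable_funB.
- move=> t _ /=; rewrite lee_fin ger0_norm ?le_max ?lexx ?orbT// ger0_norm ?addr_ge0//.
  rewrite ge_max addr_ge0// andbT lerD ?ler_norm//.
  by rewrite -normrN ler_norm.
- under eq_fun do rewrite EFinD.
  apply: integrableD => //; first exact: integrable_norm.
  exact: finite_measure_integrable_cst.
Qed.

Definition stop_loss c : R := \int[mu]_z Num.max (zeta z - c) 0.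

Let mpos c : measurable_fun setT (fun y : R => Num.max (y - c) 0).
Proof. by apply: measurable_maxr => //; exact: measurable_funB. Qed.

Let iQ : unif.-integrable setT (EFin \o Q).
Proof. exact: (integrable_cdf_transform (g := id)). Qed.

Let iposQ c : unif.-integrable setT (EFin \o (fun t => Num.max (Q t - c) 0)).
Proof.
exact: (integrable_cdf_transform (mpos c) (integrable_stop_loss c)).
Qed.

Lemma tail_integral_cst a c : 0 < a < 1 ->
  tail_integral F a = c * (1 - a) +
    \int[unif]_t ((fun t => Q t - c) \_ `]a, +oo[) t.
Proof.
move=> /andP[a0 a1]; rewrite tail_integral_unif; last exact: ltW.
rewrite -Rintegral_mkcond RintegralB//; last 2 first.
- exact: integrableS iQ.
- exact: finite_measure_integrable_cst.
rewrite Rintegral_cst//= [fine (unif _)](_ : _ = 1 - a).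
  ring.
by rewrite unif_ge// (ltW a0) ltW.
Qed.

Let irest a c : unif.-integrable setT (EFin \o ((fun t => Q t - c) \_ `]a, +oo[)).
Proof.
rewrite (_ : EFin \o _ = (EFin \o (fun t => Q t - c)) \_ `]a, +oo[%classic); last first.
  by apply/funext => t; rewrite /= !patchE; case: ifPn.
apply: (proj1 (integrable_mkcond _ (measurable_itv _))).
rewrite (_ : _ \o _ = (EFin \o Q) \- (EFin \o cst c))%E//.
apply: integrableB => //; first exact: integrableS iQ.
exact: finite_measure_integrable_cst.
Qed.

(** After subtraction of [c], whose integral over []a, 1[] is [c * (1 - a)], the integrand is at
    most its positive part above [a], and is replaced by 0 below. *)
Lemma tail_integral_le a c : 0 < a < 1 ->
  tail_integral F a <= c * (1 - a) + stop_loss c.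
Proof.
move=> a01; rewrite (tail_integral_cst c a01) lerD2l /stop_loss.
rewrite (Rintegral_cdf_transform (mpos c) (integrable_stop_loss c)).
apply: (le_Rintegral_unif (irest a c) (iposQ c)) => t t01.
rewrite patchE; case: ifPn => _; last by rewrite le_max lexx orbT.
by rewrite le_max lexx.
Qed.

(** The minimizing level is [c = Q a]: since [Q] is nondecreasing, cutting [Q - Q a] at [a] is the
    same as taking its positive part. *)
Lemma tail_integralE a : 0 < a < 1 ->
  exists c, tail_integral F a = c * (1 - a) + stop_loss c.
Proof.
move=> a01; exists (Q a); rewrite (tail_integral_cst (Q a) a01); congr +%R.
rewrite /stop_loss (Rintegral_cdf_transform (mpos _) (integrable_stop_loss _)).
case/andP: a01 => a0 a1.
apply: eq_Rintegral_unif => [||t /andP[t0 t1]].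
- by have /measurable_int/measurable_EFinP := irest a (Q a).
- by have /measurable_int/measurable_EFinP := iposQ (Q a).
rewrite patchE; case: ifPn; rewrite ?inE ?notin_setE/= in_itv/= andbT.
  by move=> /ltW at_; apply/esym/max_idPl; rewrite subr_ge0 tquantile_nd.
move=> /negP; rewrite -leNgt => ta; apply/esym/max_idPr.
by rewrite subr_le0 tquantile_nd.
Qed.

End Law.

Section TailOrder.
Context {R : realType} d (T : measurableType d) (mu : probability T R).
Implicit Types zeta : T -> R.

Lemma Rintegral_prob_cst c : \int[mu]_(z in setT) c = c.
Proof.
rewrite Rintegral_cst// (_ : fine _ = 1) ?mulr1//.
exact: (congr1 fine (probability_setT mu)).
Qed.

Lemma stop_loss_ge0 zeta c : 0 <= stop_loss mu zeta c.
Proof. by apply: Rintegral_ge0 => z _; rewrite le_max lexx orbT. Qed.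

Lemma stop_loss_ge_mean zeta c : mu.-integrable setT (EFin \o zeta) ->
  \int[mu]_z zeta z - c <= stop_loss mu zeta c.
Proof.
move=> iz; have mz : measurable_fun setT zeta.
  by move/measurable_int : iz => /measurable_EFinP.
rewrite -{1}(Rintegral_prob_cst c) -RintegralB//; last exact: finite_measure_integrable_cst.
apply: le_Rintegral => //.
- rewrite (_ : _ \o _ = (EFin \o zeta) \- (EFin \o cst c))%E//.
  by apply: integrableB => //; exact: finite_measure_integrable_cst.
- exact: integrable_stop_loss.
- by move=> z _; rewrite le_max lexx.
Qed.

Lemma tail_integral_mono d' (T' : measurableType d') (nu : probability T' R)
    zeta (eta : T' -> R) a :
  mu.-integrable setT (EFin \o zeta) -> nu.-integrable setT (EFin \o eta) ->
  (forall c, stop_loss mu zeta c <= stop_loss nu eta c) -> 0 < a < 1 ->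
  tail_integral (cdf_of mu zeta) a <= tail_integral (cdf_of nu eta) a.
Proof.
move=> iz ie sl a01.
have mz : measurable_fun setT zeta by move/measurable_int : iz => /measurable_EFinP.
have me : measurable_fun setT eta by move/measurable_int : ie => /measurable_EFinP.
(* The level that is optimal for [eta] is a competitor for [zeta]. *)
have [c ->] := tail_integralE me ie a01.
by rewrite (le_trans (tail_integral_le mz iz c a01))// lerD2l.
Qed.

Lemma tail_integral_le_abs zeta a : mu.-integrable setT (EFin \o zeta) ->
  0 < a < 1 -> tail_integral (cdf_of mu zeta) a <= \int[mu]_z `|zeta z|.
Proof.
move=> iz a01.
have mz : measurable_fun setT zeta by move/measurable_int : iz => /measurable_EFinP.
rewrite (le_trans (tail_integral_le mz iz 0 a01))// mul0r add0r.
apply: le_Rintegral => //; first exact: integrable_stop_loss.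
  exact: integrable_norm.
by move=> z _; rewrite subr0 ge_max normr_ge0 ler_norm.
Qed.

Lemma integrable_lin2 zeta1 zeta2 (s t : R) :
  mu.-integrable setT (EFin \o zeta1) -> mu.-integrable setT (EFin \o zeta2) ->
  mu.-integrable setT (EFin \o (fun z => s * zeta1 z + t * zeta2 z)).
Proof.
move=> i1 i2.
rewrite (_ : _ \o _ = (fun z => s%:E * (EFin \o zeta1) z)
   \+ (fun z => t%:E * (EFin \o zeta2) z))%E//.
by apply: integrableD => //; exact: integrableZl.
Qed.

Lemma Rintegral_lin2 zeta1 zeta2 (s t : R) :
  mu.-integrable setT (EFin \o zeta1) -> mu.-integrable setT (EFin \o zeta2) ->
  \int[mu]_z (s * zeta1 z + t * zeta2 z) =
  s * \int[mu]_z zeta1 z + t * \int[mu]_z zeta2 z.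
Proof.
move=> i1 i2; rewrite RintegralD ?RintegralZl//.
- rewrite (_ : _ \o _ = (fun z => s%:E * (EFin \o zeta1) z))%E//.
  exact: integrableZl.
- rewrite (_ : _ \o _ = (fun z => t%:E * (EFin \o zeta2) z))%E//.
  exact: integrableZl.
Qed.

Lemma tail_integral_sublinear zeta1 zeta2 s t a :
  mu.-integrable setT (EFin \o zeta1) -> mu.-integrable setT (EFin \o zeta2) ->
  0 <= s -> 0 <= t -> 0 < a < 1 ->
  tail_integral (cdf_of mu (fun z => s * zeta1 z + t * zeta2 z)) a <=
  s * tail_integral (cdf_of mu zeta1) a + t * tail_integral (cdf_of mu zeta2) a.
Proof.
move=> i1 i2 s0 t0 a01.
have m1 : measurable_fun setT zeta1 by move/measurable_int : i1 => /measurable_EFinP.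
have m2 : measurable_fun setT zeta2 by move/measurable_int : i2 => /measurable_EFinP.
have i := integrable_lin2 s t i1 i2.
have m : measurable_fun setT (fun z => s * zeta1 z + t * zeta2 z).
  by move/measurable_int : i => /measurable_EFinP.
have [c1 ->] := tail_integralE m1 i1 a01.
have [c2 ->] := tail_integralE m2 i2 a01.
(* The combination of the two optimal levels is a competitor for the combined variable; the rest is
   sublinearity of the positive part. *)
rewrite (le_trans (tail_integral_le m i (s * c1 + t * c2) a01))//.
have -> : s * (c1 * (1 - a) + stop_loss mu zeta1 c1) +
    t * (c2 * (1 - a) + stop_loss mu zeta2 c2) =
    (s * c1 + t * c2) * (1 - a) + (s * stop_loss mu zeta1 c1 + t * stop_loss mu zeta2 c2).
  by ring.
rewrite lerD2l /stop_loss -Rintegral_lin2//; [|exact: integrable_stop_loss..].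
apply: le_Rintegral => //; first exact: integrable_stop_loss.
  by apply: integrable_lin2; exact: integrable_stop_loss.
move=> z _; rewrite ge_max; apply/andP; split.
  have -> : s * zeta1 z + t * zeta2 z - (s * c1 + t * c2) =
     s * (zeta1 z - c1) + t * (zeta2 z - c2) by ring.
  by rewrite lerD// ler_wpM2l// le_max lexx.
by rewrite addr_ge0// mulr_ge0// le_max lexx orbT.
Qed.

(** With [sl] the stop-loss at [c], the tail integral is the convex combination
    [(1 - a) * (c + sl) + a * sl]. Jensen's inequality for a centered variable gives
    [0 <= c + sl]. *)
Lemma tail_integral_ge0 zeta a : mu.-integrable setT (EFin \o zeta) ->
  \int[mu]_z zeta z = 0 -> 0 < a < 1 -> 0 <= tail_integral (cdf_of mu zeta) a.
Proof.
move=> iz z0 a01.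
have mz : measurable_fun setT zeta by move/measurable_int : iz => /measurable_EFinP.
have [c ->] := tail_integralE mz iz a01; case/andP: a01 => a0 a1.
have := stop_loss_ge_mean c iz; rewrite z0 sub0r => h.
have h0 := stop_loss_ge0 zeta c; nra.
Qed.

(** Both terms of the convex combination [(1 - a) * (c + sl) + a * sl] must vanish, so [sl = 0] and
    [c = 0]: the positive part of [zeta] has mean 0, and then so does its negative part. *)
Lemma tail_integral_eq0 zeta a : mu.-integrable setT (EFin \o zeta) ->
  \int[mu]_z zeta z = 0 -> 0 < a < 1 -> tail_integral (cdf_of mu zeta) a = 0 ->
  \forall z \ae mu, zeta z = 0.
Proof.
move=> iz z0 a01.
have mz : measurable_fun setT zeta by move/measurable_int : iz => /measurable_EFinP.
have [c ->] := tail_integralE mz iz a01; case/andP: a01 => a0 a1.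
have := stop_loss_ge_mean c iz; rewrite z0 sub0r => h.
have h0 := stop_loss_ge0 zeta c => tail0.
have c0 : c = 0 by nra.
have sl0 : stop_loss mu zeta 0 = 0 by move: tail0; rewrite c0 mul0r add0r.
have ipos := integrable_stop_loss mz iz 0.
(* The absolute value is twice the positive part minus the variable itself. *)
have E : \int[mu]_z `|zeta z| = 0.
  rewrite (eq_Rintegral _ (g := fun z => 2 * Num.max (zeta z - 0) 0 + (- 1) * zeta z)).
    by rewrite Rintegral_lin2// -/(stop_loss mu zeta 0) sl0 z0 !mulr0 addr0.
  move=> z _; rewrite subr0; case: (leP 0 (zeta z)) => hz.
    rewrite ger0_norm//; ring.
  rewrite ltr0_norm//; ring.
have /(ae_eq_integral_abs _ measurableT _).1 : (\int[mu]_z `|(EFin \o zeta) z| = 0)%E.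
  have ia : mu.-integrable setT (EFin \o (fun z => `|zeta z|)) by exact: integrable_norm.
  have := integrable_fin_num measurableT ia.
  by move=> /fineK; rewrite -/(Rintegral _ _ _) E.
move=> h1; have {}h1 := h1 ((proj2 (measurable_EFinP _ _)) mz).
by apply: filterS h1 => z /(_ I) /= [].
Qed.

Lemma tail_integral_gt0 zeta a : mu.-integrable setT (EFin \o zeta) ->
  \int[mu]_z zeta z = 0 -> ~ (\forall z \ae mu, zeta z = 0) -> 0 < a < 1 ->
  0 < tail_integral (cdf_of mu zeta) a.
Proof.
move=> iz z0 nz a01; rewrite lt_neqAle tail_integral_ge0// andbT eq_sym.
by apply/eqP => /(tail_integral_eq0 iz z0 a01).
Qed.

Lemma tail_integralZ zeta s a : mu.-integrable setT (EFin \o zeta) ->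
  \int[mu]_z zeta z = 0 -> 0 <= s -> 0 < a < 1 ->
  tail_integral (cdf_of mu (fun z => s * zeta z)) a =
  s * tail_integral (cdf_of mu zeta) a.
Proof.
move=> iz z0 s0 a01.
have H r (eta : T -> R) : mu.-integrable setT (EFin \o eta) -> 0 <= r ->
    tail_integral (cdf_of mu (fun z => r * eta z)) a <=
    r * tail_integral (cdf_of mu eta) a.
  move=> ie r0.
  have := tail_integral_sublinear ie ie r0 (lexx 0) a01.
  have -> : (fun z => r * eta z + 0 * eta z) = (fun z => r * eta z).
    by apply/funext => z; rewrite mul0r addr0.
  by rewrite mul0r addr0.
have isz : mu.-integrable setT (EFin \o (fun z => s * zeta z)).
  rewrite (_ : _ \o _ = (fun z => s%:E * (EFin \o zeta) z))%E//.
  exact: integrableZl.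
apply/eqP; rewrite eq_le H//=.
have [s0'|s0'] := eqVneq s 0.
  rewrite s0' mul0r tail_integral_ge0//.
    by rewrite s0' in isz.
  by rewrite RintegralZl// z0 mulr0.
have sgt0 : 0 < s by rewrite lt_neqAle eq_sym s0'.
(* The reverse inequality is [H] at the inverse scale, applied to [s * zeta]. *)
have := H s^-1 _ isz; rewrite invr_ge0 => /(_ s0).
have -> : (fun z => s^-1 * (s * zeta z)) = zeta.
  by apply/funext => z; rewrite mulKf.
by rewrite ler_pdivlMl.
Qed.

End TailOrder.

(** * Exchanging the excess of two quantile functions *)

Section Density.
Context d (T : measurableType d) {R : realType} (m : {measure set T -> \bar R}).
Variable f : T -> R.
Hypothesis mf : measurable_fun setT f.
Hypothesis f0 : forall x, 0 <= f x.

(** The two proofs are arguments, so that the term [density mf f0] carries what the measure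
    structure declared below depends on. *)
Definition density & measurable_fun setT f & (forall x, 0 <= f x) :=
  fun A : set T => (\int[m]_(x in A) (f x)%:E)%E.

Let dens := density mf f0.

Let dens0 : dens set0 = 0%E.
Proof. by rewrite /dens/density integral_set0. Qed.

Let dens_ge0 A : (0 <= dens A)%E.
Proof. by apply: integral_ge0 => x _; rewrite lee_fin. Qed.

Let dens_sigma_additive : semi_sigma_additive dens.
Proof.
move=> F mF tF mUF; rewrite /dens/density.
apply: cvg_toP.
  apply: ereal_nondecreasing_is_cvgn => i j ij.
  apply: lee_sum_nneg_natr => // k _ _.
  by apply: integral_ge0 => x _; rewrite lee_fin.
rewrite ge0_integral_bigcup//.
- by apply/measurable_EFinP; exact: measurable_funTS.
- by move=> x _; rewrite lee_fin.
Qed.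

HB.instance Definition _ := isMeasure.Build _ _ _ (density mf f0)
  dens0 dens_ge0 dens_sigma_additive.

Import HBNNSimple.

Let integral_density_indic A : measurable A ->
  (\int[density mf f0]_x (\1_A x)%:E = \int[m]_x ((\1_A x)%:E * (f x)%:E))%E.
Proof.
move=> mA; rewrite integral_indic// setIT /density.
change (\int[m]_(x in A) (f x)%:E = \int[m]_x ((\1_A x)%:E * (f x)%:E))%E.
rewrite integral_mkcond; apply: eq_integral => x _.
by rewrite patchE indicE; case: ifPn; rewrite ?mul1e ?mul0e.
Qed.

Let integral_density_nnsfun (h : {nnsfun T >-> R}) :
  (\int[density mf f0]_x (h x)%:E = \int[m]_x ((h x)%:E * (f x)%:E))%E.
Proof.
under [LHS]eq_integral do rewrite fimfunE -fsumEFin//.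
rewrite [LHS]ge0_integral_fsum//; last 2 first.
  - by move=> r; exact/measurable_EFinP/measurableT_comp.
  - by move=> n x _; rewrite EFinM nnfun_muleindic_ge0.
under [RHS]eq_integral.
  move=> x _; rewrite fimfunE -fsumEFin// muleC ge0_mule_fsumr; last first.
    by move=> r; rewrite EFinM nnfun_muleindic_ge0.
  over.
rewrite [RHS]ge0_integral_fsum//; last 2 first.
  - move=> r; apply: emeasurable_funM; first exact/measurable_EFinP.
    by apply/measurable_EFinP; exact/measurableT_comp.
  - by move=> n x _; rewrite mule_ge0 ?lee_fin// -lee_fin EFinM nnfun_muleindic_ge0.
apply: eq_fsbigr => r _.
have [r0|r0] := leP 0 r; last first.
  rewrite preimage_nnfun0// !integral0_eq// => x _; by rewrite indic0 mulr0 ?mule0.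
under eq_integral do rewrite EFinM.
rewrite ge0_integralZl//; last exact/measurable_EFinP/measurable_indic.
under [RHS]eq_integral do rewrite EFinM muleCA (muleC (f _)%:E).
rewrite ge0_integralZl// ?integral_density_indic//.
- by apply: emeasurable_funM; exact/measurable_EFinP.
- by move=> x _; rewrite mule_ge0// lee_fin.
Qed.

Lemma ge0_integral_density (psi : T -> \bar R) :
  measurable_fun setT psi -> (forall x, 0 <= psi x)%E ->
  (\int[density mf f0]_x psi x = \int[m]_x (psi x * (f x)%:E))%E.
Proof.
move=> mpsi psi0.
pose h := nnsfun_approx measurableT mpsi.
have hpsi x : (h n x)%:E @[n --> \oo] --> psi x by exact: cvg_nnsfun_approx.
transitivity (limn (fun n => \int[density mf f0]_x (h n x)%:E)%E).
  rewrite -monotone_convergence//=.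
  - by apply: eq_integral => x _; apply/esym/cvg_lim.
  - by move=> n; exact/measurable_EFinP.
  - by move=> n ? _; rewrite lee_fin.
  - by move=> ? _ ? ? mn; rewrite lee_fin; exact/lefP/nd_nnsfun_approx.
rewrite (_ : (fun n => _) = (fun n => \int[m]_x ((h n x)%:E * (f x)%:E))%E); last first.
  by apply/funext => n; exact: integral_density_nnsfun.
rewrite -monotone_convergence//=.
- apply: eq_integral => x _; apply/cvg_lim => //.
  by apply: cvgeZr => //.
- by move=> n; apply: emeasurable_funM => //; exact/measurable_EFinP.
- by move=> n ? _; rewrite mule_ge0// lee_fin.
- by move=> ? _ ? ? mn; rewrite lee_wpmul2r ?lee_fin//; exact/lefP/nd_nnsfun_approx.
Qed.

End Density.

Lemma ge0_ae_eq0 d (T : measurableType d) (R : realType)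
    (m : {measure set T -> \bar R}) (g : T -> \bar R) :
  measurable_fun setT g -> (forall x, 0 <= g x)%E -> (\int[m]_x g x = 0)%E ->
  \forall x \ae m, g x = 0%E.
Proof.
move=> mg g0 ig0.
have : (\int[m]_x `|g x| = 0)%E.
  by rewrite -[RHS]ig0; apply: eq_integral => x _; rewrite gee0_abs.
move=> /(ae_eq_integral_abs m measurableT mg).1.
by apply: filterS => x /(_ I).
Qed.

Section Cumulative.
Context {R : realType}.

Definition mass (f : R -> R) : R := \int[unif]_v f v.

Definition cumul (f : R -> R) (u : R) : R := \int[unif]_(v in `]-oo, u]) f v.

Variable f : R -> R.
Hypothesis f0 : forall u, 0 <= f u.
Hypothesis intf : unif.-integrable setT (EFin \o f).

Let mf : measurable_fun setT f.
Proof. by move/measurable_int : intf => /measurable_EFinP. Qed.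

Let D : {measure set R -> \bar R} := density unif mf f0.

Lemma densityT : D setT = (mass f)%:E.
Proof.
by rewrite /mass /Rintegral fineK//; exact: integrable_fin_num.
Qed.

Lemma densityF u : D `]-oo, u]%classic = (cumul f u)%:E.
Proof.
rewrite /cumul /Rintegral fineK//; apply: integrable_fin_num => //.
exact: integrableS intf.
Qed.

Hypothesis M0 : 0 < mass f.

Let q := tquantile (cumul f) (mass f).

Lemma measurable_cumul_quantile : measurable_fun setT q.
Proof. exact: measurable_tquantile1 M0 densityT densityF. Qed.

Lemma cumul_quantile_le t u : 0 < t < 1 ->
  (q t <= u) = (mass f * t <= cumul f u).
Proof.
move=> t01; rewrite /q /tquantile M0 t01.
exact: (quantile_scaled_le M0 densityT densityF).
Qed.

Lemma cumul_transform (G : R -> \bar R) : measurable_fun setT G ->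
  (forall u, 0 <= G u)%E ->
  (\int[unif]_u (G u * (f u)%:E) = (mass f)%:E * \int[unif]_t G (q t))%E.
Proof.
move=> mG G0; rewrite -(ge0_integral_density unif mf f0)//.
exact: (quantile_transform M0 densityT densityF).
Qed.

(** Here and in the converse below, [cumul_transform] is applied to the indicator of [B]: [B] is
    null for [f(u) du] exactly when the quantile avoids it for almost every [t]. This pair of lemmas
    moves almost-everywhere statements between the point [u] and the cumulated mass [t]. *)
Lemma cumul_quantile_ae (B : set R) : measurable B ->
  (\forall u \ae unif, B u -> f u = 0) -> \forall t \ae unif, ~ B (q t).
Proof.
move=> mB fB.
have m1 : measurable_fun setT (fun u => (\1_B u)%:E : \bar R).
  by apply/measurable_EFinP; exact: measurable_indic.
have := @cumul_transform _ m1 (fun u => _).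
move=> /(_ (fun u => ltac:(by rewrite lee_fin))).
rewrite (ae_eq_integral (cst 0%E))//; first last.
- apply: filterS fB => u h _ /=; rewrite indicE.
  case: (boolP (u \in B)) => uB; last by rewrite mul0e.
  by rewrite h ?mule0//; exact/set_mem.
- apply: emeasurable_funM => //; apply/measurable_EFinP; exact: mf.
rewrite integral0 => /esym/eqP; rewrite mule_eq0 eqe gt_eqF//= => /eqP.
move=> /ge0_ae_eq0 h; apply: filterS (h _ _); first last.
- by move=> t; rewrite lee_fin.
- by apply: measurableT_comp m1 _; exact: measurable_cumul_quantile.
move=> t /= /eqP; rewrite eqe indicE => + Bq.
by rewrite mem_set//= oner_eq0.
Qed.

Lemma ae_cumul_quantile (B : set R) : measurable B ->
  (\forall t \ae unif, ~ B (q t)) -> \forall u \ae unif, B u -> f u = 0.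
Proof.
move=> mB qB.
have m1 : measurable_fun setT (fun u => (\1_B u)%:E : \bar R).
  by apply/measurable_EFinP; exact: measurable_indic.
have := @cumul_transform _ m1 (fun u => _).
move=> /(_ (fun u => ltac:(by rewrite lee_fin))).
rewrite (ae_eq_integral (cst 0%E) (fun t => (\1_B (q t))%:E))//; first last.
- apply: filterS qB => t h _ /=; rewrite indicE.
  by rewrite memNset.
- by apply: measurableT_comp m1 _; exact: measurable_cumul_quantile.
rewrite integral0 mule0 => /ge0_ae_eq0 h; apply: filterS (h _ _); first last.
- by move=> u; rewrite mule_ge0// lee_fin.
- apply: emeasurable_funM => //; apply/measurable_EFinP; exact: mf.
move=> u /= /eqP + Bu; rewrite indicE mem_set// mul1e eqe.
by move=> /eqP.
Qed.

(** Equality, and not only [>=], because a measure with a density has no atom: the point [q t] can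
    be removed, and the mass strictly below it comes from the parameters [s] with [q s < q t], which
    are at most [t]. *)
Lemma cumul_quantileE t : 0 < t < 1 -> cumul f (q t) = mass f * t.
Proof.
move=> t01; apply/eqP; rewrite eq_le -cumul_quantile_le// lexx andbT.
rewrite -lee_fin -densityF.
have -> : `]-oo, (q t)]%classic = `]-oo, (q t)[%classic `|` [set q t].
  by rewrite setUitv1.
rewrite measureU//; last first.
  by rewrite -subset0 => x /= []; rewrite in_itv/= => + xq; rewrite xq ltxx.
rewrite [X in (_ + X)%R](_ : _ = 0%E); last first.
  have mEf : measurable_fun [set q t] (EFin \o f).
    by apply: measurable_funTS; exact: measurable_int intf.
  by apply: null_set_integral (unif_set1 _) => //.
rewrite addr0.
have E := quantile_law M0 densityT densityF (measurable_itv `]-oo, (q t)[).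
apply: (@le_trans _ _ ((mass f)%:E * unif (q @^-1` `]-oo, (q t)[))%E).
  by rewrite -E; exact: lexx.
rewrite EFinM.
apply: lee_wpmul2l; first by rewrite lee_fin ltW.
case/andP : (t01) => t0 t1.
have t01' : 0 <= t <= 1 by rewrite !ltW.
rewrite -(unif_le t01').
rewrite measureIl01; last first.
  rewrite -[X in measurable X]setTI; apply: measurable_cumul_quantile => //.
apply: le_measure; rewrite ?inE//.
  apply: measurableI => //.
  by rewrite -[X in measurable X]setTI; apply: measurable_cumul_quantile.
move=> s /= [+]; rewrite !in_itv/= => qs /andP[s0 s1].
rewrite leNgt; apply/negP => ts; move: qs; rewrite ltNge => /negP; apply.
rewrite cumul_quantile_le// (@le_trans _ _ (mass f * s))//.
  by rewrite ler_pM2l// ltW.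
by rewrite -cumul_quantile_le ?s0//.
Qed.

End Cumulative.

Lemma measurable_invr (R : realType) : measurable_fun setT (fun x : R => x^-1).
Proof.
rewrite (_ : (fun x => _) = (fun x : R => if x == 0 then 0 else x^-1)); last first.
  by apply/funext => x; case: eqVneq => // ->; rewrite invr0.
apply: measurable_fun_if => //.
  by apply: measurable_fun_eqr.
rewrite setTI (_ : _ @^-1` _ = [set x | x != 0]); last first.
  by apply/seteqP; split => x /=; [move=> ->|move/negbTE].
apply: open_continuous_measurable_fun; first exact: open_neq.
by move=> x; rewrite inE/= => x0; exact: inv_continuous.
Qed.

Lemma measurable_funV d (T : measurableType d) (R : realType) (f : T -> R) :
  measurable_fun setT f -> measurable_fun setT (fun x => (f x)^-1).
Proof. by move=> mf; exact: measurableT_comp (@measurable_invr R) mf. Qed.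

Section Swap.
Context {R : realType}.
Implicit Types a c : R -> R.

Definition gain a c (u : R) : R := Num.max (c u - a u) 0.

(* The map phi described at the top, and below it the probability rho; the test in
   [swap_prob] only matters on a null set. *)
Definition swap a c (u : R) : R :=
  if a u < c u
  then tquantile (cumul (gain c a)) (mass (gain c a))
         (cumul (gain a c) u / mass (gain a c))
  else tquantile (cumul (gain a c)) (mass (gain a c))
         (cumul (gain c a) u / mass (gain c a)).

Definition swap_prob a c (u : R) : R :=
  let r := (c u - a u) / (a (swap a c u) - a u) in
  if 0 <= r <= 1 then r else 0.

Lemma swap_prob_ge0 a c u : 0 <= swap_prob a c u.
Proof. by rewrite /swap_prob; case: ifPn => // /andP[]. Qed.

Lemma swap_prob_le1 a c u : swap_prob a c u <= 1.
Proof. by rewrite /swap_prob; case: ifPn => // /andP[]. Qed.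

Lemma gain_ge0 a c u : 0 <= gain a c u.
Proof. by rewrite /gain le_max lexx orbT. Qed.

Lemma gainB a c u : gain a c u - gain c a u = c u - a u.
Proof. rewrite /gain; have [h1|h1] := leP (c u - a u) 0; have [h2|h2] := leP (a u - c u) 0; lra. Qed.

Lemma integrable_gain a c : unif.-integrable setT (EFin \o a) ->
  unif.-integrable setT (EFin \o c) ->
  unif.-integrable setT (EFin \o gain a c).
Proof.
move=> ia ic.
have ma : measurable_fun setT a by move/measurable_int : ia => /measurable_EFinP.
have mc : measurable_fun setT c by move/measurable_int : ic => /measurable_EFinP.
apply: (@le_integrable _ _ _ _ _ measurableT _ (fun u => (`|c u| + `|a u|)%:E)) => //.
- apply/measurable_EFinP; apply: measurable_maxr => //.
  exact: measurable_funB.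
- move=> u _ /=; rewrite lee_fin ger0_norm ?gain_ge0// ger0_norm ?addr_ge0//.
  rewrite /gain ge_max addr_ge0// andbT (le_trans (ler_norm _))//.
  exact: ler_normB.
- under eq_fun do rewrite EFinD.
  by apply: integrableD => //; exact: integrable_norm.
Qed.

End Swap.

(** * Measurability of the exchange jointly in the conditioning variable and the rank *)

Section JointMeasurability.
Context {R : realType} d (X : measurableType d).

Section Cumul.
Variable f : X -> R -> R.
Hypothesis mf : measurable_fun setT (fun xu : X * R => f xu.1 xu.2).
Hypothesis f0 : forall x u, 0 <= f x u.
Hypothesis intf : forall x, unif.-integrable setT (EFin \o f x).

Lemma measurable_mass : measurable_fun setT (fun x => mass (f x)).
Proof.
have mEf : measurable_fun setT (fun xu : X * R => (f xu.1 xu.2)%:E) by exact/measurable_EFinP.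
have Ef0 (xu : X * R) : (0 <= (f xu.1 xu.2)%:E)%E by rewrite lee_fin.
have := @measurable_fun_fubini_tonelli_F _ _ _ _ R unif _ mEf Ef0.
move=> h; apply: (@measurableT_comp _ _ _ _ _ _ fine) h => //.
Qed.

Lemma measurable_cumul : measurable_fun setT (fun xu : X * R => cumul (f xu.1) xu.2).
Proof.
(* With the bound of integration moved into an indicator, [u] becomes a mere parameter and Tonelli's
   theorem applies. *)
pose g (xuv : (X * R) * R) := f xuv.1.1 xuv.2 * \1_[set v : R | v <= xuv.1.2] xuv.2.
have mg : measurable_fun setT g.
  apply: measurable_funM.
    apply: (measurableT_comp (f := fun xu : X * R => f xu.1 xu.2) (g := fun xuv : (X * R) * R => (xuv.1.1, xuv.2))) => //.
    apply: measurable_fun_pair => //.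
    by apply: measurableT_comp.
  rewrite (_ : (fun _ => _) = (fun xuv : (X * R) * R => if xuv.2 <= xuv.1.2 then 1 else 0)).
    apply: measurable_fun_ifT => //; apply: measurable_fun_ler => //.
    by apply: measurableT_comp.
  apply/funext => xuv; rewrite indicE; case: ifPn => h; first by rewrite mem_set.
  by rewrite memNset//; exact/negP.
rewrite (_ : (fun xu => _) = (fun xu => fine (\int[unif]_v (g (xu, v))%:E)%E)).
  have mEg : measurable_fun setT (EFin \o g) by exact/measurable_EFinP.
  have Eg0 xuv : (0 <= (EFin \o g) xuv)%E by rewrite lee_fin mulr_ge0.
  have := @measurable_fun_fubini_tonelli_F _ _ _ _ R unif _ mEg Eg0.
  move=> h; apply: (@measurableT_comp _ _ _ _ _ _ fine) h => //.
apply/funext => -[x u]; rewrite /cumul /Rintegral integral_mkcond; congr fine.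
apply: eq_integral => v _; rewrite patchE /g/= indicE; case: ifPn.
  by rewrite mulr1.
by rewrite mulr0.
Qed.

Lemma measurable_cumul_tquantile : measurable_fun setT
  (fun xt : X * R => tquantile (cumul (f xt.1)) (mass (f xt.1)) xt.2).
Proof.
apply: (measurable_tquantile (F := fun x => cumul (f x)) (M := fun x => mass (f x))).
- by move=> u; have /(measurable_fun_pair1 u) := measurable_cumul.
- exact: measurable_mass.
- move=> x t u M0 t01.
  have := cumul_quantile_le (f0 x) (intf x) M0 u t01.
  by rewrite /tquantile M0 t01.
Qed.

End Cumul.

Variables a c : X -> R -> R.
Hypothesis ma : measurable_fun setT (fun xu : X * R => a xu.1 xu.2).
Hypothesis mc : measurable_fun setT (fun xu : X * R => c xu.1 xu.2).
Hypothesis ia : forall x, unif.-integrable setT (EFin \o a x).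
Hypothesis ic : forall x, unif.-integrable setT (EFin \o c x).

Lemma measurable_swap :
  measurable_fun setT (fun xu : X * R => swap (a xu.1) (c xu.1) xu.2).
Proof.
(* One branch of [swap]; the other one is the same with the two functions interchanged. *)
have H (b e : X -> R -> R) :
    measurable_fun setT (fun xu : X * R => b xu.1 xu.2) ->
    measurable_fun setT (fun xu : X * R => e xu.1 xu.2) ->
    (forall x, unif.-integrable setT (EFin \o b x)) ->
    (forall x, unif.-integrable setT (EFin \o e x)) ->
    measurable_fun setT (fun xu : X * R =>
      tquantile (cumul (gain (e xu.1) (b xu.1))) (mass (gain (e xu.1) (b xu.1)))
         (cumul (gain (b xu.1) (e xu.1)) xu.2 / mass (gain (b xu.1) (e xu.1)))).
  move=> mb me ib ie.
  have mg1 : measurable_fun setT (fun xu : X * R => gain (e xu.1) (b xu.1) xu.2).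
    by apply: measurable_maxr => //; exact: measurable_funB.
  have mg2 : measurable_fun setT (fun xu : X * R => gain (b xu.1) (e xu.1) xu.2).
    by apply: measurable_maxr => //; exact: measurable_funB.
  have ig1 x := integrable_gain (ie x) (ib x).
  have ig2 x := integrable_gain (ib x) (ie x).
  have mq := measurable_cumul_tquantile (f := fun x => gain (e x) (b x)) mg1 (fun x => gain_ge0 _ _) ig1.
  apply: (measurableT_comp mq (g := fun xu : X * R => (xu.1,
    cumul (gain (b xu.1) (e xu.1)) xu.2 / mass (gain (b xu.1) (e xu.1))))).
  apply: measurable_fun_pair => //; apply: measurable_funM.
    exact: (measurable_cumul (f := fun x => gain (b x) (e x)) mg2 (fun x => gain_ge0 _ _)).
  apply: measurable_funV.
  exact: (measurableT_comp (measurable_mass (f := fun x => gain (b x) (e x)) mg2 (fun x => gain_ge0 _ _)) measurable_fst).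
apply: measurable_fun_ifT; first exact: measurable_fun_ltr.
  exact: H.
exact: H.
Qed.

Lemma measurable_swap_prob :
  measurable_fun setT (fun xu : X * R => swap_prob (a xu.1) (c xu.1) xu.2).
Proof.
have mr : measurable_fun setT (fun xu : X * R => (c xu.1 xu.2 - a xu.1 xu.2) /
    (a xu.1 (swap (a xu.1) (c xu.1) xu.2) - a xu.1 xu.2)).
  apply: measurable_funM; first exact: measurable_funB.
  apply: measurable_funV; apply: measurable_funB => //.
  apply: (measurableT_comp ma (g := fun xu : X * R => (xu.1, swap (a xu.1) (c xu.1) xu.2))).
  by apply: measurable_fun_pair => //; exact: measurable_swap.
rewrite /swap_prob; apply: measurable_fun_ifT => //.
by apply: measurable_and; exact: measurable_fun_ler.
Qed.

End JointMeasurability.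

(** * Invariance of the measure [rho(u) du] under the exchange *)

Section SwapInvariance.
Context {R : realType}.
Variables a c : R -> R.
Hypothesis ia : unif.-integrable setT (EFin \o a).
Hypothesis ic : unif.-integrable setT (EFin \o c).
Hypothesis ndc : forall s t, 0 < s -> s <= t -> t < 1 -> c s <= c t.
Hypothesis major : forall u, 0 < u < 1 ->
  \int[unif]_(t in `]u, +oo[) c t <= \int[unif]_(t in `]u, +oo[) a t.
Hypothesis mean_eq : \int[unif]_t c t = \int[unif]_t a t.

Let fp := gain a c.
Let fm := gain c a.
Let igp := integrable_gain ia ic.
Let igm := integrable_gain ic ia.
Let gp0 := @gain_ge0 R a c.
Let gm0 := @gain_ge0 R c a.

Let ma : measurable_fun setT a.
Proof. by move/measurable_int : ia => /measurable_EFinP. Qed.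

Let mc : measurable_fun setT c.
Proof. by move/measurable_int : ic => /measurable_EFinP. Qed.

Let mswap : measurable_fun setT (swap a c).
Proof.
have ma' : measurable_fun setT (fun xu : R * R => a xu.2) by exact: measurableT_comp.
have mc' : measurable_fun setT (fun xu : R * R => c xu.2) by exact: measurableT_comp.
have := @measurable_swap R _ R (fun=> a) (fun=> c) ma' mc' (fun=> ia) (fun=> ic).
by move=> /(measurable_fun_pair2 (0 : R)).
Qed.

Let mswap_prob : measurable_fun setT (swap_prob a c).
Proof.
have ma' : measurable_fun setT (fun xu : R * R => a xu.2) by exact: measurableT_comp.
have mc' : measurable_fun setT (fun xu : R * R => c xu.2) by exact: measurableT_comp.
have := @measurable_swap_prob R _ R (fun=> a) (fun=> c) ma' mc' (fun=> ia) (fun=> ic).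
by move=> /(measurable_fun_pair2 (0 : R)).
Qed.

Lemma mass_gainE : mass fp = mass fm.
Proof.
apply/eqP; rewrite -subr_eq0 /mass -RintegralB//.
rewrite (eq_Rintegral _ (g := fun u => c u - a u)); last first.
  by move=> u _; exact: gainB.
by rewrite RintegralB// mean_eq subrr.
Qed.

(** This is where dominance enters. The integrals of [c - a] over []-oo, u]] and []u, +oo[] are
    opposite because the means agree, and dominance makes the second one nonpositive. *)
Lemma cumul_gain_le u : 0 < u < 1 -> cumul fm u <= cumul fp u.
Proof.
move=> u01; rewrite -subr_ge0 /cumul -RintegralB//; last 2 first.
- exact: integrableS igp.
- exact: integrableS igm.
rewrite (eq_Rintegral _ (g := fun u => c u - a u)); last first.
  by move=> v _; exact: gainB.
have ica : unif.-integrable setT (EFin \o (fun v => c v - a v)).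
  by rewrite (_ : _ \o _ = (EFin \o c) \- (EFin \o a))%E//; exact: integrableB.
have E : \int[unif]_v (c v - a v) = 0 by rewrite RintegralB// mean_eq subrr.
have : [set: R] = `]-oo, u]%classic `|` `]u, +oo[%classic.
  by rewrite -setCitvl setUv.
move=> ET; move: E; rewrite ET Rintegral_setU//; last 2 first.
- by rewrite -ET.
- by rewrite -setCitvl; exact/disj_setPCl.
move=> /eqP; rewrite addr_eq0 => /eqP ->; rewrite oppr_ge0.
rewrite RintegralB//; last 2 first.
- exact: integrableS ic.
- exact: integrableS ia.
by rewrite subr_le0 major.
Qed.

Let qp := tquantile (cumul fp) (mass fp).
Let qm := tquantile (cumul fm) (mass fm).

Section PositiveMass.
Hypothesis M0 : 0 < mass fp.

Let M0' : 0 < mass fm.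
Proof. by rewrite -mass_gainE. Qed.

Let null01 f (Hf : forall u, 0 <= f u) : \forall u \ae (@unif R), (~` `]0, 1[%classic) u -> f u = 0 :> R.
Proof.
apply: filterS unif_ae01 => u u01 /= h.
by exfalso; apply: h; rewrite in_itv.
Qed.

(** [qp t] and [qm t] are the points of [{a < c}] and [{c < a}] with the same cumulated mass. The
    inequalities chain into [a (qp t) < c (qp t) <= c (qm t) < a (qm t)]: seen from either point,
    the value of [c] lies between the two values of [a]. *)
Let swapped t := [/\ 0 < t < 1, a (qp t) < c (qp t), c (qm t) < a (qm t),
  c (qp t) <= c (qm t) & swap a c (qp t) = qm t /\ swap a c (qm t) = qp t].

Lemma swapped_ae : \forall t \ae unif, swapped t.
Proof.
have mlt (b e : R -> R) : measurable_fun setT b -> measurable_fun setT e ->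
    measurable [set u | e u <= b u].
  move=> mb me; rewrite -[X in measurable X]setTI.
  exact: (measurable_fun_ler me mb).
have p01 := cumul_quantile_ae gp0 igp M0 (measurableC (measurable_itv `]0, 1[)) (null01 gp0).
have m01 := cumul_quantile_ae gm0 igm M0' (measurableC (measurable_itv `]0, 1[)) (null01 gm0).
have pac : \forall t \ae unif, ~ [set u | c u <= a u] (qp t).
  apply: (cumul_quantile_ae gp0 igp M0 (mlt _ _ ma mc)).
  by apply: nearW => u /= cu; apply/max_idPr; rewrite subr_le0.
have mac : \forall t \ae unif, ~ [set u | a u <= c u] (qm t).
  apply: (cumul_quantile_ae gm0 igm M0' (mlt _ _ mc ma)).
  by apply: nearW => u /= cu; apply/max_idPr; rewrite subr_le0.
apply: filterS3 unif_ae01 (filterI p01 m01) (filterI pac mac) => t t01 /=.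
move=> [{}p01 {}m01] [/negP + /negP]; rewrite -!ltNge => {}pac {}mac.
have {}p01 : 0 < qp t < 1 by move: p01 => /contrapT; rewrite in_itv.
have {}m01 : 0 < qm t < 1 by move: m01 => /contrapT; rewrite in_itv.
(* The mass of [fm] up to [qm t] is at least [mass fm * t], and that of [fp] is larger still. The
   bounds [p01] and [m01] were secured first because dominance and monotonicity are only available
   inside []0, 1[]. *)
have pm : qp t <= qm t.
  rewrite (cumul_quantile_le gp0 igp M0 _ t01).
  rewrite (le_trans _ (cumul_gain_le m01))// mass_gainE.
  by rewrite -(cumul_quantile_le gm0 igm M0' _ t01).
have sp : swap a c (qp t) = qm t.
  rewrite /swap pac (cumul_quantileE gp0 igp M0 t01) mulrC mulKf//.
  by rewrite gt_eqF.
have sm : swap a c (qm t) = qp t.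
  rewrite /swap ltNge (ltW mac)/= (cumul_quantileE gm0 igm M0' t01) mulrC mulKf//.
  by rewrite gt_eqF.
split=> //; apply: ndc => //.
- by case/andP : p01.
- by case/andP : m01.
Qed.

(** [B1] and [B2] collect the points where the exchange fails to overshoot. By the chain in
    [swapped], [qp t] avoids [B1] and [qm t] avoids [B2] for almost every [t]. Carried back to [u],
    this says that [fp] vanishes almost everywhere on [B1], where it is positive by definition;
    likewise for [fm] and [B2]. *)
Lemma swap_diff_ae : \forall u \ae unif,
  (a u < c u -> c u - a u <= a (swap a c u) - a u) /\
  (c u < a u -> a u - c u <= a u - a (swap a c u)).
Proof.
have mas : measurable_fun setT (a \o swap a c) by exact: measurableT_comp.
pose B1 := [set u | a u < c u /\ a (swap a c u) < c u].
pose B2 := [set u | c u < a u /\ c u < a (swap a c u)].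
have mB1 : measurable B1.
  rewrite -[X in measurable X]setTI.
  rewrite (_ : B1 = (fun u => (a u < c u) && (a (swap a c u) < c u)) @^-1` [set true]); last first.
    by apply/seteqP; split => u /= => [[-> ->]//|/andP].
  by apply: measurable_and => //; apply: measurable_fun_ltr.
have mB2 : measurable B2.
  rewrite -[X in measurable X]setTI.
  rewrite (_ : B2 = (fun u => (c u < a u) && (c u < a (swap a c u))) @^-1` [set true]); last first.
    by apply/seteqP; split => u /= => [[-> ->]//|/andP].
  by apply: measurable_and => //; apply: measurable_fun_ltr.
have H1 : \forall u \ae unif, B1 u -> fp u = 0.
  apply: (ae_cumul_quantile gp0 igp M0 mB1).
  apply: filterS swapped_ae => t [_ pac mac cc [sp sm]] [_].
  by rewrite sp ltNge (le_trans cc)// ltW.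
have H2 : \forall u \ae unif, B2 u -> fm u = 0.
  apply: (ae_cumul_quantile gm0 igm M0' mB2).
  apply: filterS swapped_ae => t [_ pac mac cc [sp sm]] [_].
  by rewrite sm ltNge (le_trans _ cc)// ltW.
apply: filterS2 H1 H2 => u H1 H2; split => h.
- rewrite lerD2r leNgt; apply/negP => h'.
  have := H1 (conj h h'); rewrite /fp /gain => /max_idPr.
  by rewrite subr_le0 leNgt h.
- rewrite lerD2l lerN2 leNgt; apply/negP => h'.
  have := H2 (conj h h'); rewrite /fm /gain => /max_idPr.
  by rewrite subr_le0 leNgt h.
Qed.

Let K u := `|a (swap a c u) - a u|^-1.

(** [rho] is the excess times [K], and [K] takes the same value at two exchanged points. Where
    [c < a], numerator and denominator of the quotient are both negative; where [a u = c u], both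
    identities are trivial whatever [swap] does there. *)
Lemma swap_prob_ae : \forall u \ae unif,
  swap_prob a c u * (a (swap a c u) - a u) = c u - a u /\
  swap_prob a c u = K u * fp u + K u * fm u.
Proof.
apply: filterS swap_diff_ae => u [h1 h2].
rewrite /swap_prob /K /fp /fm /gain.
have [ac|ca|ac] := ltgtP (a u) (c u).
- have d0 : 0 < a (swap a c u) - a u by rewrite (lt_le_trans _ (h1 ac))// subr_gt0.
  have -> : 0 <= (c u - a u) / (a (swap a c u) - a u) <= 1.
    by rewrite divr_ge0 ?ler_pdivrMr ?mul1r ?h1 ?(ltW d0)// subr_ge0 ltW.
  rewrite divfK ?gt_eqF//; split => //.
  rewrite gtr0_norm// (max_idPl _) ?subr_ge0 ?(ltW ac)//.
  by rewrite (max_idPr _) ?subr_le0 ?(ltW ac)// mulr0 addr0 mulrC.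
- have d0 : 0 < a u - a (swap a c u) by rewrite (lt_le_trans _ (h2 ca))// subr_gt0.
  have -> : (c u - a u) / (a (swap a c u) - a u) = (a u - c u) / (a u - a (swap a c u)).
    by rewrite -(opprB (a u) (c u)) -(opprB (a u) (a _)) invrN mulrNN.
  have -> : 0 <= (a u - c u) / (a u - a (swap a c u)) <= 1.
    by rewrite divr_ge0 ?ler_pdivrMr ?mul1r ?h2 ?(ltW d0)// subr_ge0 ltW.
  split.
    by rewrite -(opprB (a u) (a _)) mulrN divfK ?gt_eqF// opprB.
  rewrite -normrN opprB gtr0_norm// [X in _ = _ * X + _](max_idPr _) ?subr_le0 ?(ltW ca)//.
  by rewrite (max_idPl _) ?subr_ge0 ?(ltW ca)// mulr0 add0r mulrC.
- rewrite ac subrr mul0r lexx ler01/= mul0r; split => //.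
  by rewrite maxxx mulr0 addr0.
Qed.

Let kappa t := `|a (qm t) - a (qp t)|^-1.

(* Both halves of [rho(u) du] are parametrized by the common cumulated mass [t],
   with the same density [kappa]; this makes the symmetry of [swap] visible. *)
Lemma swap_prob_transform (G : R -> \bar R) : measurable_fun setT G ->
  (forall u, 0 <= G u)%E ->
  (\int[unif]_u ((swap_prob a c u)%:E * G u) =
   (mass fp)%:E * \int[unif]_t ((kappa t)%:E * (G (qp t) + G (qm t))))%E.
Proof.
move=> mG G0.
have mK : measurable_fun setT K.
  apply: measurable_funV; apply: measurableT_comp => //.
  by apply: measurable_funB => //; exact: measurableT_comp.
have K0 u : 0 <= K u by rewrite invr_ge0.
pose KG u := ((K u)%:E * G u)%E.
have mKG : measurable_fun setT KG by apply: emeasurable_funM => //; exact/measurable_EFinP.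
have KG0 u : (0 <= KG u)%E by rewrite mule_ge0// lee_fin.
have mEp : measurable_fun setT (fun u => (fp u)%:E) by exact: measurable_int igp.
have mEm : measurable_fun setT (fun u => (fm u)%:E) by exact: measurable_int igm.
have mqp := measurable_cumul_quantile gp0 igp M0.
have mqm := measurable_cumul_quantile gm0 igm M0'.
transitivity (\int[unif]_u (KG u * (fp u)%:E + KG u * (fm u)%:E))%E.
  apply: ae_eq_integral => //.
  - by apply: emeasurable_funM => //; exact/measurable_EFinP.
  - by apply: emeasurable_funD; exact: emeasurable_funM.
  apply: filterS swap_prob_ae => u [_ ->] _.
  rewrite /KG EFinD !EFinM ge0_muleDl ?mule_ge0 ?lee_fin ?gain_ge0//.
  by rewrite -!muleA; congr (_ + _)%E; congr (_ * _)%E; rewrite muleC.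
rewrite ge0_integralD//; last 4 first.
- by move=> u _; rewrite mule_ge0// lee_fin gain_ge0.
- exact: emeasurable_funM.
- by move=> u _; rewrite mule_ge0// lee_fin gain_ge0.
- exact: emeasurable_funM.
rewrite (cumul_transform gp0 igp M0)// (cumul_transform gm0 igm M0')//.
rewrite -/fp -/fm -/qp -/qm -mass_gainE.
rewrite -ge0_muleDr; [|exact: integral_ge0|exact: integral_ge0].
have mKGp : measurable_fun setT (KG \o qp) by exact: measurableT_comp mKG mqp.
have mKGm : measurable_fun setT (KG \o qm) by exact: measurableT_comp mKG mqm.
have ID := ge0_integralD unif measurableT (fun t _ => KG0 (qp t)) mKGp (fun t _ => KG0 (qm t)) mKGm.
rewrite -[X in (_ * X = _)%E]ID.
congr (_ * _)%E; apply: ae_eq_integral => //.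
- by apply: emeasurable_funD; [exact: mKGp|exact: mKGm].
- apply: emeasurable_funM.
    apply/measurable_EFinP; apply: measurable_funV; apply: measurableT_comp => //.
    by apply: measurable_funB; [exact: measurableT_comp ma mqm|exact: measurableT_comp ma mqp].
  by apply: emeasurable_funD; [exact: measurableT_comp mG mqp|exact: measurableT_comp mG mqm].
apply: filterS swapped_ae => t [_ _ _ _ [sp sm]] _ /=.
have Kp : K (qp t) = kappa t by rewrite /K sp.
have Km : K (qm t) = kappa t by rewrite /K sm /kappa distrC.
rewrite /KG Kp Km; apply/esym; apply: ge0_muleDr; exact: G0.
Qed.

(** In the parametrization by [t], composing with [swap] only interchanges the summands at [qp t]
    and [qm t]. *)
Lemma swap_invariant_pos (psi : R -> \bar R) : measurable_fun setT psi ->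
  (forall u, 0 <= psi u)%E ->
  (\int[unif]_u ((swap_prob a c u)%:E * psi (swap a c u)) =
   \int[unif]_u ((swap_prob a c u)%:E * psi u))%E.
Proof.
move=> mpsi psi0.
have mps : measurable_fun setT (psi \o swap a c) by exact: measurableT_comp mpsi mswap.
have ps0 u : (0 <= (psi \o swap a c) u)%E by exact: psi0.
rewrite (swap_prob_transform mps ps0).
rewrite (swap_prob_transform mpsi psi0); congr (_ * _)%E.
have mqp := measurable_cumul_quantile gp0 igp M0.
have mqm := measurable_cumul_quantile gm0 igm M0'.
have mk : measurable_fun setT (fun t => (kappa t)%:E).
  apply/measurable_EFinP; apply: measurable_funV; apply: measurableT_comp => //.
  by apply: measurable_funB; [exact: measurableT_comp ma mqm|exact: measurableT_comp ma mqp].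
apply: ae_eq_integral => //.
- apply: emeasurable_funM => //.
  by apply: emeasurable_funD; [exact: measurableT_comp mps mqp|exact: measurableT_comp mps mqm].
- apply: emeasurable_funM => //.
  by apply: emeasurable_funD; [exact: measurableT_comp mpsi mqp|exact: measurableT_comp mpsi mqm].
by apply: filterS swapped_ae => t [_ _ _ _ [sp sm]] _ /=; rewrite sp sm addeC.
Qed.

End PositiveMass.

(** The degenerate case, where there is no mass to parametrize by: both excesses vanish almost
    everywhere, and [rho] with them. *)
Lemma gain_mass0 : mass fp <= 0 -> \forall u \ae unif, a u = c u.
Proof.
move=> M0.
have H (f : R -> R) : (forall u, 0 <= f u) -> unif.-integrable setT (EFin \o f) ->
    mass f <= 0 -> \forall u \ae unif, f u = 0.
  move=> f0 intf fM.
  have f0' u : (0 <= (EFin \o f) u)%E by rewrite lee_fin.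
  have : (\int[unif]_u (EFin \o f) u = 0)%E.
    rewrite -[LHS]fineK; last exact: integrable_fin_num.
    congr EFin; apply/eqP; rewrite eq_le [X in X && _]fM/= fine_ge0//.
    by apply: integral_ge0 => u _; exact: f0'.
  move=> /(ge0_ae_eq0 (measurable_int _ intf) f0').
  by apply: filterS => u /= [].
have M0' : mass fm <= 0 by rewrite -mass_gainE.
apply: filterS2 (H _ gp0 igp M0) (H _ gm0 igm M0') => u p0 m0.
by apply/esym/eqP; rewrite -subr_eq0 -gainB p0 m0 subr0.
Qed.

Lemma swap_probE : \forall u \ae unif,
  swap_prob a c u * (a (swap a c u) - a u) = c u - a u.
Proof.
have [M0|M0] := ltP 0 (mass fp).
  by apply: filterS (swap_prob_ae M0) => u [].
apply: filterS (gain_mass0 M0) => u acE.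
by rewrite /swap_prob acE subrr mul0r lexx ler01/= mul0r.
Qed.

Lemma swap_invariant (psi : R -> \bar R) : measurable_fun setT psi ->
  (forall u, 0 <= psi u)%E ->
  (\int[unif]_u ((swap_prob a c u)%:E * psi (swap a c u)) =
   \int[unif]_u ((swap_prob a c u)%:E * psi u))%E.
Proof.
move=> mpsi psi0; have [M0|M0] := ltP 0 (mass fp).
  exact: swap_invariant_pos.
have mps : measurable_fun setT (psi \o swap a c) by exact: measurableT_comp mpsi mswap.
have mp : measurable_fun setT (fun u => (swap_prob a c u)%:E) by exact/measurable_EFinP.
apply: ae_eq_integral => //; [exact: (emeasurable_funM mp mps)|exact: emeasurable_funM|].
apply: filterS (gain_mass0 M0) => u acE _ /=.
by rewrite /swap_prob acE subrr mul0r lexx ler01/= !mul0e.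
Qed.

End SwapInvariance.

(** * Ranks and conditional distributions *)

Section SameLaw.
Context d1 d2 d (T1 : measurableType d1) (T2 : measurableType d2)
  (T : measurableType d) {R : realType}.
Variables (m1 : {measure set T1 -> \bar R}) (m2 : {measure set T2 -> \bar R}).
Variables (X1 : T1 -> T) (X2 : T2 -> T).
Hypothesis mX1 : measurable_fun setT X1.
Hypothesis mX2 : measurable_fun setT X2.
Hypothesis lawE : forall A, measurable A -> m1 (X1 @^-1` A) = m2 (X2 @^-1` A).

Lemma ge0_integral_same_law (psi : T -> \bar R) : measurable_fun setT psi ->
  (forall x, 0 <= psi x)%E ->
  (\int[m1]_w psi (X1 w) = \int[m2]_w psi (X2 w))%E.
Proof.
move=> mpsi psi0.
have := ge0_integral_pushforward mX1 m1 measurableT mpsi (fun x _ => psi0 x).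
have := ge0_integral_pushforward mX2 m2 measurableT mpsi (fun x _ => psi0 x).
rewrite !preimage_setT => /= <- <-; apply: eq_measure_integral => A mA _.
exact: lawE.
Qed.

Lemma integrable_same_law (f : T -> R) : measurable_fun setT f ->
  m1.-integrable setT (EFin \o (f \o X1)) ->
  m2.-integrable setT (EFin \o (f \o X2)).
Proof.
move=> mf /integrableP[_ i1]; apply/integrableP; split.
  by apply/measurable_EFinP; exact: measurableT_comp.
have mpsi : measurable_fun setT (fun x => `|(f x)%:E|%E).
  by apply: measurableT_comp => //; exact/measurable_EFinP.
have := ge0_integral_same_law mpsi (fun x => abse_ge0 _) => /= E.
by rewrite -E.
Qed.

Lemma integral_same_law (f : T -> R) : measurable_fun setT f ->
  m1.-integrable setT (EFin \o (f \o X1)) ->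
  (\int[m1]_w (f (X1 w))%:E = \int[m2]_w (f (X2 w))%:E)%E.
Proof.
move=> mf i1; have i2 := integrable_same_law mf i1.
have mEf : measurable_fun setT (EFin \o f) by exact/measurable_EFinP.
have := integral_pushforward mX1 mEf i1 measurableT.
have := integral_pushforward mX2 mEf i2 measurableT.
rewrite !preimage_setT => /= <- <-; apply: eq_measure_integral => A mA _.
exact: lawE.
Qed.

End SameLaw.

(* The rank [F(zeta-) + w (F(zeta) - F(zeta-))], where an independent uniform
   [w] breaks the ties: it is uniform, and its quantile recovers [zeta]. *)
Definition cdf_left d (T : measurableType d) (R : realType)
    (mu : {measure set T -> \bar R}) (f : T -> R) (t : R) : R :=
  fine (mu [set z | f z < t]).

Definition rank d (T : measurableType d) (R : realType)
    (mu : {measure set T -> \bar R}) (zeta : T -> R) (z : T) (w : R) : R :=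
  cdf_left mu zeta (zeta z) +
  w * (cdf_of mu zeta (zeta z) - cdf_left mu zeta (zeta z)).

(** * Uniformity of the randomized rank *)

Section Rank.
Context {R : realType} d (T : measurableType d) (mu : probability T R).
Variable zeta : T -> R.
Hypothesis mzeta : measurable_fun setT zeta.
Let F := cdf_of mu zeta.
Let Fl := cdf_left mu zeta.

Let mle y : measurable [set z | zeta z <= y].
Proof.
rewrite -[X in measurable X]setTI.
exact: (measurable_fun_ler mzeta (measurable_cst y)).
Qed.

Let mlt y : measurable [set z | zeta z < y].
Proof.
rewrite -[X in measurable X]setTI.
exact: (measurable_fun_ltr mzeta (measurable_cst y)).
Qed.

Let meq y : measurable [set z | zeta z = y].
Proof.
rewrite -[X in measurable X]setTI.
exact: (mzeta measurableT (measurable_set1 y)).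
Qed.

Let FE y : mu [set z | zeta z <= y] = (F y)%:E.
Proof. by rewrite /F/cdf_of fineK//; exact: fin_num_measure. Qed.

Let FlE y : mu [set z | zeta z < y] = (Fl y)%:E.
Proof. by rewrite /Fl/cdf_left fineK//; exact: fin_num_measure. Qed.

Lemma cdf_left_le x y : x < y -> F x <= Fl y.
Proof.
move=> xy; rewrite -lee_fin -FE -FlE; apply: le_measure; rewrite ?inE//.
by move=> z /= zx; exact: le_lt_trans xy.
Qed.

Lemma cdf_leftS y : Fl y <= F y.
Proof.
by rewrite -lee_fin -FE -FlE; apply: le_measure; rewrite ?inE// => z /= /ltW.
Qed.

Lemma cdf_jump y : mu [set z | zeta z = y] = (F y - Fl y)%:E.
Proof.
rewrite EFinB -FE -FlE.
rewrite (_ : [set z | zeta z <= y] = [set z | zeta z < y] `|` [set z | zeta z = y]).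
  rewrite measureU//; last first.
    by rewrite -subset0 => z /= [+ zy]; rewrite zy ltxx.
  by rewrite addeAC subee ?add0e//; exact: fin_num_measure.
apply/seteqP; split => z /=; first by rewrite le_eqVlt => /orP[/eqP|]; [right|left].
by move=> [/ltW|->].
Qed.

(** The event is the increasing union of [{zeta <= Q t - 1/(n+1)}], and each of these has mass below
    [t] by the Galois connection. *)
Lemma cdf_left_quantile t : 0 < t < 1 -> Fl (quantile F t) <= t.
Proof.
move=> t01; rewrite -lee_fin -FlE.
rewrite (_ : [set z | _] = \bigcup_n [set z | zeta z <= quantile F t - n.+1%:R^-1]).
  apply: measure_bigcup_le => [//|n k nk z /= h|n].
    by rewrite (le_trans h)// lerD2l lerN2 lef_pV2 ?posrE// ler_nat.
  rewrite [X in (X <= _)%E](FE _) lee_fin ltW// ltNge -(quantile_cdf_le mu mzeta) // -ltNge.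
  by rewrite ltrBlDr ltrDl.
apply/seteqP; split => z /=.
  rewrite -subr_gt0 => /ltr_add_invr[n]; rewrite add0r => h.
  by exists n => //=; rewrite lerBrDr -lerBrDl ltW.
by move=> [n _ /= h]; rewrite (le_lt_trans h)// ltrBlDr ltrDl.
Qed.

Lemma measurable_rank : measurable_fun setT (fun zw : T * R => rank mu zeta zw.1 zw.2).
Proof.
have mF : measurable_fun setT (F \o zeta).
  apply: measurableT_comp => //; apply: nondecreasing_measurable => //.
  exact: (cdf_nd mu mzeta).
have mFl : measurable_fun setT (Fl \o zeta).
  apply: measurableT_comp => //; apply: nondecreasing_measurable => //.
  move=> x y; rewrite le_eqVlt => /orP[/eqP -> //|xy].
  by rewrite (le_trans (cdf_leftS _))// cdf_left_le.
apply: measurable_funD; first exact: measurableT_comp mFl measurable_fst.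
apply: measurable_funM => //.
by apply: measurable_funB; [exact: measurableT_comp mF measurable_fst|exact: measurableT_comp mFl measurable_fst].
Qed.

Section Level.
Variable t : R.
Hypothesis t01 : 0 < t < 1.
Let c := quantile F t.
Let D := F c - Fl c.
(** Up to null sets, the conditional probability given [z] that the rank is at most [t]: 1 below the
    quantile [c], the proportion of the jump to be filled at [c], and 0 above. If there is no jump,
    the quotient is 0 by convention and the event [zeta z = c] is null. *)
Let lower (z : T) : R := \1_[set z | zeta z < c] z + (t - Fl c) / D * \1_[set z | zeta z = c] z.

Let Fc : t <= F c.
Proof. by rewrite -(quantile_cdf_le mu mzeta). Qed.

Let D0 : 0 <= D.
Proof. by rewrite subr_ge0 cdf_leftS. Qed.

Let r01 : 0 <= (t - Fl c) / D <= 1.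
Proof.
apply/andP; split; first by rewrite divr_ge0 // subr_ge0 cdf_left_quantile.
have [->|Dn] := eqVneq D 0; first by rewrite invr0 mulr0.
have Dp : 0 < D by rewrite lt_neqAle eq_sym Dn.
by rewrite ler_pdivrMr// mul1r lerD2r Fc.
Qed.

Let integral_lower : (\int[mu]_z (lower z)%:E = t%:E)%E.
Proof.
case/andP : r01 => r0 _.
under eq_integral do rewrite EFinD EFinM.
rewrite ge0_integralD//; last 3 first.
- by apply/measurable_EFinP; exact: measurable_indic.
- by move=> z _; rewrite mule_ge0 ?lee_fin.
- by apply: emeasurable_funM => //; apply/measurable_EFinP; exact: measurable_indic.
rewrite ge0_integralZl//; last first.
  by apply/measurable_EFinP; exact: measurable_indic.
rewrite !integral_indic// !setIT.
rewrite [X in (X + _)%E](FlE _) [X in (_ * X)%E](cdf_jump _) -EFinM -EFinD.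
congr EFin; rewrite -/D.
have [D0'|Dn] := eqVneq D 0; last by rewrite divfK// addrC subrK.
rewrite D0' invr0 !mulr0 addr0; apply/eqP; rewrite eq_le cdf_left_quantile//=.
by rewrite (le_trans Fc)// -subr_le0 -/D D0'.
Qed.

Let ge1_unif (A : set R) : measurable A -> `]0, 1[%classic `<=` A -> unif A = 1%E.
Proof.
move=> mA h; apply/eqP; rewrite eq_le probability_le1//=.
by rewrite -(@unif_itv01 R); apply: le_measure; rewrite ?inE.
Qed.

Let null_unif (A : set R) : measurable A -> A `<=` ~` `]0, 1[%classic -> unif A = 0%E.
Proof.
move=> mA h; apply/eqP; rewrite eq_le measure_ge0 andbT.
rewrite -(@unif_itv01C R); apply: le_measure; rewrite ?inE//.
exact: measurableC.
Qed.

Let mrank z : measurable_fun setT (rank mu zeta z).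
Proof. by have /(measurable_fun_pair2 z) := measurable_rank. Qed.

(** Fiberwise comparison with [lower], whose integral is [t]. Only a lower bound is proved for [<=],
    and an upper bound for [<] in the next lemma, because a rank equal to [t] cannot be excluded on
    each fiber: above [c] one only knows that the rank is at least [t]. *)
Lemma rank_le_ge : (t%:E <= (mu \x unif) [set zw | (rank mu zeta zw.1 zw.2 <= t)%R])%E.
Proof.
rewrite -integral_lower /product_measure1.
have m1 : measurable [set zw : T * R | rank mu zeta zw.1 zw.2 <= t].
  rewrite -[X in measurable X]setTI.
  exact: (measurable_fun_ler measurable_rank (measurable_cst t)).
apply: ge0_le_integral => //.
- move=> z _; rewrite lee_fin /lower addr_ge0// mulr_ge0//.
  by case/andP : r01.
- apply/measurable_EFinP; apply: measurable_funD; first exact: measurable_indic.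
  by apply: measurable_funM => //; exact: measurable_indic.
- exact: measurable_fun_xsection.
move=> z _ /=.
have -> : xsection [set zw : T * R | rank mu zeta zw.1 zw.2 <= t] z =
  [set w | rank mu zeta z w <= t] by apply/seteqP; split => w /=; rewrite /xsection/= inE.
have mA : measurable [set w | rank mu zeta z w <= t].
  rewrite -[X in measurable X]setTI.
  exact: (measurable_fun_ler (mrank z) (measurable_cst t)).
rewrite /lower !indicE.
have [zc|zc|zc] := ltgtP (zeta z) c.
- rewrite mem_set//= memNset; last by move=> /= h; rewrite h ltxx in zc.
  rewrite mulr0 addr0 ge1_unif// => w /=; rewrite in_itv/= => /andP[w0 w1].
  rewrite /rank (@le_trans _ _ (F (zeta z)))//.
    rewrite -/F -/Fl; have := cdf_leftS (zeta z); nra.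
  by rewrite ltW// ltNge -(quantile_cdf_le mu mzeta)// -ltNge.
- rewrite memNset; last by move=> /= h; rewrite ltNge (ltW zc) in h.
  rewrite memNset; last by move=> /= h; rewrite h ltxx in zc.
  by rewrite mulr0 addr0 measure_ge0.
- rewrite memNset; last by move=> /= h; rewrite zc ltxx in h.
  rewrite mem_set// add0r mulr1.
  have [->|Dn] := eqVneq D 0; first by rewrite invr0 mulr0.
  have Dp : 0 < D by rewrite lt_neqAle eq_sym Dn.
  rewrite -(unif_le r01); apply: le_measure; rewrite ?inE//.
  move=> w /=; rewrite in_itv/= ler_pdivlMr// /rank zc -/F -/Fl -/D; lra.
Qed.

Lemma rank_lt_le : ((mu \x unif) [set zw | (rank mu zeta zw.1 zw.2 < t)%R] <= t%:E)%E.
Proof.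
rewrite -integral_lower /product_measure1.
have m1 : measurable [set zw : T * R | rank mu zeta zw.1 zw.2 < t].
  rewrite -[X in measurable X]setTI.
  exact: (measurable_fun_ltr measurable_rank (measurable_cst t)).
apply: ge0_le_integral => //.
- exact: measurable_fun_xsection.
- apply/measurable_EFinP; apply: measurable_funD; first exact: measurable_indic.
  by apply: measurable_funM => //; exact: measurable_indic.
move=> z _ /=.
have -> : xsection [set zw : T * R | rank mu zeta zw.1 zw.2 < t] z =
  [set w | rank mu zeta z w < t] by apply/seteqP; split => w /=; rewrite /xsection/= inE.
have mA : measurable [set w | rank mu zeta z w < t].
  rewrite -[X in measurable X]setTI.
  exact: (measurable_fun_ltr (mrank z) (measurable_cst t)).
rewrite /lower !indicE.
have [zc|zc|zc] := ltgtP (zeta z) c.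
- rewrite mem_set//= memNset; last by move=> /= h; rewrite h ltxx in zc.
  by rewrite mulr0 addr0 probability_le1.
- rewrite memNset; last by move=> /= h; rewrite ltNge (ltW zc) in h.
  rewrite memNset; last by move=> /= h; rewrite h ltxx in zc.
  rewrite mulr0 addr0 null_unif// => w /= + /=; rewrite in_itv/= => h /andP[w0 w1].
  move: h; rewrite ltNge => /negP; apply; rewrite /rank.
  rewrite (le_trans Fc)// (le_trans (cdf_left_le zc))//.
  by rewrite lerDl mulr_ge0 ?(ltW w0)// subr_ge0; exact: cdf_leftS.
- rewrite memNset; last by move=> /= h; rewrite zc ltxx in h.
  rewrite mem_set// add0r mulr1.
  have [D0'|Dn] := eqVneq D 0.
    rewrite D0' invr0 mulr0 (_ : [set w | _] = set0) ?measure0//.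
    rewrite -subset0 => w /=; rewrite /rank zc -/F -/Fl -/D D0' mulr0 addr0.
    by move: D0' Fc; rewrite /D; lra.
  have Dp : 0 < D by rewrite lt_neqAle eq_sym Dn.
  rewrite -(unif_le r01); apply: le_measure; rewrite ?inE//.
  move=> w /=; rewrite in_itv/= ler_pdivlMr// /rank zc -/F -/Fl -/D; lra.
Qed.

End Level.

Let U (zw : T * R) : R := rank mu zeta zw.1 zw.2.

Let mUle t : measurable [set zw | U zw <= t].
Proof.
rewrite -[X in measurable X]setTI.
exact: (measurable_fun_ler measurable_rank (measurable_cst t)).
Qed.

Let mUlt t : measurable [set zw | U zw < t].
Proof.
rewrite -[X in measurable X]setTI.
exact: (measurable_fun_ltr measurable_rank (measurable_cst t)).
Qed.

(** The missing upper bound at [t] follows from the strict one at [t + e], which is available as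
    long as [t + e < 1]; beyond, there is nothing to prove. *)
Lemma rank_le t : 0 < t < 1 -> (mu \x unif)%E [set zw | U zw <= t] = t%:E.
Proof.
move=> t01; apply/eqP; rewrite eq_le rank_le_ge// andbT.
apply/lee_addgt0Pr => e e0.
have [h|h] := ltP (t + e) 1; last first.
  have h1 : (1%:E <= (t + e)%:E :> \bar R)%E by rewrite lee_fin.
  exact: (le_trans (probability_le1 _ (mUle t)) h1).
rewrite (@le_trans _ _ ((mu \x unif)%E [set zw | U zw < t + e]))//.
  apply: le_measure; rewrite ?inE// => zw /= Ut.
  by rewrite (le_lt_trans Ut)// ltrDl.
rewrite -EFinD; apply: rank_lt_le; rewrite h andbT.
by case/andP : t01 => t0 _; rewrite addr_gt0.
Qed.

Lemma rank_law (A : set R) : measurable A -> (mu \x unif)%E (U @^-1` A) = unif A.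
Proof.
move=> mA; have mU : measurable_fun setT U by exact: measurable_rank.
pose nu : probability R R := distribution (mu \x unif)%E (mkmfun mU).
suff : nu A = unif A by [].
have nuT : nu setT = 1%:E by exact: probability_setT.
have unifT : (unif : probability R R) setT = 1%:E by exact: probability_setT.
have nuC u : nu `]u, +oo[%classic = (1 - nu `]-oo, u]%classic)%E.
  by rewrite -setCitvl probability_setC.
have unifC u : unif `]u, +oo[%classic = (1 - unif `]-oo, u]%classic)%E.
  by rewrite -setCitvl probability_setC.
have nu01 t : 0 < t < 1 -> nu `]-oo, t]%classic = t%:E.
  move=> t01; rewrite -(rank_le t01); congr ((mu \x unif) _)%E.
refine (@measure_unique _ R _ (@RGenOInfty.G R) (fun n => `]- n%:R, +oo[%classic)
  _ _ _ _ nu unif _ _ A mA) => //.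
- exact: RGenOInfty.measurableE.
- move=> _ _ [x ->] [y ->]; exists (Num.max x y).
  by apply/seteqP; split => z /=; rewrite !in_itv/= !andbT gt_max => /andP.
- by move=> n; exists (- n%:R).
- rewrite -subTset => x _; exists (Num.truncn `|x|).+1 => //=.
  by rewrite in_itv/= andbT ltrNl (le_lt_trans _ (truncnS_gt _))// -normrN ler_norm.
- move=> _ [u ->]; rewrite [LHS]nuC [RHS]unifC; congr (1 - _)%E.
  have [u0|u0] := leP u 0.
    have H (m : probability R R) : (forall t, 0 < t < 1 -> m `]-oo, t]%classic = t%:E) ->
        m `]-oo, u]%classic = 0%E.
      move=> mt; apply/eqP; rewrite eq_le measure_ge0 andbT.
      apply/lee_addgt0Pr => e e0; rewrite add0e.
      (* The cap [2^-1] keeps the comparison level inside []0, 1[]. *)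
      pose e' := Num.min e 2^-1.
      have e'01 : 0 < e' < 1.
        by rewrite lt_min e0 invr_gt0 ltr0n/= gt_min invf_lt1 ?ltr1n ?orbT.
      rewrite (@le_trans _ _ e'%:E)//; last by rewrite lee_fin ge_min lexx.
      rewrite -mt//; apply: le_measure; rewrite ?inE//.
      apply: subset_itvl; rewrite bnd_simp (le_trans u0)//.
      by case/andP : e'01 => /ltW.
    rewrite !H// => t /andP[t0 t1].
    by rewrite unif_le// !ltW.
  have [u1|u1] := ltP u 1.
    by rewrite nu01 ?u0// unif_le// !ltW.
  have H (m : probability R R) : (forall t, 0 < t < 1 -> m `]-oo, t]%classic = t%:E) ->
      m `]-oo, u]%classic = 1%E.
    move=> mt; apply/eqP; rewrite eq_le probability_le1//=.
    apply/lee_addgt0Pr => e e0.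
    pose e' := Num.min e 2^-1.
    have e'01 : 0 < e' < 1.
      by rewrite lt_min e0 invr_gt0 ltr0n/= gt_min invf_lt1 ?ltr1n ?orbT.
    have e1 : 0 < 1 - e' < 1 by case/andP : e'01 => *; apply/andP; split; lra.
    rewrite (@le_trans _ _ ((1 - e')%:E + e%:E)%E)//.
      rewrite -EFinD lee_fin -addrA lerDl addrC subr_ge0.
      by rewrite ge_min lexx.
    rewrite leeD2r// -mt//; apply: le_measure; rewrite ?inE//.
    apply: subset_itvl; rewrite bnd_simp (le_trans _ u1)//.
    by case/andP : e1 => _ /ltW.
  rewrite !H// => t /andP[t0 t1].
  by rewrite unif_le// !ltW.
- by move=> k; rewrite (le_lt_trans (probability_le1 _ _))// ltry.
Qed.

Hypothesis izeta : mu.-integrable setT (EFin \o zeta).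

(** One inequality suffices. The rank is at most [F (zeta z)], so its quantile is at most [zeta z];
    the two variables have the same law, hence the same finite mean, and a difference of constant
    sign with mean 0 vanishes almost everywhere. *)
Lemma quantile_rank :
  \forall zw \ae (mu \x unif)%E, tquantile F 1 (U zw) = zeta zw.1.
Proof.
pose Q := tquantile F 1.
have mQ : measurable_fun setT Q by exact: measurable_quantile_cdf.
have mU : measurable_fun setT U by exact: measurable_rank.
have mz1 : measurable_fun setT (fun zw : T * R => zeta zw.1).
  exact: measurableT_comp.
have iQ : unif.-integrable setT (EFin \o Q).
  exact: (@integrable_cdf_transform _ _ _ mu _ mzeta id).
have law1 (A : set T) : measurable A -> mu A = (mu \x unif)%E (fst @^-1` A).
  move=> mA; rewrite (_ : fst @^-1` A = A `*` setT).
    by rewrite product_measure1E//; rewrite [X in (_ * X)%E](@probability_setT _ _ _ unif) mule1.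
  by apply/seteqP; split => -[z w] //= [].
have lawU (A : set R) : measurable A -> unif A = (mu \x unif)%E (U @^-1` A).
  by move=> mA; rewrite rank_law.
have iQU : (mu \x unif)%E.-integrable setT (EFin \o (Q \o U)).
  exact: (@integrable_same_law _ _ _ R _ _ R unif _ id U).
have iz1 : (mu \x unif)%E.-integrable setT (EFin \o (fun zw : T * R => zeta zw.1)).
  exact: (@integrable_same_law _ _ _ T _ T R mu _ id fst).
have E1 : (\int[mu \x unif]_zw (zeta zw.1)%:E = \int[mu]_z (zeta z)%:E)%E.
  have := @integral_same_law _ _ _ T _ T R mu _ id fst _ _ law1 zeta mzeta izeta.
  by move=> ->.
have E2 : (\int[mu \x unif]_zw (Q (U zw))%:E = \int[unif]_t (Q t)%:E)%E.
  have := @integral_same_law _ _ _ R _ _ R unif _ id U _ _ lawU Q mQ iQ.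
  by move=> ->.
have E3 : (\int[mu]_z (zeta z)%:E = \int[unif]_t (Q t)%:E)%E.
  have := Rintegral_cdf_transform (g := id) mzeta (@measurable_id _ _ _) izeta.
  rewrite /Rintegral => E.
  rewrite -[LHS]fineK; last exact: integrable_fin_num.
  rewrite -[RHS]fineK; last exact: integrable_fin_num.
  by congr EFin.
have leQ : \forall zw \ae (mu \x unif)%E, Q (U zw) <= zeta zw.1.
  have U01 : \forall zw \ae (mu \x unif)%E, 0 < U zw < 1.
    exists (U @^-1` (~` `]0, 1[%classic)); split => //=.
    - by rewrite -[X in measurable X]setTI; apply: mU => //; exact: measurableC.
    - rewrite -[LHS](lawU (~` `]0, 1[%classic)) ?unif_itv01C//; exact: measurableC.
  have w01 : \forall zw \ae (mu \x unif)%E, 0 < zw.2 < 1.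
    exists (setT `*` (~` `]0, 1[%classic)); split => //=.
    - by apply: measurableX => //; exact: measurableC.
    - rewrite product_measure1E//; last exact: measurableC.
      by rewrite [X in (_ * X)%E]unif_itv01C mule0.
  apply: filterS2 U01 w01 => zw U01 /andP[w0 w1].
  rewrite /Q /tquantile ltr01 U01 mul1r/= (quantile_cdf_le mu mzeta)// /U /rank.
  have := cdf_leftS (zeta zw.1); rewrite -/F -/Fl; nra.
pose h (zw : T * R) : R := `|zeta zw.1 - Q (U zw)|.
have mh : measurable_fun setT h.
  by apply: measurableT_comp => //; apply: measurable_funB => //; exact: measurableT_comp.
have : (\int[mu \x unif]_zw (h zw)%:E = 0)%E.
  rewrite (ae_eq_integral (fun zw => (zeta zw.1)%:E - (Q (U zw))%:E)%E)//; last 3 first.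
  - exact/measurable_EFinP.
  - by apply: emeasurable_funB; apply/measurable_EFinP => //; exact: measurableT_comp.
  - by apply: filterS leQ => zw zwl _ /=; rewrite /h ger0_norm ?subr_ge0.
  rewrite integralB_EFin// E1 E2 E3 subee//.
  exact: integrable_fin_num.
have mEh : measurable_fun setT (EFin \o h) by exact/measurable_EFinP.
have Eh0 zw : (0 <= (EFin \o h) zw)%E by rewrite lee_fin /h normr_ge0.
move=> /(ge0_ae_eq0 mEh Eh0); apply: filterS => zw /= [] /eqP; rewrite normr_eq0 subr_eq0 => /eqP.
by move=> ->.
Qed.

End Rank.

Section CondLaw.
Context d d1 d2 (Omega : measurableType d) (T : measurableType d1)
  (E : measurableType d2) {R : realType} (P : probability Omega R).
Variables (A : Omega -> T) (C : Omega -> E) (k : R.-pker E ~> T).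
Hypothesis mA : measurable_fun setT A.
Hypothesis mC : measurable_fun setT C.
Hypothesis kP : is_cond_law P A C k.

Let CA w := (C w, A w).

Let mCA : measurable_fun setT CA.
Proof. exact: measurable_fun_pair. Qed.

Let mk (B : set (E * T)) : measurable B ->
  measurable_fun setT (fun w => k (C w) (xsection B (C w))).
Proof.
move=> mB; apply: (measurableT_comp (f := fun x => k x (xsection B x))) => //.
exact: measurable_fun_xsection_finite_kernel (mem_set mB).
Qed.

(** [is_cond_law] only speaks of rectangles. They form a generating pi-system, and the sets [B]
    satisfying the equation form a Dynkin system. *)
Lemma cond_law_section (B : set (E * T)) : measurable B ->
  P (CA @^-1` B) = (\int[P]_w k (C w) (xsection B (C w)))%E.
Proof.
move=> mB.
pose G := [set X `*` Y | X in @measurable _ E & Y in @measurable _ T].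
have mG : @measurable _ (E * T)%type = <<s G >> by rewrite measurable_prod_measurableType.
have setIG : setI_closed G.
  move=> X Y [X1 mX1 [X2 mX2 <-{X}]] [Y1 mY1 [Y2 mY2 <-{Y}]].
  exists (X1 `&` Y1); first exact: measurableI.
  by exists (X2 `&` Y2); [exact: measurableI|rewrite setXI].
pose Q (B : set (E * T)) := P (CA @^-1` B) = (\int[P]_w k (C w) (xsection B (C w)))%E.
suff : Q B by [].
apply: (dynkin_induction mG setIG); last by rewrite -mG.
- rewrite /Q preimage_setT probability_setT.
  rewrite -[LHS](@probability_setT _ _ _ P) -[LHS]mul1e -integral_cst//.
  apply: eq_integral => w _; rewrite [xsection _ _](_ : _ = setT).
    by apply/esym; exact: prob_kernel.
  by apply/seteqP; split => z //= _; rewrite /xsection/= inE.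
- move=> _ [X mX [Y mY <-]]; rewrite /Q.
  have -> : CA @^-1` (X `*` Y) = A @^-1` Y `&` C @^-1` X.
    by apply/seteqP; split => w /= [].
  rewrite kP// integral_mkcond; apply: eq_integral => w _.
  rewrite patchE; case: ifPn; rewrite ?inE ?notin_setE/= => XCw.
    by rewrite in_xsectionX// inE.
  by rewrite notin_xsectionX ?measure0// notin_setE.
- move=> S mS; rewrite /Q => QS.
  rewrite preimage_setC probability_setC; last first.
    by rewrite -[X in measurable X]setTI; exact: mCA.
  rewrite QS -(@probability_setT _ _ _ P) -[P setT]mul1e -integral_cst//.
  rewrite -integralB//; last 2 first.
  + exact: finite_measure_integrable_cst.
  + apply: (@le_integrable _ _ _ P _ measurableT _ (cst 1%E)) => //.
    * exact: mk.
    * move=> w _ /=; rewrite gee0_abs// normr1 -(@prob_kernel _ _ _ _ _ k (C w)).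
      by apply: le_measure; rewrite ?inE//; exact: measurable_xsection.
    * exact: finite_measure_integrable_cst.
  apply: eq_integral => w _.
  rewrite -(@prob_kernel _ _ _ _ _ k (C w)).
  have mx : measurable (xsection S (C w)) by exact: measurable_xsection.
  have koo : (k (C w) setT < +oo)%E by rewrite prob_kernel ltry.
  have := measureD measurableT mx koo; rewrite setTI => <-.
  congr (k (C w) _); apply/seteqP; split => z /=; rewrite /xsection/= !inE.
    by move=> [].
  by move=> h; split.
- move=> F mF tF QF; rewrite /Q.
  rewrite preimage_bigcup measure_bigcup//; last 2 first.
  + by move=> i _; rewrite -[X in measurable X]setTI; exact: mCA.
  + by move=> i j _ _ [w [Fi Fj]]; apply: (tF i j I I); exists (CA w).
  transitivity (\sum_(0 <= i <oo) P (CA @^-1` F i))%E.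
    by apply: eq_eseriesl => i; rewrite in_setT.
  under eq_eseriesr do rewrite QF.
  rewrite -integral_nneseries//; last by move=> n; exact: mk.
  apply: eq_integral => w _.
  rewrite xsection_bigcup measure_bigcup//; last 2 first.
  + by move=> i _; exact: measurable_xsection.
  + exact: trivIset_xsection.
  by apply: eq_eseriesl => i; rewrite in_setT.
Qed.

Import HBNNSimple.

Lemma cond_law_integral (G : E * T -> \bar R) : measurable_fun setT G ->
  (forall x, 0 <= G x)%E ->
  (\int[P]_w G (C w, A w) = \int[P]_w \int[k (C w)]_z G (C w, z))%E.
Proof.
move=> mG G0.
pose h := nnsfun_approx measurableT mG.
have hG x : (h n x)%:E @[n --> \oo] --> G x by exact: cvg_nnsfun_approx.
have mh n : measurable_fun setT (EFin \o h n) by exact/measurable_EFinP.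
have mh2 n x : measurable_fun setT (fun z => (h n (x, z))%:E).
  exact: measurableT_comp (mh n) _.
have ndh x : {homo (fun n => (h n x)%:E) : n m / (n <= m)%N >-> (n <= m)%E}.
  by move=> n m nm; rewrite lee_fin; exact/lefP/nd_nnsfun_approx.
have mkh n : measurable_fun setT (fun w => \int[k (C w)]_z (h n (C w, z))%:E)%E.
  apply: (measurableT_comp (f := fun x => \int[k x]_z (h n (x, z))%:E)%E) => //.
  apply: (measurable_fun_integral_finite_kernel (EFin \o h n) k) => //.
  by move=> x; rewrite lee_fin.
have step n : (\int[P]_w (h n (C w, A w))%:E =
    \int[P]_w \int[k (C w)]_z (h n (C w, z))%:E)%E.
  under eq_integral do rewrite fimfunE -fsumEFin//.
  rewrite ge0_integral_fsum//; last 2 first.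
  - move=> r; apply/measurable_EFinP; apply: measurable_funM => //.
    exact: measurableT_comp (measurable_indic _) mCA.
  - by move=> r w _; rewrite EFinM nnfun_muleindic_ge0.
  transitivity (\int[P]_w (\sum_(r \in range (h n))
      \int[k (C w)]_z (r * \1_(h n @^-1` [set r]) (C w, z))%:E))%E; last first.
    apply: eq_integral => w _; rewrite -ge0_integral_fsum//; last 2 first.
    - move=> r; apply/measurable_EFinP; apply: measurable_funM => //.
      exact: measurableT_comp (measurable_indic _) _.
    - by move=> r z _; rewrite EFinM nnfun_muleindic_ge0.
    by apply: eq_integral => z _; rewrite fimfunE -fsumEFin.
  have mi r : measurable_fun setT (fun w =>
      \int[k (C w)]_z (r * \1_(h n @^-1` [set r]) (C w, z))%:E)%E.
    apply: (measurableT_comp (f := fun x => \int[k x]_z (r * \1_(h n @^-1` [set r]) (x, z))%:E)%E) => //.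
    apply: (measurable_fun_integral_finite_kernel (fun xz => (r * \1_(h n @^-1` [set r]) xz)%:E) k).
    + by move=> x; rewrite EFinM nnfun_muleindic_ge0.
    + by apply/measurable_EFinP; apply: measurable_funM.
  rewrite ge0_integral_fsum//; last first.
    move=> r w _; apply: integral_ge0 => z _.
    by rewrite EFinM nnfun_muleindic_ge0.
  apply: eq_fsbigr => r _.
  have mr : measurable (h n @^-1` [set r]) by [].
  have [r0|r0] := leP 0 r; last first.
    rewrite preimage_nnfun0// !integral0_eq// => w _.
      by rewrite integral0_eq// => z _; rewrite indic0 mulr0.
    by rewrite indic0 mulr0.
  under eq_integral do rewrite EFinM.
  rewrite ge0_integralZl//; last first.
    by apply/measurable_EFinP; exact: measurableT_comp (measurable_indic _) mCA.
  under [RHS]eq_integral => w _.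
    under eq_integral do rewrite EFinM.
    rewrite ge0_integralZl//; last first.
      by apply/measurable_EFinP; exact: measurableT_comp (measurable_indic _) _.
    over.
  have ik w : (\int[k (C w)]_z (\1_(h n @^-1` [set r]) (C w, z))%:E =
      k (C w) (xsection (h n @^-1` [set r]) (C w)))%E.
    transitivity (\int[k (C w)]_z (\1_(xsection (h n @^-1` [set r]) (C w)) z)%:E)%E.
      by apply: eq_integral => z _; rewrite !indicE mem_xsection.
    by rewrite integral_indic ?setIT//; exact: measurable_xsection.
  rewrite ge0_integralZl//; last 2 first.
  - by under eq_fun do rewrite ik; exact: mk.
  - by move=> w _; rewrite ik.
  congr (_ * _)%E; under [RHS]eq_integral do rewrite ik.
  rewrite -cond_law_section//.
  transitivity (\int[P]_w (\1_(CA @^-1` (h n @^-1` [set r])) w)%:E)%E.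
    by apply: eq_integral => w _.
  rewrite integral_indic ?setIT//.
  by rewrite -[X in measurable X]setTI; exact: mCA.
transitivity (limn (fun n => \int[P]_w (h n (C w, A w))%:E)%E).
  rewrite -monotone_convergence//=.
  - by apply: eq_integral => w _; apply/esym/cvg_lim.
  - by move=> n; exact: measurableT_comp (mh n) mCA.
  - by move=> n w _; rewrite lee_fin.
rewrite (_ : (fun n => _) = (fun n => \int[P]_w \int[k (C w)]_z (h n (C w, z))%:E))%E; last first.
  exact/funext.
rewrite -monotone_convergence//=.
- apply: eq_integral => w _; rewrite -monotone_convergence//=.
  + by apply: eq_integral => z _; apply/cvg_lim.
  + by move=> n z _; rewrite lee_fin.
- by move=> n w _; apply: integral_ge0 => z _; rewrite lee_fin.
- move=> w _ n m' nm; apply: ge0_le_integral => //.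
  + by move=> z _; rewrite lee_fin.
  + by move=> z _; exact: ndh.
Qed.

End CondLaw.

(** * Kernels: measurability in the conditioning variable *)

Section KernelFst.
Context d1 d2 d3 (E : measurableType d1) (F : measurableType d2)
  (T : measurableType d3) {R : realType} (k : R.-pker E ~> T).

(** A dummy second parameter is added to the kernel, so that it can measure sections of sets that
    depend on [x] and on a further variable, such as the argument of a cdf. *)
Definition kfst (xy : E * F) : {measure set T -> \bar R} := k xy.1.

Let measurable_kfst U : measurable U -> measurable_fun setT (kfst ^~ U).
Proof.
move=> mU; apply: (measurableT_comp (f := k ^~ U) (g := fst)) => //.
exact: measurable_kernel.
Qed.

HB.instance Definition _ := isKernel.Build _ _ _ _ _ kfst measurable_kfst.

Let kfst_prob xy : kfst xy setT = 1%E.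
Proof. exact: prob_kernel. Qed.

HB.instance Definition _ := Kernel_isProbability.Build _ _ _ _ _ kfst kfst_prob.

End KernelFst.

(* [k x] carries no canonical structure of probability; [kprob k x] does. *)
Section KernelProbability.
Context d1 d2 (E : measurableType d1) (T : measurableType d2) {R : realType}
  (k : R.-pker E ~> T) (x : E).

Definition kval (A : set T) : \bar R := k x A.

Let kval0 : kval set0 = 0%E.
Proof. exact: measure0. Qed.

Let kval_ge0 A : (0 <= kval A)%E.
Proof. exact: measure_ge0. Qed.

Let kval_sigma_additive : semi_sigma_additive kval.
Proof. exact: measure_semi_sigma_additive. Qed.

HB.instance Definition _ := isMeasure.Build _ _ _ kval
  kval0 kval_ge0 kval_sigma_additive.

Let kval_setT : kval setT = 1%:E.
Proof. exact: prob_kernel. Qed.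

HB.instance Definition _ := @Measure_isProbability.Build _ _ R kval kval_setT.

Definition kprob : probability T R := kval.

Lemma integral_kprob D (f : T -> \bar R) :
  (\int[kprob]_(z in D) f z = \int[k x]_(z in D) f z)%E.
Proof. exact: eq_measure_integral. Qed.

Lemma Rintegral_kprob D (f : T -> R) :
  \int[kprob]_(z in D) f z = \int[k x]_(z in D) f z.
Proof. by rewrite /Rintegral integral_kprob. Qed.

Lemma integrable_kprob D (f : T -> \bar R) :
  kprob.-integrable D f <-> (k x).-integrable D f.
Proof.
by split => /integrableP[mf fi]; apply/integrableP; split => //;
  move: fi; rewrite integral_kprob.
Qed.

End KernelProbability.

Section KernelMeasurability.
Context d1 d2 (E : measurableType d1) (T : measurableType d2) {R : realType}
  (k : R.-pker E ~> T).
Variable zeta : E -> T -> R.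
Hypothesis mzeta : measurable_fun setT (fun xz : E * T => zeta xz.1 xz.2).

Lemma measurable_curry x : measurable_fun setT (zeta x).
Proof. by have /(measurable_fun_pair2 x) := mzeta. Qed.

Lemma measurable_kernel_section (F : Type) dF (Y : measurableType dF)
    (B : set (E * Y * T)) : measurable B ->
  measurable_fun setT (fun xy : E * Y => fine (k xy.1 [set z | B (xy, z)])).
Proof.
move=> mB; apply: (@measurableT_comp _ _ _ _ _ _ fine) => //.
have := measurable_fun_xsection_finite_kernel (kfst (F := Y) k) (mem_set mB).
congr measurable_fun; apply/funext => xy; congr (k xy.1 _).
by apply/seteqP; split => z /=; rewrite /xsection/= inE.
Qed.

Lemma measurable_cdf_kernel :
  measurable_fun setT (fun xy : E * R => cdf_of (k xy.1) (zeta xy.1) xy.2).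
Proof.
apply: (@measurable_kernel_section unit _ R [set xyz | zeta xyz.1.1 xyz.2 <= xyz.1.2]).
rewrite -[X in measurable X]setTI.
apply: (measurable_fun_ler (f := fun xyz : E * R * T => zeta xyz.1.1 xyz.2)
  (g := fun xyz : E * R * T => xyz.1.2)) => //.
  apply: (measurableT_comp (f := fun xz : E * T => zeta xz.1 xz.2)
    (g := fun xyz : E * R * T => (xyz.1.1, xyz.2))) => //.
  by apply: measurable_fun_pair => //; exact: measurableT_comp.
exact: measurableT_comp.
Qed.

Lemma measurable_cdf_left_kernel :
  measurable_fun setT (fun xy : E * R => cdf_left (k xy.1) (zeta xy.1) xy.2).
Proof.
apply: (@measurable_kernel_section unit _ R [set xyz | zeta xyz.1.1 xyz.2 < xyz.1.2]).
rewrite -[X in measurable X]setTI.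
apply: (measurable_fun_ltr (f := fun xyz : E * R * T => zeta xyz.1.1 xyz.2)
  (g := fun xyz : E * R * T => xyz.1.2)) => //.
  apply: (measurableT_comp (f := fun xz : E * T => zeta xz.1 xz.2)
    (g := fun xyz : E * R * T => (xyz.1.1, xyz.2))) => //.
  by apply: measurable_fun_pair => //; exact: measurableT_comp.
exact: measurableT_comp.
Qed.

Lemma measurable_tquantile_kernel : measurable_fun setT
  (fun xt : E * R => tquantile (cdf_of (k xt.1) (zeta xt.1)) 1 xt.2).
Proof.
apply: (measurable_tquantile (F := fun x => cdf_of (k x) (zeta x)) (M := fun=> 1)).
- by move=> u; have /(measurable_fun_pair1 u) := measurable_cdf_kernel.
- by [].
- by move=> x t u _ t01; rewrite mul1r (quantile_cdf_le (kprob k x) (measurable_curry x)).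
Qed.

Lemma measurable_rank_kernel : measurable_fun setT
  (fun xzw : E * T * R => rank (k xzw.1.1) (zeta xzw.1.1) xzw.1.2 xzw.2).
Proof.
have m11 : measurable_fun setT (fun xzw : E * T * R => xzw.1.1) by exact: measurableT_comp.
have mz : measurable_fun setT (fun xzw : E * T * R => zeta xzw.1.1 xzw.1.2).
  exact: (measurableT_comp mzeta measurable_fst).
have mF : measurable_fun setT (fun xzw : E * T * R =>
    cdf_of (k xzw.1.1) (zeta xzw.1.1) (zeta xzw.1.1 xzw.1.2)).
  apply: (measurableT_comp measurable_cdf_kernel
    (g := fun xzw : E * T * R => (xzw.1.1, zeta xzw.1.1 xzw.1.2))).
  exact: measurable_fun_pair.
have mFl : measurable_fun setT (fun xzw : E * T * R =>
    cdf_left (k xzw.1.1) (zeta xzw.1.1) (zeta xzw.1.1 xzw.1.2)).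
  apply: (measurableT_comp measurable_cdf_left_kernel
    (g := fun xzw : E * T * R => (xzw.1.1, zeta xzw.1.1 xzw.1.2))).
  exact: measurable_fun_pair.
by apply: measurable_funD => //; apply: measurable_funM => //; exact: measurable_funB.
Qed.

Lemma measurable_mean_kernel :
  measurable_fun setT (fun x => \int[k x]_z zeta x z).
Proof.
apply: (@measurableT_comp _ _ _ _ _ _ fine) => //.
under eq_fun do rewrite integralE.
have mEz : measurable_fun setT (fun xz : E * T => (zeta xz.1 xz.2)%:E).
  exact/measurable_EFinP.
have mp := measurable_fun_integral_finite_kernel _ k (funepos_ge0 _) (measurable_funepos mEz).
have mn := measurable_fun_integral_finite_kernel _ k (funeneg_ge0 _) (measurable_funeneg mEz).
apply: emeasurable_funB.
  move: mp; congr measurable_fun; apply/funext => x.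
  by apply: eq_integral => z _; rewrite !funeposE.
move: mn; congr measurable_fun; apply/funext => x.
by apply: eq_integral => z _; rewrite !funenegE.
Qed.

End KernelMeasurability.

(** * The martingale coupling *)

Lemma integral_bernoulli (R : realType) (r : R) (A B : \bar R) :
  0 <= r <= 1 ->
  (\int[unif]_w (if (w < r)%R then A else B) = r%:E * A + (1 - r)%:E * B)%E.
Proof.
move=> r01; case/andP : (r01) => r0 r1.
have ur : unif `]-oo, r[%classic = r%:E.
  have e : `]-oo, r]%classic = `]-oo, r[%classic `|` [set r] by rewrite setUitv1.
  have := unif_le r01; rewrite e measureU//; last first.
    by rewrite -subset0 => x /= []; rewrite in_itv/= => + xq; rewrite xq ltxx.
  by rewrite [X in (_ + X)%R](unif_set1 r) addr0.
have ur' : unif `[r, +oo[%classic = (1 - r)%:E.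
  by rewrite -setCitvl probability_setC// ur.
have -> : [set: R] = `]-oo, r[%classic `|` `[r, +oo[%classic.
  by rewrite -setCitvl setUv.
have mif : measurable_fun setT (fun w : R => if (w < r)%R then A else B).
  by apply: measurable_fun_ifT => //; exact: measurable_fun_ltr.
rewrite integral_setU//=; last 2 first.
- exact: measurable_funTS.
- by rewrite -setCitvl; exact/disj_setPCl.
congr (_ + _)%E.
  under eq_integral => w.
    rewrite inE/= in_itv/= => ->.
    over.
  rewrite integral_cst// muleC; congr (_ * _)%E; exact: ur.
under eq_integral => w.
  rewrite inE/= in_itv/= andbT leNgt => /negbTE ->.
  over.
rewrite integral_cst// muleC; congr (_ * _)%E; exact: ur'.
Qed.

Lemma product_unif_fst d (T : measurableType d) (R : realType) (Q : probability T R)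
    (A : set T) : measurable A -> (Q \x unif)%E (fst @^-1` A) = Q A.
Proof.
move=> mA; have -> : fst @^-1` A = A `*` [set: R] by apply/seteqP; split => -[x y] //= [].
have := product_measure1E Q unif mA measurableT => E1.
rewrite [LHS]E1 -[RHS]mule1; congr (_ * _)%E; exact: (probability_setT unif).
Qed.

Section Coupling.
Context d d1 d2 (Omega : measurableType d) (T : measurableType d1)
  (E : measurableType d2) {R : realType} (P : probability Omega R).
Variables (X : Omega -> T) (C : Omega -> E).
Hypotheses (mX : measurable_fun setT X) (mC : measurable_fun setT C).
Variables (kY : R.-pker E ~> R) (kX : R.-pker E ~> T).
Hypothesis kXP : is_cond_law P X C kX.
Variables (mY : E -> R) (zeta : E -> T -> R).
Hypothesis mmY : measurable_fun setT mY.
Hypothesis mzeta : measurable_fun setT (fun xz : E * T => zeta xz.1 xz.2).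
Variable good : set E.
Hypothesis mgood : measurable good.
Hypothesis goodP : P (C @^-1` (~` good)) = 0%E.

Let eta (x : E) (y : R) : R := y - mY x.

Hypothesis good_eta : forall x, good x ->
  (kY x).-integrable setT (EFin \o eta x) /\ \int[kY x]_y eta x y = 0.
Hypothesis good_zeta : forall x, good x ->
  (kX x).-integrable setT (EFin \o zeta x) /\ \int[kX x]_z zeta x z = 0.
Hypothesis good_tail : forall x, good x -> forall a, 0 < a < 1 ->
  tail_integral (cdf_of (kX x) (zeta x)) a <= tail_integral (cdf_of (kY x) (eta x)) a.

Let meta : measurable_fun setT (fun xy : E * R => eta xy.1 xy.2).
Proof. by apply: measurable_funB => //; exact: measurableT_comp. Qed.

Let mzx x : measurable_fun setT (zeta x) := measurable_curry mzeta x.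
Let mex x : measurable_fun setT (eta x) := measurable_curry meta x.

(** Both quantile functions are set to 0 off [good]. The hypotheses of the exchange then hold at
    every [x], as its joint measurability requires, and not merely at almost every one. *)
Definition Yquantile (x : E) (u : R) : R :=
  if x \in good then tquantile (cdf_of (kY x) (eta x)) 1 u else 0.

Definition Xquantile (x : E) (u : R) : R :=
  if x \in good then tquantile (cdf_of (kX x) (zeta x)) 1 u else 0.

Let a := Yquantile.
Let c := Xquantile.

Let mmem : measurable_fun setT (fun xu : E * R => xu.1 \in good).
Proof.
apply: (measurableT_comp (f := fun x => x \in good) (g := fst)) => //.
apply: (measurable_fun_bool true) => //.
rewrite setTI (_ : _ @^-1` _ = good)//.
by apply/seteqP; split => x /=; [exact: set_mem | exact: mem_set].
Qed.

Lemma measurable_Yquantile : measurable_fun setT (fun xu : E * R => a xu.1 xu.2).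
Proof.
by apply: measurable_fun_ifT => //; exact: (measurable_tquantile_kernel kY meta).
Qed.

Lemma measurable_Xquantile : measurable_fun setT (fun xu : E * R => c xu.1 xu.2).
Proof.
by apply: measurable_fun_ifT => //; exact: (measurable_tquantile_kernel kX mzeta).
Qed.

Lemma integrable_Yquantile x : unif.-integrable setT (EFin \o a x).
Proof.
rewrite /a /Yquantile; have [gx|gx] := boolP (x \in good); last exact: integrable0.
move/set_mem : gx => gx.
have [ie _] := good_eta gx; move/(integrable_kprob _ _ _ _).2 : ie => ie.
exact: (integrable_cdf_transform (mex x) (@measurable_id _ _ _) ie).
Qed.

Lemma integrable_Xquantile x : unif.-integrable setT (EFin \o c x).
Proof.
rewrite /c /Xquantile; have [gx|gx] := boolP (x \in good); last exact: integrable0.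
move/set_mem : gx => gx.
have [iz _] := good_zeta gx; move/(integrable_kprob _ _ _ _).2 : iz => iz.
exact: (integrable_cdf_transform (mzx x) (@measurable_id _ _ _) iz).
Qed.

Lemma Xquantile_nd x s t : 0 < s -> s <= t -> t < 1 -> c x s <= c x t.
Proof.
rewrite /c /Xquantile; case: ifPn => // _; exact: (tquantile_nd (kprob kX x)).
Qed.

Lemma quantile_major x u : 0 < u < 1 ->
  \int[unif]_(t in `]u, +oo[) c x t <= \int[unif]_(t in `]u, +oo[) a x t.
Proof.
move=> u01; rewrite /c /a /Xquantile /Yquantile; have [gx|gx] := boolP (x \in good) => //; move/set_mem : gx => gx.
have := good_tail gx u01.
have u0 : 0 <= u by case/andP : u01 => /ltW.
by rewrite (tail_integral_unif (kprob kX x) (mzx x) u0)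
  (tail_integral_unif (kprob kY x) (mex x) u0).
Qed.

Lemma quantile_mean x : \int[unif]_t c x t = \int[unif]_t a x t.
Proof.
rewrite /c /a /Xquantile /Yquantile; have [gx|gx] := boolP (x \in good) => //; move/set_mem : gx => gx.
have [ie e0] := good_eta gx; have [iz z0] := good_zeta gx.
move/(integrable_kprob _ _ _ _).2 : ie => ie; move/(integrable_kprob _ _ _ _).2 : iz => iz.
have := Rintegral_cdf_transform (g := id) (mex x) (@measurable_id _ _ _) ie.
have := Rintegral_cdf_transform (g := id) (mzx x) (@measurable_id _ _ _) iz.
by rewrite !Rintegral_kprob e0 z0 => <- <-.
Qed.

Let rho x := swap_prob (a x) (c x).
Let phi x := swap (a x) (c x).

Let mphi : measurable_fun setT (fun xu : E * R => phi xu.1 xu.2).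
Proof.
exact: (measurable_swap measurable_Yquantile measurable_Xquantile
  integrable_Yquantile integrable_Xquantile).
Qed.

Let mrho : measurable_fun setT (fun xu : E * R => rho xu.1 xu.2).
Proof.
exact: (measurable_swap_prob measurable_Yquantile measurable_Xquantile
  integrable_Yquantile integrable_Xquantile).
Qed.

Let rho_swap x : \forall u \ae unif, rho x u * (a x (phi x u) - a x u) = c x u - a x u.
Proof.
exact: (swap_probE (integrable_Yquantile x) (integrable_Xquantile x)
  (@Xquantile_nd x) (@quantile_major x) (quantile_mean x)).
Qed.

Let rho_invariant x (psi : R -> \bar R) : measurable_fun setT psi ->
  (forall u, 0 <= psi u)%E ->
  (\int[unif]_u ((rho x u)%:E * psi (phi x u)) =
   \int[unif]_u ((rho x u)%:E * psi u))%E.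
Proof.
exact: (swap_invariant (integrable_Yquantile x) (integrable_Xquantile x)
  (@Xquantile_nd x) (@quantile_major x) (quantile_mean x)).
Qed.

Let P1 : probability (Omega * R)%type R := (P \x unif)%E.

Definition Xrank (ww : Omega * R) : R :=
  rank (kX (C ww.1)) (zeta (C ww.1)) (X ww.1) ww.2.

Let mXrank : measurable_fun setT Xrank.
Proof.
apply: (measurableT_comp (measurable_rank_kernel kX mzeta)
  (g := fun ww : Omega * R => ((C ww.1, X ww.1), ww.2))).
apply: measurable_fun_pair => //; apply: measurable_fun_pair; exact: measurableT_comp.
Qed.

Let fiber (psi : E * T * R -> \bar R) x : measurable_fun setT psi ->
  (forall x, 0 <= psi x)%E ->
  (\int[kX x]_z \int[unif]_u psi ((x, z), u) =
   \int[kprob kX x \x unif]_zw psi ((x, zw.1), zw.2))%E.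
Proof.
move=> mpsi psi0.
have m2 : measurable_fun setT (fun zw : T * R => psi ((x, zw.1), zw.2)).
  apply: (measurableT_comp mpsi (g := fun zw : T * R => ((x, zw.1), zw.2))).
  by apply: measurable_fun_pair => //; apply: measurable_fun_pair.
by rewrite (@fubini_tonelli1 _ _ _ _ R (kprob kX x) unif _ m2).
Qed.

Let mfiber (psi : E * T * R -> \bar R) : measurable_fun setT psi ->
  (forall x, 0 <= psi x)%E ->
  measurable_fun setT (fun x => \int[kprob kX x \x unif]_zw psi ((x, zw.1), zw.2))%E.
Proof.
move=> mpsi psi0; under eq_fun do rewrite -fiber//.
have mH : measurable_fun setT (fun xz : E * T => \int[unif]_w psi (xz, w))%E.
  exact: (@measurable_fun_fubini_tonelli_F _ _ _ _ R unif psi mpsi psi0).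
have H0 (xz : E * T) : (0 <= \int[unif]_w psi (xz, w))%E by exact: integral_ge0.
exact: (measurable_fun_integral_finite_kernel _ kX H0 mH).
Qed.

Lemma cond_rank_integral (psi : E * T * R -> \bar R) : measurable_fun setT psi ->
  (forall x, 0 <= psi x)%E ->
  (\int[P1]_ww psi ((C ww.1, X ww.1), ww.2) =
   \int[P]_w \int[kprob kX (C w) \x unif]_zw psi ((C w, zw.1), zw.2))%E.
Proof.
move=> mpsi psi0.
have m1 : measurable_fun setT (fun ww : Omega * R => psi ((C ww.1, X ww.1), ww.2)).
  apply: (measurableT_comp mpsi (g := fun ww : Omega * R => ((C ww.1, X ww.1), ww.2))).
  apply: measurable_fun_pair => //; apply: measurable_fun_pair; exact: measurableT_comp.
rewrite [LHS](@fubini_tonelli1 _ _ _ _ R P unif _ m1)//.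
have mH : measurable_fun setT (fun xz : E * T => \int[unif]_w psi (xz, w))%E.
  exact: (@measurable_fun_fubini_tonelli_F _ _ _ _ R unif psi mpsi psi0).
have H0 (xz : E * T) : (0 <= \int[unif]_w psi (xz, w))%E by exact: integral_ge0.
have := cond_law_integral mX mC kXP mH H0; rewrite /fubini_F /= => ->.
by apply: eq_integral => w _; exact: fiber.
Qed.

(** The rank is taken within the conditional law given [C], so it is uniform conditionally on [C]:
    it is independent of [C]. *)
Lemma Xrank_law (psi : E * R -> \bar R) : measurable_fun setT psi ->
  (forall x, 0 <= psi x)%E ->
  (\int[P1]_ww psi (C ww.1, Xrank ww) = \int[P]_w \int[unif]_u psi (C w, u))%E.
Proof.
move=> mpsi psi0.
have := @cond_rank_integral (fun xzw => psi (xzw.1.1, rank (kX xzw.1.1) (zeta xzw.1.1) xzw.1.2 xzw.2)).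
move=> /= ->//; last first.
  apply: (measurableT_comp mpsi (g := fun xzw => (xzw.1.1, rank (kX xzw.1.1) (zeta xzw.1.1) xzw.1.2 xzw.2))).
  apply: measurable_fun_pair; last exact: (measurable_rank_kernel kX mzeta).
  exact: measurableT_comp.
apply: eq_integral => w _.
have mp : measurable_fun setT (fun u => psi (C w, u)).
  by apply: (measurableT_comp mpsi) => //; exact: measurable_fun_pair.
have mr := measurable_rank (kprob kX (C w)) (mzx (C w)).
have lr := rank_law (kprob kX (C w)) (mzx (C w)).
exact: (ge0_integral_same_law (X2 := id) mr (@measurable_id _ _ _) lr mp).
Qed.

Lemma Xrank_ae (Q : E * R -> Prop) : measurable [set xu | Q xu] ->
  (forall x, \forall u \ae unif, Q (x, u)) ->
  \forall ww \ae P1, Q (C ww.1, Xrank ww).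
Proof.
move=> mQ Qae.
pose psi (xu : E * R) : \bar R := (\1_(~` [set xu | Q xu]) xu)%:E.
have mpsi : measurable_fun setT psi.
  by apply/measurable_EFinP; apply: measurable_indic; exact: measurableC.
have psi0 xu : (0 <= psi xu)%E by rewrite lee_fin.
have : (\int[P1]_ww psi (C ww.1, Xrank ww) = 0)%E.
  rewrite Xrank_law//; apply: integral0_eq => w _.
  rewrite (ae_eq_integral (cst 0%E))//; first by rewrite integral0.
    by apply: (measurableT_comp mpsi) => //; exact: measurable_fun_pair.
  by apply: filterS (Qae (C w)) => u Qu _; rewrite /psi indicE memNset//= => /(_ Qu).
move=> /ge0_ae_eq0 H; have {}H := H _ (fun _ => psi0 _).
apply: filterS (H _) => [ww|].
  rewrite /psi indicE => -[] /eqP; rewrite pnatr_eq0 eqb0 notin_setE /= => /contrapT.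
  by [].
apply: (measurableT_comp mpsi (g := fun ww => (C ww.1, Xrank ww))).
by apply: measurable_fun_pair => //; exact: (measurableT_comp mC measurable_fst).
Qed.

Lemma good_ae : \forall w \ae P, good (C w).
Proof.
exists (C @^-1` (~` good)); split => //.
by rewrite -[X in measurable X]setTI; apply: mC => //; exact: measurableC.
Qed.

Lemma Xquantile_rank : \forall ww \ae P1, c (C ww.1) (Xrank ww) = zeta (C ww.1) (X ww.1).
Proof.
pose B := [set xzw : E * T * R |
  c xzw.1.1 (rank (kX xzw.1.1) (zeta xzw.1.1) xzw.1.2 xzw.2) != zeta xzw.1.1 xzw.1.2].
have m11 : measurable_fun setT (fun xzw : E * T * R => xzw.1.1) by exact: measurableT_comp.
have mB : measurable B.
  have me : measurable_fun setT (fun xzw : E * T * R =>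
      c xzw.1.1 (rank (kX xzw.1.1) (zeta xzw.1.1) xzw.1.2 xzw.2) == zeta xzw.1.1 xzw.1.2).
    apply: measurable_fun_eqr; last exact: (measurableT_comp mzeta measurable_fst).
    apply: (measurableT_comp measurable_Xquantile
      (g := fun xzw => (xzw.1.1, rank (kX xzw.1.1) (zeta xzw.1.1) xzw.1.2 xzw.2))).
    by apply: measurable_fun_pair => //; exact: (measurable_rank_kernel kX mzeta).
  have := measurable_neg me measurableT (Y := [set true]) => /(_ _); rewrite setTI; apply.
  by [].
pose psi (xzw : E * T * R) : \bar R := (\1_B xzw)%:E.
have mpsi : measurable_fun setT psi by apply/measurable_EFinP; exact: measurable_indic.
have psi0 xzw : (0 <= psi xzw)%E by rewrite lee_fin.
have mpsiP : measurable_fun setT (fun ww : Omega * R => psi ((C ww.1, X ww.1), ww.2)).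
  apply: (measurableT_comp mpsi (g := fun ww : Omega * R => ((C ww.1, X ww.1), ww.2))).
  apply: measurable_fun_pair => //; apply: measurable_fun_pair; exact: measurableT_comp.
have : (\int[P1]_ww psi ((C ww.1, X ww.1), ww.2) = 0)%E.
  rewrite cond_rank_integral//.
  rewrite (ae_eq_integral (cst 0%E))//; first by rewrite integral0.
    exact: (measurableT_comp (mfiber mpsi psi0) mC).
  apply: filterS good_ae => w gw _; have [iz _] := good_zeta gw.
  move/(integrable_kprob _ _ _ _).2 : iz => iz.
  rewrite (ae_eq_integral (cst 0%E))//; first by rewrite integral0.
    apply: (measurableT_comp mpsi (g := fun zw : T * R => ((C w, zw.1), zw.2))).
    by apply: measurable_fun_pair => //; apply: measurable_fun_pair.
  apply: filterS (quantile_rank (mzx (C w)) iz) => zw e _.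
  by rewrite /psi indicE memNset// /B /= /c /Xquantile mem_set// e eqxx.
move=> /(ge0_ae_eq0 mpsiP (fun _ => psi0 _)); apply: filterS => ww.
rewrite /psi indicE => -[] /eqP; rewrite pnatr_eq0 eqb0 notin_setE /B /= => /negP.
by rewrite negbK => /eqP.
Qed.

Let Omega2 : measurableType _ := ((Omega * R) * R)%type.
Let P2 : probability Omega2 R := (P1 \x unif)%E.

(** The rank [V] of the overview. The first auxiliary variable breaks the ties inside [Xrank]; the
    second, [w.2], is the coin that decides the exchange. *)
Definition mixed_rank (w : (Omega * R) * R) : R :=
  if w.2 < rho (C w.1.1) (Xrank w.1) then phi (C w.1.1) (Xrank w.1) else Xrank w.1.

Let mCX1 : measurable_fun setT (fun ww : Omega * R => (C ww.1, Xrank ww)).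
Proof.
by apply: measurable_fun_pair => //; exact: (measurableT_comp mC measurable_fst).
Qed.

Let mphi1 : measurable_fun setT (fun ww : Omega * R => phi (C ww.1) (Xrank ww)).
Proof. exact: (measurableT_comp mphi mCX1). Qed.

Let mrho1 : measurable_fun setT (fun ww : Omega * R => rho (C ww.1) (Xrank ww)).
Proof. exact: (measurableT_comp mrho mCX1). Qed.

Lemma measurable_mixed_rank : measurable_fun setT mixed_rank.
Proof.
apply: measurable_fun_ifT.
- apply: measurable_fun_ltr => //.
  exact: (measurableT_comp mrho1 measurable_fst).
- exact: (measurableT_comp mphi1 measurable_fst).
- exact: (measurableT_comp mXrank measurable_fst).
Qed.

Let mC2 : measurable_fun setT (fun w : (Omega * R) * R => C w.1.1).
Proof.
by apply: (measurableT_comp mC (g := fun w : (Omega * R) * R => w.1.1));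
  exact: (measurableT_comp measurable_fst measurable_fst).
Qed.

Let rho01 x u : 0 <= rho x u <= 1.
Proof. by rewrite swap_prob_ge0 swap_prob_le1. Qed.

Let inner (psi : E * R -> \bar R) : (forall xu, 0 <= psi xu)%E -> forall ww : Omega * R,
  (\int[unif]_w psi (C ww.1, mixed_rank (ww, w)) =
   (rho (C ww.1) (Xrank ww))%:E * psi (C ww.1, phi (C ww.1) (Xrank ww)) +
   (1 - rho (C ww.1) (Xrank ww))%:E * psi (C ww.1, Xrank ww))%E.
Proof.
move=> psi0 ww; rewrite -integral_bernoulli//; apply: eq_integral => w _.
by rewrite /mixed_rank/=; case: ifPn.
Qed.

(** Integrating out the coin leaves [rho * (psi o phi) + (1 - rho) * psi]. Invariance of [rho(u) du]
    replaces the first term by [rho * psi], and the weights add up to 1. *)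
Lemma mixed_rank_law (psi : E * R -> \bar R) : measurable_fun setT psi ->
  (forall x, 0 <= psi x)%E ->
  (\int[P2]_w psi (C w.1.1, mixed_rank w) = \int[P]_w \int[unif]_u psi (C w, u))%E.
Proof.
move=> mpsi psi0.
have m1 : measurable_fun setT (fun w : (Omega * R) * R => psi (C w.1.1, mixed_rank w)).
  apply: (measurableT_comp mpsi (g := fun w => (C w.1.1, mixed_rank w))).
  by apply: measurable_fun_pair => //; exact: measurable_mixed_rank.
rewrite [LHS](@fubini_tonelli1 _ _ _ _ R P1 unif _ m1)// /fubini_F/=.
under eq_integral do rewrite inner//.
pose chi (xu : E * R) : \bar R := ((rho xu.1 xu.2)%:E * psi (xu.1, phi xu.1 xu.2) +
   (1 - rho xu.1 xu.2)%:E * psi xu)%E.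
have mrhoE : measurable_fun setT (fun xu : E * R => (rho xu.1 xu.2)%:E).
  exact/measurable_EFinP.
have mrhoE' : measurable_fun setT (fun xu : E * R => (1 - rho xu.1 xu.2)%:E).
  by apply/measurable_EFinP; exact: measurable_funB.
have mpsiphi : measurable_fun setT (fun xu : E * R => psi (xu.1, phi xu.1 xu.2)).
  apply: (measurableT_comp mpsi (g := fun xu : E * R => (xu.1, phi xu.1 xu.2))).
  by apply: measurable_fun_pair.
have t10 xu : (0 <= (rho xu.1 xu.2)%:E * psi (xu.1, phi xu.1 xu.2))%E.
  by rewrite mule_ge0// lee_fin; case/andP : (rho01 xu.1 xu.2).
have t20 xu : (0 <= (1 - rho xu.1 xu.2)%:E * psi xu)%E.
  by rewrite mule_ge0// lee_fin subr_ge0; case/andP : (rho01 xu.1 xu.2).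
have t30 xu : (0 <= (rho xu.1 xu.2)%:E * psi xu)%E.
  by rewrite mule_ge0// lee_fin; case/andP : (rho01 xu.1 xu.2).
have mt1 := emeasurable_funM mrhoE mpsiphi.
have mt2 := emeasurable_funM mrhoE' mpsi.
have mt3 := emeasurable_funM mrhoE mpsi.
have mchi : measurable_fun setT chi by exact: emeasurable_funD.
have chi0 xu : (0 <= chi xu)%E by exact: adde_ge0.
rewrite [LHS](Xrank_law mchi chi0); apply: eq_integral => w _; rewrite /chi/=.
have sec (h : E * R -> \bar R) : measurable_fun setT h -> measurable_fun setT (fun u => h (C w, u)).
  by move=> mh; apply: (measurableT_comp mh) => //; exact: measurable_fun_pair.
rewrite ge0_integralD//; last 4 first.
- by move=> u _; exact: (t10 (C w, u)).
- exact: (sec _ mt1).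
- by move=> u _; exact: (t20 (C w, u)).
- exact: (sec _ mt2).
have := rho_invariant (C w) (sec _ mpsi) (fun u => psi0 (C w, u)) => ->.
rewrite -ge0_integralD//; last 4 first.
- by move=> u _; exact: (t30 (C w, u)).
- exact: (sec _ mt3).
- by move=> u _; exact: (t20 (C w, u)).
- exact: (sec _ mt2).
apply: eq_integral => u _; case/andP : (rho01 (C w) u) => r0 r1.
by rewrite -ge0_muleDl ?lee_fin ?subr_ge0// -EFinD addrC subrK mul1e.
Qed.

Definition coupled (w : (Omega * R) * R) : R := mY (C w.1.1) + a (C w.1.1) (mixed_rank w).

Lemma measurable_coupled : measurable_fun setT coupled.
Proof.
apply: measurable_funD; first exact: (measurableT_comp mmY mC2).
apply: (measurableT_comp measurable_Yquantile (g := fun w => (C w.1.1, mixed_rank w))).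
by apply: measurable_fun_pair => //; exact: measurable_mixed_rank.
Qed.

Variable Y : Omega -> R.
Hypothesis mYY : measurable_fun setT Y.
Hypothesis kYP : is_cond_law P Y C kY.
Hypothesis iY : P.-integrable setT (EFin \o Y).

(** Given [C], the mixed rank is uniform, so its image under the conditional quantile function has
    the conditional law of [Y - mY C]. Stated for all nonnegative [psi], the lemma yields both the
    law of [coupled] and, with the absolute value, its integrability. *)
Lemma coupled_law (psi : E * R -> \bar R) : measurable_fun setT psi ->
  (forall x, 0 <= psi x)%E ->
  (\int[P2]_w psi (C w.1.1, coupled w) = \int[P]_w psi (C w, Y w))%E.
Proof.
move=> mpsi psi0.
have mshift : measurable_fun setT (fun xu : E * R => (xu.1, mY xu.1 + a xu.1 xu.2)).
  apply: measurable_fun_pair => //; apply: measurable_funD.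
    exact: (measurableT_comp mmY measurable_fst).
  exact: measurable_Yquantile.
have := mixed_rank_law (measurableT_comp mpsi mshift) (fun xu => psi0 _) => /= E1.
rewrite [LHS]E1 (cond_law_integral mYY mC kYP mpsi psi0).
apply: ae_eq_integral => //.
- have mF := @measurable_fun_fubini_tonelli_F _ _ _ _ R unif _
    (measurableT_comp mpsi mshift) (fun xu => psi0 _).
  exact: (measurableT_comp mF mC).
- have mK := measurable_fun_integral_finite_kernel _ kY psi0 mpsi.
  exact: (measurableT_comp mK mC).
apply: filterS good_ae => w gw _; have [ie _] := good_eta gw.
have mp : measurable_fun setT (fun y => psi (C w, mY (C w) + y)).
  apply: (measurableT_comp mpsi (g := fun y => (C w, mY (C w) + y))).
  by apply: measurable_fun_pair => //; exact: measurable_funD.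
have := @cdf_transform _ _ _ (kprob kY (C w)) _ (mex (C w)) _ mp (fun y => psi0 _).
rewrite integral_kprob => /esym E2; rewrite /a /Yquantile mem_set//.
rewrite [LHS]E2; apply: eq_integral => y _; congr (psi (_, _)).
by rewrite /eta addrC subrK.
Qed.

Lemma same_law_coupled : same_law P2 (fun w => (coupled w, C w.1.1)) P (fun w => (Y w, C w)).
Proof.
move=> B mB; pose psi (xy : E * R) : \bar R := (\1_B (xy.2, xy.1))%:E.
have mpsi : measurable_fun setT psi.
  have ms : measurable_fun setT (fun xy : E * R => (xy.2, xy.1)).
    exact: measurable_fun_pair.
  have := measurableT_comp (measurable_indic (R := R) mB) ms.
  by move=> /measurable_EFinP.
have psi0 xy : (0 <= psi xy)%E by rewrite lee_fin.
have := coupled_law mpsi psi0; rewrite /psi/=.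
rewrite (_ : (fun w => (\1_B (coupled w, C w.1.1))%:E) =
  (fun w => (\1_((fun w => (coupled w, C w.1.1)) @^-1` B) w)%:E))//.
rewrite (_ : (fun w => (\1_B (Y w, C w))%:E) =
  (fun w => (\1_((fun w => (Y w, C w)) @^-1` B) w)%:E))//.
rewrite !integral_indic ?setIT//.
  rewrite -[X in measurable X]setTI; apply: (measurable_fun_pair mYY mC) => //.
rewrite -[X in measurable X]setTI.
by apply: (measurable_fun_pair measurable_coupled mC2).
Qed.

Let integrable_coupled : P2.-integrable setT (EFin \o coupled).
Proof.
apply/integrableP; split; first by apply/measurable_EFinP; exact: measurable_coupled.
have := coupled_law (psi := fun xy => `|xy.2%:E|%E) _ (fun _ => abse_ge0 _).
move=> /= ->; first by case/integrableP : iY.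
apply/measurable_EFinP; apply: measurableT_comp => //; exact: measurable_snd.
Qed.

Let mean (xz : T * E) : R := mY xz.2 + zeta xz.2 xz.1.

Let mmean : measurable_fun setT mean.
Proof.
apply: measurable_funD; first exact: (measurableT_comp mmY measurable_snd).
apply: (measurableT_comp mzeta (g := fun xz : T * E => (xz.2, xz.1))).
exact: measurable_fun_pair.
Qed.

(** With everything but the coin fixed, the mean is [mY + a U + rho U * (a (phi U) - a U)], that is
    [mY + c U] by the choice of [rho], and [c U] is [zeta] by the quantile property of the rank. *)
Let coupled_mean : \forall ww \ae P1,
  (\int[unif]_w (coupled (ww, w))%:E = (mean (X ww.1, C ww.1))%:E)%E.
Proof.
pose Q (xu : E * R) : Prop := rho xu.1 xu.2 * (a xu.1 (phi xu.1 xu.2) - a xu.1 xu.2) =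
    c xu.1 xu.2 - a xu.1 xu.2.
have mQ : measurable [set xu | Q xu].
  have maphi : measurable_fun setT (fun xu : E * R => a xu.1 (phi xu.1 xu.2)).
    apply: (measurableT_comp measurable_Yquantile (g := fun xu => (xu.1, phi xu.1 xu.2))).
    exact: measurable_fun_pair.
  have mL : measurable_fun setT (fun xu : E * R => rho xu.1 xu.2 * (a xu.1 (phi xu.1 xu.2) - a xu.1 xu.2)).
    by apply: measurable_funM => //; apply: measurable_funB => //; exact: measurable_Yquantile.
  have mR : measurable_fun setT (fun xu : E * R => c xu.1 xu.2 - a xu.1 xu.2).
    by apply: measurable_funB; [exact: measurable_Xquantile | exact: measurable_Yquantile].
  have := measurable_fun_eqr mL mR measurableT (Y := [set true]) => /(_ _).
  rewrite setTI (_ : _ @^-1` _ = [set xu | Q xu]); first by apply.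
  by apply/seteqP; split => xu /= /eqP.
have := Xrank_ae mQ rho_swap.
apply: filterS2 Xquantile_rank => ww /= e1 e2.
set r := rho (C ww.1) (Xrank ww) in e2 *.
have r01 : 0 <= r <= 1 by exact: rho01.
have -> : (fun w => (coupled (ww, w))%:E) = (fun w : R => ((if w < r then
    mY (C ww.1) + a (C ww.1) (phi (C ww.1) (Xrank ww)) else mY (C ww.1) + a (C ww.1) (Xrank ww))%:E)).
  by apply/funext => w; rewrite /coupled /mixed_rank/=; case: ifPn.
have := integral_bernoulli (mY (C ww.1) + a (C ww.1) (phi (C ww.1) (Xrank ww)))%:E
  (mY (C ww.1) + a (C ww.1) (Xrank ww))%:E r01.
rewrite (_ : (fun w : R => if _ then _ else _) = (fun w : R => ((if w < r then
    mY (C ww.1) + a (C ww.1) (phi (C ww.1) (Xrank ww)) else mY (C ww.1) + a (C ww.1) (Xrank ww))%:E))); last first.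
  by apply/funext => w; case: ifPn.
move=> ->; rewrite -!EFinM -EFinD; congr EFin; rewrite /mean/= -e1.
by transitivity (mY (C ww.1) + a (C ww.1) (Xrank ww) +
  r * (a (C ww.1) (phi (C ww.1) (Xrank ww)) - a (C ww.1) (Xrank ww)));
  [ring | rewrite e2; ring].
Qed.

Let fst_law (A : set (Omega * R)) : measurable A -> P1 A = P2 (fst @^-1` A).
Proof. by move=> mA; rewrite -[LHS](product_unif_fst P1 mA). Qed.

Let mean1 (ww : Omega * R) := mean (X ww.1, C ww.1).

Let mmean1 : measurable_fun setT mean1.
Proof.
apply: (measurableT_comp mmean (g := fun ww : Omega * R => (X ww.1, C ww.1))).
by apply: measurable_fun_pair; exact: measurableT_comp.
Qed.

Let imean1 : P1.-integrable setT (EFin \o mean1).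
Proof.
have iF := integrable_fubini_F integrable_coupled.
apply/integrableP; split; first exact/measurable_EFinP.
move/integrableP : (iF) => [mF]; apply: le_lt_trans.
rewrite le_eqVlt; apply/orP; left; apply/eqP; apply: ae_eq_integral => //.
- by apply: measurableT_comp => //; exact/measurable_EFinP.
- exact: measurableT_comp.
- by apply: filterS coupled_mean => ww e _; rewrite /fubini_F/= e.
Qed.

(** [coupled_mean] conditions on all of [ww], including the tie-breaker, which is more than
    [(X, C)]. An event of [(X, C)] does not involve the coin, so Fubini's theorem integrates the
    coin first inside it. *)
Lemma is_cond_exp_coupled :
  is_cond_exp P2 coupled (fun w => (X w.1.1, C w.1.1)) mean.
Proof.
have imean : P2.-integrable setT (EFin \o (mean1 \o fst)).
  exact: (integrable_same_law (X1 := id) (@measurable_id _ _ _) measurable_fst fst_law mmean1 imean1).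
split; [exact: integrable_coupled | exact: mmean | exact: imean |].
move=> B mB; set D := _ @^-1` B.
pose D1 := (fun ww : Omega * R => (X ww.1, C ww.1)) @^-1` B.
have mXC : measurable_fun setT (fun ww : Omega * R => (X ww.1, C ww.1)).
  by apply: measurable_fun_pair; exact: measurableT_comp.
have mD1 : measurable D1.
  by rewrite -[X in measurable X]setTI; exact: mXC.
have mD : measurable D.
  rewrite -[X in measurable X]setTI.
  exact: (measurableT_comp mXC (g := fst)).
rewrite [LHS]integral_mkcond [RHS]integral_mkcond.
have i1 := (integrable_mkcond _ mD).1 (integrableS measurableT mD (@subsetT _ _) integrable_coupled).
have i2 := (integrable_mkcond _ mD).1 (integrableS measurableT mD (@subsetT _ _) imean).
have E1 := integral12_prod_meas1 i1; have E2 := integral12_prod_meas1 i2.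
rewrite -[LHS]E1 -[RHS]E2; apply: ae_eq_integral => //.
- exact: (measurable_fubini_F i1).
- exact: (measurable_fubini_F i2).
apply: filterS coupled_mean => ww e _; rewrite /fubini_F/= /patch.
have Dw w : ((ww, w) \in D) = (ww \in D1) by [].
under eq_integral do rewrite Dw.
under [RHS]eq_integral do rewrite Dw.
have [_|_] := boolP (ww \in D1); last by [].
rewrite e /= integral_cst// -[LHS]mule1; congr (_ * _)%E; apply/esym; exact: (probability_setT unif).
Qed.

End Coupling.

(** * Conditional expectations *)

Section CondLawExpectation.
Context d d1 d2 (Omega : measurableType d) (T : measurableType d1)
  (E : measurableType d2) {R : realType} (P : probability Omega R).
Variables (A : Omega -> T) (C : Omega -> E) (k : R.-pker E ~> T).
Hypothesis mA : measurable_fun setT A.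
Hypothesis mC : measurable_fun setT C.
Hypothesis kP : is_cond_law P A C k.

Let mpre D : measurable D -> measurable (C @^-1` D).
Proof. by move=> mD; rewrite -[X in measurable X]setTI; exact: mC. Qed.

Let mCA : measurable_fun setT (fun w => (C w, A w)).
Proof. exact: measurable_fun_pair. Qed.

Lemma cond_law_integral_set (G : E * T -> \bar R) D : measurable_fun setT G ->
  (forall x, 0 <= G x)%E -> measurable D ->
  (\int[P]_(w in C @^-1` D) G (C w, A w) =
   \int[P]_(w in C @^-1` D) \int[k (C w)]_z G (C w, z))%E.
Proof.
move=> mG G0 mD; rewrite [LHS]integral_mkcond [RHS]integral_mkcond.
have mfD : measurable (fst @^-1` D : set (E * T)).
  by rewrite -[X in measurable X]setTI; exact: measurable_fst.
have mG' : measurable_fun setT (G \_ (fst @^-1` D)).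
  by apply/(measurable_restrictT _ _).1 => //; exact: measurable_funTS.
have G'0 x : (0 <= (G \_ (fst @^-1` D)) x)%E by rewrite patchE; case: ifPn.
have := cond_law_integral mA mC kP mG' G'0.
rewrite (_ : (fun w => (G \_ _) (C w, A w)) = (fun w => G (C w, A w)) \_ (C @^-1` D))//.
move=> ->; apply: eq_integral => w _; rewrite patchE.
have -> : (w \in C @^-1` D) = (C w \in D) by [].
under eq_integral.
  move=> z _; rewrite patchE.
  have -> : ((C w, z) \in (fst @^-1` D : set (E * T))) = (C w \in D) by [].
  over.
by case: ifPn => // _; rewrite integral0.
Qed.

Variable G : E * T -> R.
Hypothesis mG : measurable_fun setT G.
Hypothesis iG : P.-integrable setT (fun w => (G (C w, A w))%:E).

Let mGE : measurable_fun setT (EFin \o G). Proof. exact/measurable_EFinP. Qed.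

Let mGz : measurable_fun setT (fun xz : E * T => G (xz.1, xz.2)).
Proof. by rewrite (_ : (fun _ => _) = G)//; apply/funext => -[]. Qed.

Let N (x : E) := (\int[k x]_z `|(G (x, z))%:E|)%E.

Let mN : measurable_fun setT N.
Proof.
have mabs : measurable_fun setT (fun xz : E * T => `|(G xz)%:E|%E) by exact: measurableT_comp.
exact: (measurable_fun_integral_finite_kernel _ k (fun _ => abse_ge0 _) mabs).
Qed.

Let iN : P.-integrable setT (N \o C).
Proof.
have mabs : measurable_fun setT (fun xz : E * T => `|(G xz)%:E|%E) by exact: measurableT_comp.
apply/integrableP; split; first exact: measurableT_comp.
have -> : (\int[P]_w `|(N \o C) w| = \int[P]_w N (C w))%E.
  by apply: eq_integral => w _ /=; rewrite gee0_abs// integral_ge0.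
rewrite -(cond_law_integral mA mC kP mabs (fun _ => abse_ge0 _)).
by case/integrableP : iG.
Qed.

Lemma cond_law_integrable :
  \forall w \ae P, (k (C w)).-integrable setT (fun z => (G (C w, z))%:E).
Proof.
have := integrable_ae measurableT iN; apply: filterS => w /(_ I) Nfin.
apply/integrableP; split.
  by apply/measurable_EFinP; apply: measurableT_comp => //; exact: measurable_fun_pair.
by rewrite -ge0_fin_numE// integral_ge0.
Qed.

Let part (H : E * T -> \bar R) : measurable_fun setT H -> (forall x, 0 <= H x)%E ->
  (forall x, H x <= `|(G x)%:E|)%E ->
  P.-integrable setT (fun w => \int[k (C w)]_z H (C w, z))%E.
Proof.
move=> mH H0 HG.
have mI := measurable_fun_integral_finite_kernel _ k H0 mH.
apply/integrableP; split; first exact: (measurableT_comp mI mC).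
have -> : (\int[P]_w `|\int[k (C w)]_z H (C w, z)| = \int[P]_w \int[k (C w)]_z H (C w, z))%E.
  by apply: eq_integral => w _ /=; rewrite gee0_abs// integral_ge0.
rewrite -(cond_law_integral mA mC kP mH H0).
case/integrableP : iG => _; apply: le_lt_trans; apply: ge0_le_integral => //.
- exact: (measurableT_comp mH mCA).
- by apply: measurableT_comp => //; apply: (measurableT_comp mGE mCA).
Qed.

(** Disintegration is available for nonnegative functions, so positive and negative parts are
    treated apart; their conditional integrals are integrable, being bounded by that of the absolute
    value. *)
Lemma is_cond_exp_cond_law :
  is_cond_exp P (fun w => G (C w, A w)) C (fun x => \int[k x]_z G (x, z)).
Proof.
pose I x := \int[k x]_z G (x, z).
have mI : measurable_fun setT I.
  exact: (measurable_mean_kernel k (zeta := fun x z => G (x, z)) mGz).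
split => //.
  apply: (le_integrable measurableT _ _ iN).
    by apply/measurable_EFinP; exact: measurableT_comp.
  move=> w _ /=; rewrite [leRHS]gee0_abs ?integral_ge0// /I /Rintegral.
  have mz : measurable_fun setT (fun z => (G (C w, z))%:E).
    by apply/measurable_EFinP; apply: measurableT_comp => //; exact: measurable_fun_pair.
  apply: le_trans (le_abse_integral _ measurableT mz).
  (* [fine] sends an infinite integral to 0, which respects the bound. *)
  by case: (\int[k (C w)]_x (G (C w, x))%:E)%E => [r| |] //=; rewrite ?normr0 ?leey.
move=> D mD; have mCD := mpre mD.
have mp := measurable_funepos mGE; have mn := measurable_funeneg mGE.
have HP x : ((EFin \o G)^\+ x <= `|(G x)%:E|)%E.
  by rewrite funeposE /= ge_max !lee_fin normr_ge0 andbT ler_norm.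
have HN x : ((EFin \o G)^\- x <= `|(G x)%:E|)%E.
  by rewrite funenegE /= ge_max !lee_fin normr_ge0 andbT -normrN ler_norm.
have ip := part mp (funepos_ge0 _) HP; have in_ := part mn (funeneg_ge0 _) HN.
rewrite [LHS]integralE.
transitivity (\int[P]_(w in C @^-1` D) \int[k (C w)]_z (EFin \o G)^\+ (C w, z) -
  \int[P]_(w in C @^-1` D) \int[k (C w)]_z (EFin \o G)^\- (C w, z))%E.
  rewrite -(cond_law_integral_set mp (funepos_ge0 _) mD).
  rewrite -(cond_law_integral_set mn (funeneg_ge0 _) mD).
  by congr (_ - _)%E; apply: eq_integral => w _; rewrite ?funeposE ?funenegE.
rewrite -integralB//; last 2 first.
- exact: integrableS ip.
- exact: integrableS in_.
apply: ae_eq_integral => //.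
- apply: measurable_funTS; apply: emeasurable_funB; [exact: measurable_int ip|exact: measurable_int in_].
- by apply: measurable_funTS; apply/measurable_EFinP; exact: (measurableT_comp mI mC).
apply: filterS cond_law_integrable => w iw _; rewrite fineK; last exact: integrable_fin_num.
by rewrite [RHS]integralE; congr (_ - _)%E; apply: eq_integral => z _;
  rewrite ?funeposE ?funenegE.
Qed.

End CondLawExpectation.

Section CondExp.
Context d d1 (Omega : measurableType d) (T : measurableType d1) {R : realType}
  (P : probability Omega R).
Implicit Types (Y : Omega -> R) (W : Omega -> T) (h v : T -> R).

(** Tested on the event [h2 < h1], the hypothesis makes the integral of [(h1 - h2)^+]
    nonpositive. *)
Lemma is_cond_exp_le Y1 Y2 W h1 h2 : measurable_fun setT W ->
  is_cond_exp P Y1 W h1 -> is_cond_exp P Y2 W h2 ->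
  (forall B, measurable B ->
    \int[P]_(w in W @^-1` B) (Y1 w)%:E <= \int[P]_(w in W @^-1` B) (Y2 w)%:E)%E ->
  \forall w \ae P, h1 (W w) <= h2 (W w).
Proof.
move=> mW [i1 mh1 ih1 e1] [i2 mh2 ih2 e2] le12.
pose B := [set x | h2 x < h1 x].
have mB : measurable B.
  rewrite -[X in measurable X]setTI; exact: (measurable_fun_ltr mh2 mh1).
have mWB : measurable (W @^-1` B) by rewrite -[X in measurable X]setTI; exact: mW.
have mh1W : measurable_fun setT (h1 \o W) by exact: measurableT_comp.
have mh2W : measurable_fun setT (h2 \o W) by exact: measurableT_comp.
pose u w := (Num.max (h1 (W w) - h2 (W w)) 0)%:E.
have mu : measurable_fun setT u.
  by apply/measurable_EFinP; apply: measurable_maxr => //; exact: measurable_funB.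
have u0 w : (0 <= u w)%E by rewrite lee_fin le_max lexx orbT.
suff : (\int[P]_w u w = 0)%E.
  move=> /(ge0_ae_eq0 mu (fun _ => u0 _)); apply: filterS => w.
  by move=> [] /eqP; rewrite eq_maxr subr_le0.
apply/eqP; rewrite eq_le integral_ge0 ?andbT//.
have -> : (\int[P]_w u w = \int[P]_(w in W @^-1` B) ((h1 (W w))%:E - (h2 (W w))%:E))%E.
  rewrite [RHS]integral_mkcond; apply: eq_integral => w _; rewrite patchE /u.
  case: ifPn => [/set_mem|/negP]; rewrite ?inE /B/= => h.
    by rewrite max_l// subr_ge0 ltW.
  by move/negP : h; rewrite -leNgt -subr_le0 => /max_r ->.
rewrite integralB//; last 2 first.
- exact: integrableS ih1.
- exact: integrableS ih2.
rewrite -e1// -e2// lee_subel_addr ?add0e ?le12//.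
Qed.

(* Conditional Jensen for the convex function [y |-> (y - v)^+]: on [h > v] the
   positive part is linear. *)
Lemma is_cond_exp_pos Y W h v B : measurable_fun setT W -> is_cond_exp P Y W h ->
  measurable_fun setT v -> P.-integrable setT (EFin \o (v \o W)) -> measurable B ->
  (\int[P]_(w in W @^-1` B) (Num.max (h (W w) - v (W w)) 0)%:E <=
   \int[P]_(w in W @^-1` B) (Num.max (Y w - v (W w)) 0)%:E)%E.
Proof.
move=> mW [iY mh ih e] mv iv mB.
pose S := B `&` [set x | v x < h x].
have mS : measurable S.
  apply: measurableI => //; rewrite -[X in measurable X]setTI.
  exact: (measurable_fun_ltr mv mh).
have mpre A : measurable A -> measurable (W @^-1` A).
  by move=> mA; rewrite -[X in measurable X]setTI; exact: mW.
have mhW : measurable_fun setT (h \o W) by exact: measurableT_comp.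
have mvW : measurable_fun setT (v \o W) by exact: measurableT_comp.
have mY : measurable_fun setT Y by apply/measurable_EFinP; exact: measurable_int iY.
have iS f : P.-integrable setT f -> P.-integrable (W @^-1` S) f.
  by move=> i; apply: integrableS i => //; exact: mpre.
have -> : (\int[P]_(w in W @^-1` B) (Num.max (h (W w) - v (W w)) 0)%:E =
    \int[P]_(w in W @^-1` S) ((h (W w))%:E - (v (W w))%:E))%E.
  rewrite [LHS]integral_mkcond [RHS]integral_mkcond; apply: eq_integral => w _.
  rewrite !patchE; have [wB|wB] := boolP (w \in W @^-1` B); last first.
    rewrite (negbTE (_ : w \notin _))//; apply: contra wB => /set_mem[wB _].
    exact/mem_set.
  move/set_mem : wB => wB.
  case: ifPn => [/set_mem[_ /= h1]|h1]; first by rewrite max_l// subr_ge0 ltW.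
  rewrite max_r// subr_le0 leNgt; apply: contra h1 => h1.
  exact/mem_set.
rewrite integralB//; [|exact: mpre|exact: iS|exact: iS].
rewrite -e// -integralB//; [|exact: mpre|exact: iS|exact: iS].
rewrite [leRHS]integral_mkcond [leLHS]integral_mkcond.
have mpos : measurable_fun setT (fun w => (Num.max (Y w - v (W w)) 0)%:E).
  by apply/measurable_EFinP; apply: measurable_maxr => //; exact: measurable_funB.
have ipos : P.-integrable setT (fun w => (Num.max (Y w - v (W w)) 0)%:E).
  apply: (le_integrable measurableT mpos _ (integrableB measurableT iY iv)) => w _ /=.
  rewrite lee_fin ger0_norm ?le_max ?lexx ?orbT// ge_max normr_ge0 andbT.
  exact: ler_norm.
apply: le_integral => //.
- apply/(integrable_mkcond _ (mpre _ mS)).1; apply: iS; exact: integrableB.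
- apply/(integrable_mkcond _ (mpre _ mB)).1; apply: integrableS ipos => //; exact: mpre.
move=> w _; rewrite !patchE; have [wS|_] := boolP (w \in W @^-1` S).
  rewrite mem_set; last by case: (set_mem wS).
  by rewrite lee_fin le_max lexx.
by case: ifPn => // _; rewrite lee_fin le_max lexx orbT.
Qed.

End CondExp.

(** * Tail integrals of linear combinations *)

Section FiniteLinearCombinations.
Context {R : realType} d (T : measurableType d) (mu : probability T R).

Lemma integrable_lin I (s : seq I) (c : I -> R) (f : I -> T -> R) :
  (forall i, mu.-integrable setT (EFin \o f i)) ->
  mu.-integrable setT (EFin \o (fun z => \sum_(i <- s) c i * f i z)).
Proof.
move=> fi; elim: s => [|i s ih].
  rewrite (_ : _ \o _ = cst 0%E); first exact: integrable0.
  by apply/funext => z /=; rewrite big_nil.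
rewrite (_ : _ \o _ =
  EFin \o (fun z => c i * f i z + 1 * \sum_(i <- s) c i * f i z)).
  exact: integrable_lin2.
by apply/funext => z /=; rewrite big_cons mul1r.
Qed.

Lemma Rintegral_lin I (s : seq I) (c : I -> R) (f : I -> T -> R) :
  (forall i, mu.-integrable setT (EFin \o f i)) ->
  \int[mu]_z (\sum_(i <- s) c i * f i z) = \sum_(i <- s) c i * \int[mu]_z f i z.
Proof.
move=> fi; elim: s => [|i s ih].
  rewrite big_nil; under eq_Rintegral do rewrite big_nil.
  exact: (Rintegral_prob_cst mu).
rewrite big_cons -ih -[in RHS](mul1r (Rintegral _ _ (fun z => \sum_(i <- s) _))).
rewrite -Rintegral_lin2//; last exact: integrable_lin.
by apply: eq_Rintegral => z _; rewrite big_cons mul1r.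
Qed.

End FiniteLinearCombinations.

Lemma norm_coord_le (R : realType) p (b : 'rV[R]_p) i : `|b 0 i| <= `|b|.
Proof.
by rewrite [leRHS]/Num.norm/= mx_normrE; apply/bigmax_geP; right => /=; exists (0, i).
Qed.

Section Centered.
Context {R : realType} {p m : nat}.
Variable kX : R.-pker m.-tuple R ~> p.-tuple R.
Implicit Types (x : m.-tuple R) (b c : 'rV[R]_p) (a s t : R).

Definition centered b x (z : p.-tuple R) : R := dot (vec z - cmeanX kX x) b.

Let coord x (i : 'I_p) (z : p.-tuple R) : R := tnth z i - cmeanX kX x 0 i.

Lemma centeredE b x z : centered b x z = \sum_i b 0 i * coord x i z.
Proof. by apply: eq_bigr => i _; rewrite /coord !mxE mulrC. Qed.

Lemma centered_lin b c s t x z :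
  centered (s *: b + t *: c) x z = s * centered b x z + t * centered c x z.
Proof.
rewrite !centeredE !mulr_sumr -big_split/=; apply: eq_bigr => i _.
by rewrite !mxE; ring.
Qed.

Lemma measurable_cmeanX i : measurable_fun setT (fun x => cmeanX kX x 0 i).
Proof.
under eq_fun do rewrite mxE.
apply: (measurable_mean_kernel kX (zeta := fun _ z => tnth z i)).
exact: (measurableT_comp (measurable_tnth i) measurable_snd).
Qed.

Lemma measurable_centered b :
  measurable_fun setT (fun xz : m.-tuple R * p.-tuple R => centered b xz.1 xz.2).
Proof.
under eq_fun do rewrite centeredE.
apply: measurable_sum => i; apply: measurable_funM => //; apply: measurable_funB.
  exact: (measurableT_comp (measurable_tnth i) measurable_snd).
exact: (measurableT_comp (measurable_cmeanX i) measurable_fst).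
Qed.

Definition has_mean x := forall i, (kX x).-integrable setT (fun z => (tnth z i)%:E).

Section Mean.
Variable x : m.-tuple R.
Hypothesis gx : has_mean x.

Let k1 : probability (p.-tuple R) R := kprob kX x.

Let icst (c : R) : k1.-integrable setT (EFin \o (fun=> c)).
Proof. exact: finite_measure_integrable_cst. Qed.

Let itnth i : k1.-integrable setT (EFin \o (fun z => tnth z i)).
Proof. exact: (integrable_kprob _ _ _ _).2 (gx i). Qed.

Let icoord i : k1.-integrable setT (EFin \o coord x i).
Proof. exact: (integrableB measurableT (itnth i) (icst _)). Qed.

Let coord0 i : \int[k1]_z coord x i z = 0.
Proof.
rewrite (RintegralB measurableT (itnth i) (icst _)).
by rewrite (Rintegral_prob_cst k1) Rintegral_kprob mxE subrr.
Qed.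

Lemma integrable_centered b : (kprob kX x).-integrable setT (EFin \o centered b x).
Proof.
rewrite (_ : centered b x = (fun z => \sum_(i <- enum 'I_p) b 0 i * coord x i z)).
  exact: integrable_lin.
by apply/funext => z; rewrite centeredE -big_enum.
Qed.

Lemma Rintegral_centered b : \int[kprob kX x]_z centered b x z = 0.
Proof.
under eq_Rintegral do rewrite centeredE -big_enum.
rewrite Rintegral_lin// big1// => i _.
by have := coord0 i; rewrite /k1 => ->; rewrite mulr0.
Qed.

Definition tailX b a := tail_integral (cdfXxq kX b x) a.

Lemma tailX_sublinear b c s t a : 0 <= s -> 0 <= t -> 0 < a < 1 ->
  tailX (s *: b + t *: c) a <= s * tailX b a + t * tailX c a.
Proof.
move=> s0 t0 a01.
have := tail_integral_sublinear (integrable_centered b) (integrable_centered c) s0 t0 a01.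
apply: le_trans; rewrite le_eqVlt; apply/orP; left; apply/eqP.
rewrite /tailX; congr (tail_integral (cdf_of _ _) _); apply/funext => z.
exact: centered_lin.
Qed.

Lemma tailXZ b s a : 0 <= s -> 0 < a < 1 -> tailX (s *: b) a = s * tailX b a.
Proof.
move=> s0 a01.
have := tail_integralZ (integrable_centered b) (Rintegral_centered b) s0 a01 => <-.
rewrite /tailX; congr (tail_integral (cdf_of _ _) _); apply/funext => z.
by have := centered_lin b 0 s 0 x z; rewrite !scale0r !addr0 mul0r addr0.
Qed.

Lemma tailX_le_norm b a : 0 < a < 1 ->
  tailX b a <= `|b| * \sum_i \int[kprob kX x]_z `|coord x i z|.
Proof.
move=> a01; apply: le_trans (tail_integral_le_abs (integrable_centered b) a01) _.
have iabs f : k1.-integrable setT (EFin \o f) -> k1.-integrable setT (EFin \o (fun z => `|f z|)).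
  exact: integrable_abse.
have iac i : k1.-integrable setT (EFin \o (fun z => `|coord x i z|)) by exact: iabs.
rewrite -big_enum mulr_sumr -(Rintegral_lin _ (fun=> `|b|) iac).
apply: le_Rintegral => //.
- exact: (iabs _ (integrable_centered b)).
- exact: integrable_lin.
move=> z _; rewrite centeredE -big_enum; apply: le_trans (ler_norm_sum _ _ _) _.
by apply: ler_sum => i _; rewrite normrM ler_wpM2r// norm_coord_le.
Qed.

(** A zero tail integral would make the centered combination vanish almost surely, which puts [b] in
    the kernel of the conditional variance matrix. *)
Lemma tailX_gt0 b a : (forall i, (\int[kX x]_z (tnth z i ^+ 2)%:E < +oo)%E) ->
  cvarX kX x \in unitmx -> b != 0 -> 0 < a < 1 -> 0 < tailX b a.
Proof.
move=> X2 V b0 a01.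
apply: (tail_integral_gt0 (integrable_centered b) (Rintegral_centered b)) => // ae0.
have icc i j : k1.-integrable setT (EFin \o (fun z => coord x j z * coord x i z)).
  have isq l : k1.-integrable setT (EFin \o (fun z => tnth z l ^+ 2)).
    apply/integrableP; split.
      by apply/measurable_EFinP; apply: measurable_funX; exact: measurable_tnth.
    rewrite integral_kprob; apply: le_lt_trans (X2 l).
    rewrite le_eqVlt; apply/orP; left; apply/eqP; apply: eq_integral => z _ /=.
    by rewrite ger0_norm ?sqr_ge0.
  have i1 := integrable_lin2 2 2 (isq i) (isq j).
  (* The dominating function [2 u^2 + 2 v^2 + 2 (c1^2 + c2^2)] comes from [2 r s <= r^2 + s^2] and
     [(u - c1)^2 <= 2 u^2 + 2 c1^2]. *)
  have i2 := integrable_lin2 1 (2 * (cmeanX kX x 0 i ^+ 2 + cmeanX kX x 0 j ^+ 2)) i1 (icst 1).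
  apply: (le_integrable measurableT _ _ i2) => [|z _ /=].
    by apply/measurable_EFinP; apply: measurable_funM; apply/measurable_EFinP;
      exact: measurable_int (icoord _).
  rewrite lee_fin normrM mulr1 mul1r (ger0_norm (_ : 0 <= 2 * _ + _ + _)); last first.
    by rewrite !addr_ge0// mulr_ge0// ?addr_ge0// sqr_ge0.
  rewrite /coord; set u := tnth z i; set v := tnth z j.
  move: (cmeanX kX x 0 i) (cmeanX kX x 0 j) => c1 c2.
  have H (s t : R) : `|s - t| ^+ 2 <= 2 * s ^+ 2 + 2 * t ^+ 2.
    by rewrite real_normK ?num_real//; have := sqr_ge0 (s + t); nra.
  have := H u c1; have := H v c2; have := sqr_ge0 (`|u - c1| - `|v - c2|).
  move: `|u - c1| `|v - c2| => r s; nra.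
(* Its entries are the covariances of the coordinates with the combination that vanishes almost
   surely. *)
have : cvarX kX x *m b^T = 0.
  apply/matrixP => i j; rewrite (ord1 j) !mxE.
  transitivity (\int[k1]_z (coord x i z * centered b x z)).
    under [RHS]eq_Rintegral.
      move=> z _; rewrite centeredE mulr_sumr.
      under eq_bigr do rewrite mulrC -mulrA.
      rewrite -big_enum/=.
      over.
    rewrite Rintegral_lin// -[LHS]big_enum/=; apply: eq_bigr => l _.
    rewrite !mxE mulrC Rintegral_kprob; congr (_ * _); apply: eq_Rintegral => z _.
    by rewrite /coord !mxE mulrC.
  rewrite /Rintegral (ae_eq_integral (cst 0%E))//; first by rewrite integral0.
    apply/measurable_EFinP; apply: measurable_funM; apply/measurable_EFinP.
      exact: measurable_int (icoord _).
    exact: measurable_int (integrable_centered b).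
  by apply: filterS ae0 => z z0 _; rewrite z0 mulr0.
move=> /(congr1 (mulmx (invmx (cvarX kX x)))); rewrite mulKmx// mulmx0.
by move=> /(congr1 trmx); rewrite trmxK trmx0 => /eqP; rewrite (negbTE b0).
Qed.

End Mean.

Lemma has_mean_X2 x : (forall i, (\int[kX x]_z (tnth z i ^+ 2)%:E < +oo)%E) -> has_mean x.
Proof.
move=> X2 i; apply/integrable_kprob; apply/integrableP; split.
  by apply/measurable_EFinP; exact: measurable_tnth.
rewrite integral_kprob.
have m2 : measurable_fun setT (fun z : p.-tuple R => (tnth z i ^+ 2)%:E).
  by apply/measurable_EFinP; apply: measurable_funX; exact: measurable_tnth.
apply: (@le_lt_trans _ _ (\int[kX x]_z (1 + (tnth z i ^+ 2)%:E))%E).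
  apply: ge0_le_integral => //.
  - apply: measurableT_comp => //; apply/measurable_EFinP; exact: measurable_tnth.
  - exact: emeasurable_funD.
  - move=> z _; rewrite -EFinD lee_fin.
    have := sqr_ge0 (`|tnth z i| - 1); have := normr_ge0 (tnth z i).
    rewrite -(real_normK (num_real (tnth z i))); move: `|_| => r; nra.
rewrite ge0_integralD//; last by move=> z _; rewrite lee_fin sqr_ge0.
by rewrite integral_cst// mul1e lte_add_pinfty// (_ : kX x setT = 1%E) ?ltry// prob_kernel.
Qed.

End Centered.

(** * The identified set *)

Section SameLawSet.
Context d1 d2 d (T1 : measurableType d1) (T2 : measurableType d2)
  (T : measurableType d) {R : realType}.
Variables (m1 : {measure set T1 -> \bar R}) (m2 : {measure set T2 -> \bar R}).
Variables (X1 : T1 -> T) (X2 : T2 -> T).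
Hypothesis mX1 : measurable_fun setT X1.
Hypothesis mX2 : measurable_fun setT X2.
Hypothesis lawE : forall A, measurable A -> m1 (X1 @^-1` A) = m2 (X2 @^-1` A).

Lemma ge0_integral_same_law_set (psi : T -> \bar R) B : measurable_fun setT psi ->
  (forall x, 0 <= psi x)%E -> measurable B ->
  (\int[m1]_(w in X1 @^-1` B) psi (X1 w) = \int[m2]_(w in X2 @^-1` B) psi (X2 w))%E.
Proof.
move=> mpsi psi0 mB; rewrite [LHS]integral_mkcond [RHS]integral_mkcond.
apply: (ge0_integral_same_law mX1 mX2 lawE (psi := psi \_ B)).
  by apply/(measurable_restrictT _ _).1 => //; exact: measurable_funTS.
by move=> x; rewrite patchE; case: ifPn.
Qed.

Lemma integral_same_law_set (f : T -> R) B : measurable_fun setT f ->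
  m1.-integrable setT (EFin \o (f \o X1)) -> measurable B ->
  (\int[m1]_(w in X1 @^-1` B) (f (X1 w))%:E = \int[m2]_(w in X2 @^-1` B) (f (X2 w))%:E)%E.
Proof.
move=> mf i1 mB; rewrite [LHS]integral_mkcond [RHS]integral_mkcond.
have E1 d' (T' : measurableType d') (X' : T' -> T) :
    ((fun w => (f (X' w))%:E) \_ (X' @^-1` B))%E = (fun w => ((f \_ B) (X' w))%:E).
  by apply/funext => w; rewrite !patchE; have -> : (w \in X' @^-1` B) = (X' w \in B) by []; case: ifPn.
rewrite !E1; apply: (integral_same_law mX1 mX2 lawE).
  by apply/(measurable_restrictT _ _).1 => //; exact: measurable_funTS.
have mXB : measurable (X1 @^-1` B) by rewrite -[X in measurable X]setTI; exact: mX1.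
have := (integrable_mkcond _ mXB).1 (integrableS measurableT mXB (@subsetT _ _) i1).
rewrite (_ : EFin \o (f \_ B \o X1) = (fun w => ((f \_ B) (X1 w))%:E))// -E1.
by [].
Qed.

End SameLawSet.

Section StopLossLevel.
Context {R : realType} d1 (T1 : measurableType d1) (mu : probability T1 R).

Lemma stop_loss_le_shift (zeta : T1 -> R) c c' : mu.-integrable setT (EFin \o zeta) ->
  c <= c' -> stop_loss mu zeta c <= stop_loss mu zeta c' + (c' - c).
Proof.
move=> iz cc; have mz : measurable_fun setT zeta.
  by move/measurable_int : iz => /measurable_EFinP.
have is_ e : mu.-integrable setT (EFin \o (fun z => Num.max (zeta z - e) 0)).
  exact: (integrable_stop_loss mz iz).
have ic : mu.-integrable setT (EFin \o (fun=> c' - c)) by exact: finite_measure_integrable_cst.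
rewrite -[X in _ <= _ + X](Rintegral_prob_cst mu) -(RintegralD measurableT (is_ c') ic).
apply: le_Rintegral => //; first exact: (integrableD measurableT (is_ c') ic).
move=> z _; have [h|h] := leP (zeta z - c) 0; have := ler_norm 0.
  by move=> _; rewrite addr_ge0 ?subr_ge0// le_max lexx orbT.
by move=> _; rewrite -lerBlDr le_max; apply/orP; left; lra.
Qed.

Lemma stop_loss_le_anti (zeta : T1 -> R) c c' : mu.-integrable setT (EFin \o zeta) ->
  c <= c' -> stop_loss mu zeta c' <= stop_loss mu zeta c.
Proof.
move=> iz cc; have mz : measurable_fun setT zeta.
  by move/measurable_int : iz => /measurable_EFinP.
apply: le_Rintegral => //; try exact: (integrable_stop_loss mz iz).
by move=> z _; rewrite ge_max !le_max lexx orbT andbT lerB.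
Qed.

End StopLossLevel.

(** The stop-loss function is nonincreasing and 1-Lipschitz in its level, so a rational level just
    above [c] loses at most [e]. A countable set of levels is what allows a single null set of
    [x]. *)
Lemma stop_loss_le_rat (R : realType) d1 d2 (T1 : measurableType d1) (T2 : measurableType d2)
    (mu : probability T1 R) (nu : probability T2 R) (zeta : T1 -> R) (eta : T2 -> R) :
  mu.-integrable setT (EFin \o zeta) -> nu.-integrable setT (EFin \o eta) ->
  (forall q : rat, stop_loss mu zeta (ratr q) <= stop_loss nu eta (ratr q)) ->
  forall c, stop_loss mu zeta c <= stop_loss nu eta c.
Proof.
move=> iz ie H c; apply/ler_addgt0Pr => e e0.
have [q /andP[cq qe]] : exists q : rat, c < ratr q < c + e.
  have ce : c < c + e by rewrite ltrDl.
  by have [q] := rat_in_itvoo ce; rewrite in_itv/= => ?; exists q.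
have := stop_loss_le_shift iz (ltW cq).
have := H q; have := stop_loss_le_anti ie (ltW cq); lra.
Qed.

(** * Dominance is necessary and sufficient for identification *)

Section Model.
Context {R : realType} d {Omega : measurableType d} {P : probability Omega R}
  {p m : nat}.
Variables (Y : {RV P >-> R}) (Xnc : {RV P >-> p.-tuple R}) (Xc : {RV P >-> m.-tuple R}).
Variables (kY : R.-pker m.-tuple R ~> R) (kX : R.-pker m.-tuple R ~> p.-tuple R).
Hypotheses (kYP : is_cond_law P Y Xc kY) (kXP : is_cond_law P Xnc Xc kX).
Hypothesis iY : P.-integrable setT (EFin \o Y).
Hypothesis X1 : \forall x \ae distribution P Xc, has_mean kX x.

Let mu : probability (m.-tuple R) R := distribution P Xc.

(** Measurability of [Q] is what makes the transfer possible: the given null set lies in [Omega],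
    and the exceptional set for the law of [Xc] has to be the complement of [Q] itself. *)
Lemma ae_law (Q : m.-tuple R -> Prop) :
  measurable [set x | Q x] -> (\forall w \ae P, Q (Xc w)) -> \forall x \ae mu, Q x.
Proof.
move=> mQ [N [mN N0 QN]]; exists (~` [set x | Q x]); split => //.
  exact: measurableC.
apply/eqP; rewrite eq_le measure_ge0 andbT -N0 /mu/= /distribution/pushforward.
apply: le_measure; rewrite ?inE//.
by rewrite -[X in measurable X]setTI; apply: measurable_funPT => //; exact: measurableC.
Qed.

Definition Y_has_mean x := (kY x).-integrable setT (EFin \o id).

Let mN : measurable_fun setT (fun x => \int[kY x]_y `|y%:E|)%E.
Proof.
have mabs : measurable_fun setT (fun xy : m.-tuple R * R => `|xy.2%:E|%E).
  by apply: measurableT_comp => //; apply/measurable_EFinP; exact: measurable_snd.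
exact: (measurable_fun_integral_finite_kernel _ kY (fun _ => abse_ge0 _) mabs).
Qed.

Lemma Y_has_mean_ae : \forall x \ae mu, Y_has_mean x.
Proof.
have : \forall x \ae mu, (\int[kY x]_y `|y%:E| < +oo)%E.
  apply: ae_law; first by rewrite -[X in measurable X]setTI; exact: emeasurable_fun_infty_o.
  have iG : P.-integrable setT (fun w => ((fun xy : m.-tuple R * R => xy.2) (Xc w, Y w))%:E) by [].
  have := cond_law_integrable (measurable_funPT Y) (measurable_funPT Xc) kYP
    (@measurable_snd _ _ _ _) iG.
  by apply: filterS => w /integrableP[].
by apply: filterS => x Nx; apply/integrableP; split => //; exact/measurable_EFinP.
Qed.

Lemma cmeanYE : is_cond_exp P Y Xc (cmeanY kY).
Proof.
exact: (is_cond_exp_cond_law (G := fun xy : m.-tuple R * R => xy.2)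
  (measurable_funPT Y) (measurable_funPT Xc) kYP (@measurable_snd _ _ _ _) iY).
Qed.

Lemma dotB (u v b : 'rV[R]_p) : dot (u - v) b = dot u b - dot v b.
Proof.
by rewrite /dot -sumrB; apply: eq_bigr => i _; rewrite !mxE mulrBl.
Qed.

Lemma partially_linearE b g x z :
  partially_linear b g (z, x) = g x + dot (cmeanX kX x) b + centered kX b x z.
Proof. by rewrite /partially_linear /centered dotB/=; ring. Qed.

Lemma measurable_dot_cmeanX (b : 'rV[R]_p) : measurable_fun setT (fun x => dot (cmeanX kX x) b).
Proof.
apply: measurable_sum => i; apply: measurable_funM => //; exact: measurable_cmeanX.
Qed.

Lemma measurable_partially_linear b g :
  measurable_fun setT (@partially_linear R p m b g) <-> measurable_fun setT g.
Proof.
have md : measurable_fun setT (fun x : p.-tuple R * m.-tuple R => dot (vec x.1) b).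
  apply: measurable_sum => i; apply: measurable_funM => //.
  under eq_fun do rewrite mxE.
  exact: (measurableT_comp (measurable_tnth i) measurable_fst).
split => [mh|mg].
  pose z0 : p.-tuple R := [tuple 0 | i < p].
  have -> : g = (fun x => partially_linear b g (z0, x) - dot (vec z0) b).
    by apply/funext => x; rewrite /partially_linear/= addrK.
  apply: measurable_funB => //.
  by apply: (measurableT_comp mh (g := fun x => (z0, x))); exact: measurable_fun_pair.
apply: measurable_funD => //; exact: (measurableT_comp mg measurable_snd).
Qed.

Section Forward.
Variables (b : 'rV[R]_p) (g : m.-tuple R -> R).
Hypothesis bg : identified Y Xnc Xc b g.

Let h : p.-tuple R * m.-tuple R -> R := partially_linear b g.
Let W w := (Xnc w, Xc w).

Let mW : measurable_fun setT W. Proof. exact: measurable_fun_pair. Qed.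

Lemma identified_measurable : measurable_fun setT g.
Proof.
have [d' [T' [P' [Y' [X' [C' [_ _ [_ mh _ _]]]]]]]] := bg.
exact/(measurable_partially_linear b g).
Qed.

Let mh : measurable_fun setT h.
Proof. exact: (measurable_partially_linear b g).2 identified_measurable. Qed.

Let ih : P.-integrable setT (EFin \o (h \o W)).
Proof.
have [d' [T' [P' [Y' [X' [C' [_ lawX [_ _ ih' _]]]]]]]] := bg.
have mW' : measurable_fun setT (fun w => (X' w, C' w)) by exact: measurable_fun_pair.
exact: (integrable_same_law mW' mW lawX mh ih').
Qed.

(** Jensen's inequality holds on the auxiliary space, where the joint law is arbitrary. Its left
    side only involves the law of [(Xnc', Xc')] and its right side that of [(Y', Xc')], so each side
    returns to [Omega] separately, even if [Y] and [Xnc] are coupled differently there. *)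
Let iC (v : m.-tuple R -> R) : measurable_fun setT v -> P.-integrable setT (EFin \o (v \o Xc)) ->
  forall c B, measurable B ->
  (\int[P]_(w in Xc @^-1` B) (Num.max (h (W w) - (v (Xc w) + c)) 0)%:E <=
   \int[P]_(w in Xc @^-1` B) (Num.max (Y w - (v (Xc w) + c)) 0)%:E)%E.
Proof.
move=> mv iv c B mB.
have [d' [T' [P' [Y' [X' [C' [lawY lawX ce]]]]]]] := bg.
have mW' : measurable_fun setT (fun w => (X' w, C' w)) by exact: measurable_fun_pair.
have mZ' : measurable_fun setT (fun w => (Y' w, C' w)) by exact: measurable_fun_pair.
have mZ : measurable_fun setT (fun w => (Y w, Xc w)) by exact: measurable_fun_pair.
have mB1 : measurable (snd @^-1` B : set (p.-tuple R * m.-tuple R)).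
  by rewrite -[X in measurable X]setTI; exact: measurable_snd.
have mB2 : measurable (snd @^-1` B : set (R * m.-tuple R)).
  by rewrite -[X in measurable X]setTI; exact: measurable_snd.
pose v1 (zx : p.-tuple R * m.-tuple R) := v zx.2 + c.
have mv1 : measurable_fun setT v1.
  by apply: measurable_funD => //; exact: (measurableT_comp mv measurable_snd).
have mv2 : measurable_fun setT (fun yx : R * m.-tuple R => v yx.2 + c).
  by apply: measurable_funD => //; exact: (measurableT_comp mv measurable_snd).
have iv1 : P'.-integrable setT (EFin \o (v1 \o (fun w => (X' w, C' w)))).
  have lawX' A : measurable A -> P (W @^-1` A) = P' ((fun w => (X' w, C' w)) @^-1` A).
    by move=> mA; rewrite lawX.
  apply: (integrable_same_law mW mW' lawX' mv1).
  have icst : P.-integrable setT (EFin \o (fun=> c)) by exact: finite_measure_integrable_cst.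
  exact: (integrableD measurableT iv icst).
have := is_cond_exp_pos mW' ce mv1 iv1 mB1.
have mpsi1 : measurable_fun setT (fun zx => (Num.max (h zx - v1 zx) 0)%:E).
  by apply/measurable_EFinP; apply: measurable_maxr => //; exact: measurable_funB.
have mpsi2 : measurable_fun setT (fun yx : R * m.-tuple R => (Num.max (yx.1 - (v yx.2 + c)) 0)%:E).
  by apply/measurable_EFinP; apply: measurable_maxr => //; exact: measurable_funB.
have E1 := ge0_integral_same_law_set mW' mW lawX mpsi1 (fun _ => _) mB1.
have E2 := ge0_integral_same_law_set mZ' mZ lawY mpsi2 (fun _ => _) mB2.
rewrite [leLHS]E1; last by move=> zx; rewrite lee_fin le_max lexx orbT.
by rewrite [leRHS]E2// => yx; rewrite lee_fin le_max lexx orbT.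
Qed.

Let eW B : measurable B ->
  (\int[P]_(w in Xc @^-1` B) (h (W w))%:E = \int[P]_(w in Xc @^-1` B) (Y w)%:E)%E.
Proof.
move=> mB.
have [d' [T' [P' [Y' [X' [C' [lawY lawX [iY' _ ih' e]]]]]]]] := bg.
have mW' : measurable_fun setT (fun w => (X' w, C' w)) by exact: measurable_fun_pair.
have mZ' : measurable_fun setT (fun w => (Y' w, C' w)) by exact: measurable_fun_pair.
have mZ : measurable_fun setT (fun w => (Y w, Xc w)) by exact: measurable_fun_pair.
have mB1 : measurable (snd @^-1` B : set (p.-tuple R * m.-tuple R)).
  by rewrite -[X in measurable X]setTI; exact: measurable_snd.
have mB2 : measurable (snd @^-1` B : set (R * m.-tuple R)).
  by rewrite -[X in measurable X]setTI; exact: measurable_snd.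
have E1 := integral_same_law_set mW' mW lawX mh ih' mB1.
have E2 := integral_same_law_set mZ' mZ lawY (@measurable_fst _ _ _ _) iY' mB2.
by rewrite -[LHS]E1 -[RHS]E2 [RHS](e _ mB1).
Qed.

(** Tower property: [h W] and [Y] have the same integrals over events of [Xc]. Averaging [h] under
    [kX x] removes the centered part and leaves [g x] plus the mean term. *)
Lemma identified_cmean : \forall x \ae mu, g x = cmeanY kY x - dot (cmeanX kX x) b.
Proof.
pose G (xz : m.-tuple R * p.-tuple R) := h (xz.2, xz.1).
have mG : measurable_fun setT G.
  by apply: (measurableT_comp mh (g := fun xz => (xz.2, xz.1))); exact: measurable_fun_pair.
have c1 := is_cond_exp_cond_law (measurable_funPT Xnc) (measurable_funPT Xc) kXP mG ih.
have mC : measurable_fun setT Xc by [].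
have [_ mc2 _ _] := cmeanYE; have [_ mc1 _ _] := c1.
have mQ : measurable [set x | \int[kX x]_z G (x, z) = cmeanY kY x].
  have := measurable_fun_eqr mc1 mc2 measurableT (Y := [set true]) => /(_ _).
  rewrite setTI (_ : _ @^-1` _ = [set x | \int[kX x]_z G (x, z) = cmeanY kY x]); first by apply.
  by apply/seteqP; split => x /= /eqP.
have le1 : \forall w \ae P, \int[kX (Xc w)]_z G (Xc w, z) <= cmeanY kY (Xc w).
  by apply: (is_cond_exp_le mC c1 cmeanYE) => B mB; have := eW mB; rewrite /W => ->.
have le2 : \forall w \ae P, cmeanY kY (Xc w) <= \int[kX (Xc w)]_z G (Xc w, z).
  by apply: (is_cond_exp_le mC cmeanYE c1) => B mB; have := eW mB; rewrite /W => ->.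
have H : \forall x \ae mu, \int[kX x]_z G (x, z) = cmeanY kY x.
  by apply: ae_law => //; apply: filterS2 le1 le2 => w l1 l2; apply/eqP; rewrite eq_le l1 l2.
apply: filterS2 X1 H => x gx; rewrite -Rintegral_kprob => <-.
have -> : \int[kprob kX x]_z G (x, z) = g x + dot (cmeanX kX x) b.
  under eq_Rintegral do rewrite /G/= /h partially_linearE.
  rewrite RintegralD//; last exact: integrable_centered.
    by rewrite (Rintegral_prob_cst (kprob kX x)) Rintegral_centered// addr0.
  exact: (finite_measure_integrable_cst (kprob kX x)).
by rewrite addrK.
Qed.

Lemma identified_tail : \forall x \ae mu, forall a, 0 < a < 1 ->
  tailX kX x b a <= tail_integral (cdfYx kY x) a.
Proof.
pose GX c (xz : m.-tuple R * p.-tuple R) := Num.max (h (xz.2, xz.1) - (cmeanY kY xz.1 + c)) 0.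
pose GY c (xy : m.-tuple R * R) := Num.max (xy.2 - (cmeanY kY xy.1 + c)) 0.
have [_ mc2 ic2 _] := cmeanYE.
have mv c : measurable_fun setT (fun x => cmeanY kY x + c) by exact: measurable_funD.
have iv c : P.-integrable setT (EFin \o (fun w => cmeanY kY (Xc w) + c)).
  have icst : P.-integrable setT (EFin \o (fun=> c)) by exact: finite_measure_integrable_cst.
  exact: (integrableD measurableT ic2 icst).
have mGX c : measurable_fun setT (GX c).
  apply: measurable_maxr => //; apply: measurable_funB.
    by apply: (measurableT_comp mh (g := fun xz => (xz.2, xz.1))); exact: measurable_fun_pair.
  exact: (measurableT_comp (mv c) measurable_fst).
have mGY c : measurable_fun setT (GY c).
  apply: measurable_maxr => //; apply: measurable_funB => //.
  exact: (measurableT_comp (mv c) measurable_fst).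
have ipos f : P.-integrable setT (EFin \o f) -> P.-integrable setT (EFin \o (fun w => Num.max (f w) 0)).
  move=> iff; apply: (le_integrable measurableT _ _ iff) => [|w _ /=].
    by apply/measurable_EFinP; apply: measurable_maxr => //; apply/measurable_EFinP; exact: measurable_int iff.
  by rewrite lee_fin ger0_norm ?le_max ?lexx ?orbT// ge_max normr_ge0 andbT ler_norm.
have iGX c : P.-integrable setT (fun w => (GX c (Xc w, Xnc w))%:E).
  exact: (ipos (fun w => h (W w) - (cmeanY kY (Xc w) + c)) (integrableB measurableT ih (iv c))).
have iGY c : P.-integrable setT (fun w => (GY c (Xc w, Y w))%:E).
  exact: (ipos (fun w => Y w - (cmeanY kY (Xc w) + c)) (integrableB measurableT iY (iv c))).
have cX c := is_cond_exp_cond_law (measurable_funPT Xnc) (measurable_funPT Xc) kXP (mGX c) (iGX c).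
have cY c := is_cond_exp_cond_law (measurable_funPT Y) (measurable_funPT Xc) kYP (mGY c) (iGY c).
have mC : measurable_fun setT Xc by [].
have H c : \forall x \ae mu, \int[kX x]_z GX c (x, z) <= \int[kY x]_y GY c (x, y).
  have [_ m1 _ _] := cX c; have [_ m2 _ _] := cY c.
  apply: ae_law; first by rewrite -[X in measurable X]setTI; exact: (measurable_fun_ler m1 m2).
  by apply: (is_cond_exp_le mC (cX c) (cY c)) => B mB; exact: (iC mc2 ic2 c mB).
(* All rational levels at once: [unpickle] enumerates them, and integers that code no rational are
   sent to 0. *)
have {}H : \forall x \ae mu, forall n, let c := ratr (odflt 0 (unpickle n)) : R in
    \int[kX x]_z GX c (x, z) <= \int[kY x]_y GY c (x, y).
  by apply/ae_foralln => n; exact: H.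
apply: filterS2 (filterI X1 Y_has_mean_ae) (filterI identified_cmean H) => x [gX gY] [gx {}H] a a01.
have iY1 : (kprob kY x).-integrable setT (EFin \o (fun y : R => y - cmeanY kY x)).
  have gY' := (integrable_kprob _ _ _ _).2 gY.
  have icst : (kprob kY x).-integrable setT (EFin \o (fun=> cmeanY kY x)).
    exact: (finite_measure_integrable_cst (kprob kY x)).
  exact: (integrableB measurableT gY' icst).
apply: (tail_integral_mono (integrable_centered gX b) iY1 _ a01).
apply: (stop_loss_le_rat (integrable_centered gX b) iY1) => q.
have := H (pickle q); rewrite pickleK/= -!Rintegral_kprob /stop_loss /GX /GY/=.
set L := Rintegral _ _ _; set L' := Rintegral _ _ _ => LL.
rewrite (_ : Rintegral _ _ _ = L); last first.
  apply: eq_Rintegral => z _; rewrite /h partially_linearE gx; congr (Num.max _ _); ring.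
rewrite (_ : Rintegral _ _ _ = L')//.
by apply: eq_Rintegral => y _; congr (Num.max _ _); ring.
Qed.

End Forward.

Lemma identifiedI (b : 'rV[R]_p) (g : m.-tuple R -> R) : measurable_fun setT g ->
  (\forall x \ae mu, g x = cmeanY kY x - dot (cmeanX kX x) b) ->
  (\forall x \ae mu, forall a, 0 < a < 1 ->
    tailX kX x b a <= tail_integral (cdfYx kY x) a) ->
  identified Y Xnc Xc b g.
Proof.
move=> mg gE tailE.
have [N [mN' N0 QN]] := filterI (filterI X1 Y_has_mean_ae) (filterI gE tailE).
pose good := ~` N.
have mgood : measurable good by exact: measurableC.
have goodP : P (Xc @^-1` (~` good)) = 0%E by rewrite /good setCK.
have goodE x : good x -> (has_mean kX x /\ Y_has_mean x) /\
    (g x = cmeanY kY x - dot (cmeanX kX x) b /\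
     forall a, 0 < a < 1 -> tailX kX x b a <= tail_integral (cdfYx kY x) a).
  by move=> gx; apply/not_notP => nQ; apply: gx; exact: QN.
(* [mY] is built from [g] instead of being [cmeanY], with which it agrees only on [good]. In this
   way [partially_linear b g] equals [mY] plus the centered part everywhere, as needed at the
   end. *)
pose mY x := g x + dot (cmeanX kX x) b.
have mmY : measurable_fun setT mY.
  by apply: measurable_funD => //; exact: measurable_dot_cmeanX.
have mz := measurable_centered kX b.
have mYE x : good x -> mY x = cmeanY kY x.
  by move=> /goodE[_ [gx _]]; rewrite /mY gx subrK.
have h1 x : good x -> (kY x).-integrable setT (EFin \o (fun y : R => y - mY x)) /\
    \int[kY x]_y (y - mY x) = 0.
  move=> gx; have [[_ iy] _] := goodE x gx.
  have iy' := (integrable_kprob _ _ _ _).2 iy.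
  have icst : (kprob kY x).-integrable setT (EFin \o (fun=> mY x)).
    exact: (finite_measure_integrable_cst (kprob kY x)).
  split; first exact: ((integrable_kprob _ _ _ _).1 (integrableB measurableT iy' icst)).
  rewrite -Rintegral_kprob (RintegralB measurableT iy' icst) (Rintegral_prob_cst (kprob kY x)).
  by rewrite mYE// Rintegral_kprob subrr.
have h2 x : good x -> (kX x).-integrable setT (EFin \o centered kX b x) /\
    \int[kX x]_z centered kX b x z = 0.
  move=> gx; have [[ix _] _] := goodE x gx.
  split; first exact: ((integrable_kprob _ _ _ _).1 (integrable_centered ix b)).
  by rewrite -Rintegral_kprob Rintegral_centered.
have h3 x : good x -> forall a, 0 < a < 1 ->
    tail_integral (cdf_of (kX x) (centered kX b x)) a <=
    tail_integral (cdf_of (kY x) (fun y : R => y - mY x)) a.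
  by move=> gx a a01; have [_ [_ h]] := goodE x gx; rewrite mYE//; exact: h.
have mX := measurable_funPT Xnc; have mC := measurable_funPT Xc; have mYY := measurable_funPT Y.
have mcoupled := measurable_coupled mX mC mmY mz mgood h1 h2.
have law := same_law_coupled mX mC kXP mmY mz mgood goodP h1 h2 h3 mYY kYP.
have ce := is_cond_exp_coupled mX mC kXP mmY mz mgood goodP h1 h2 h3 mYY kYP iY.
pose P' : probability ((Omega * R) * R)%type R := ((P \x unif) \x unif)%E.
have m11 : measurable_fun setT (fun w : (Omega * R) * R => w.1.1).
  exact: (measurableT_comp measurable_fst measurable_fst).
have mX' : measurable_fun setT (fun w : (Omega * R) * R => Xnc w.1.1).
  exact: (measurableT_comp mX m11).
have mC' : measurable_fun setT (fun w : (Omega * R) * R => Xc w.1.1).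
  exact: (measurableT_comp mC m11).
exists _, _, P', (mkmfun mcoupled), (mkmfun mX'), (mkmfun mC'); split.
- exact: law.
- move=> B mB; have mA : measurable ((fun w => (Xnc w, Xc w)) @^-1` B).
    by rewrite -[X in measurable X]setTI; apply: measurable_fun_pair.
  have mA1 : measurable (fst @^-1` ((fun w => (Xnc w, Xc w)) @^-1` B) : set (Omega * R)).
    by rewrite -[X in measurable X]setTI; exact: measurable_fst.
  by rewrite -[RHS](product_unif_fst P mA) -[RHS](product_unif_fst (P \x unif)%E mA1).
- have -> : partially_linear b g = (fun xz => mY xz.2 + centered kX b xz.2 xz.1).
    by apply/funext => -[z x]; rewrite partially_linearE.
  exact: ce.
Qed.

End Model.

(** Sublinearity and the upper bound make [T] Lipschitz, so it attains a minimum on the compact unit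
    sphere of the sup norm. This minimum is positive and serves as [delta] by homogeneity. *)
Lemma sublinear_coercive (R : realType) p (T : 'rV[R]_p -> R) (M : R) :
  (forall b c, T (b + c) <= T b + T c) ->
  (forall s b, 0 <= s -> T (s *: b) = s * T b) ->
  (forall b, T b <= `|b| * M) -> (forall b, b != 0 -> 0 < T b) ->
  exists2 delta, 0 < delta & forall b, delta * `|b| <= T b.
Proof.
move=> TD TZ TM T0.
have T00 : T 0 = 0 by rewrite -(scale0r 0) TZ// mul0r.
have Tlip b c : T b - T c <= `|b - c| * `|M|.
  have := TD c (b - c); rewrite addrC subrK => h.
  have := TM (b - c); have := ler_wpM2l (normr_ge0 (b - c)) (ler_norm M); lra.
pose S : set 'rV[R]_p := [set b | `|b| = 1].
have normS b : b != 0 -> S (`|b|^-1 *: b).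
  by move=> b0; rewrite /S/= normrZ normrV ?unitfE ?normr_eq0// normr_id mulVf// normr_eq0.
(* The sphere is empty in dimension 0, where 0 is the only vector. *)
have [[q Sq]|noS] := pselect (S !=set0); last first.
  exists 1 => // b; have [->|b0] := eqVneq b 0; first by rewrite normr0 mulr0 T00.
  by exfalso; apply: noS; exists (`|b|^-1 *: b); exact: normS.
have Tcont : continuous T.
  move=> b; apply/(@cvgrPdist_le R R^o 'rV[R]_p (nbhs b) (nbhs_filter b)) => e e0.
  (* The [+ 1] keeps the radius positive when [M = 0]. *)
  have d0 : 0 < e / (`|M| + 1) by rewrite divr_gt0// ltr_wpDl.
  have := nbhsx_ballx b _ d0; apply: filterS => c; rewrite -ball_normE/= => bc.
  have : `|b - c| * `|M| <= e.
    have : `|b - c| * (`|M| + 1) <= e by rewrite -ler_pdivlMr ?ltr_wpDl// ltW.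
    by have := normr_ge0 (b - c); nra.
  have := Tlip b c; have := Tlip c b; rewrite (distrC c b) ler_norml => h1 h2 h3.
  by apply/andP; split; lra.
have cS : compact S.
  apply: bounded_closed_compact.
    by exists 1; split => // x x1 b /= ->; exact: ltW.
  have -> : S = (fun b : 'rV[R]_p => `|b|) @^-1` [set 1] by [].
  by apply: (closed_comp (fun b _ => @norm_continuous _ _ b)); exact: closed_eq.
have [c /set_mem cS1 minc] := compact_EVT_min (ex_intro _ q Sq) cS (continuous_subspaceT Tcont).
have c0 : c != 0 by apply/eqP => c0; move: cS1; rewrite /S/= c0 normr0 => /eqP; rewrite eq_sym oner_eq0.
exists (T c); first exact: T0.
move=> b; have [->|b0] := eqVneq b 0; first by rewrite normr0 mulr0 T00.
have := minc _ (mem_set (normS _ b0)); rewrite TZ ?invr_ge0// => h.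
by rewrite -ler_pdivlMr ?normr_gt0// mulrC.
Qed.

(** * Ratio formula, convexity and compactness *)

Section IdentifiedSetShape.
Context {R : realType} d {Omega : measurableType d} {P : probability Omega R}
  {p m : nat}.
Hypothesis p_gt0 : (0 < p)%N.
Variables (Y : {RV P >-> R}) (Xnc : {RV P >-> p.-tuple R}) (Xc : {RV P >-> m.-tuple R}).
Variables (kY : R.-pker m.-tuple R ~> R) (kX : R.-pker m.-tuple R ~> p.-tuple R).
Hypotheses (kYP : is_cond_law P Y Xc kY) (kXP : is_cond_law P Xnc Xc kX).
Hypothesis iY : P.-integrable setT (EFin \o Y).

Let mu : probability (m.-tuple R) R := distribution P Xc.

Hypothesis X2 : \forall x \ae mu, forall i : 'I_p, (\int[kX x]_z (tnth z i ^+ 2)%:E < +oo)%E.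
Hypothesis Xns : \forall x \ae mu, cvarX kX x \in unitmx.

Let TY x a := tail_integral (cdfYx kY x) a.

Let X1 : \forall x \ae mu, has_mean kX x.
Proof. by apply: filterS X2 => x; exact: has_mean_X2. Qed.

(** The quantifier over [g] disappears: a suitable [g] is determined almost everywhere by [b], and
    the explicit formula provides one. *)
Lemma BcP b : Bc Y Xnc Xc b <->
  \forall x \ae mu, forall a, 0 < a < 1 -> tailX kX x b a <= TY x a.
Proof.
split=> [[g bg]|H]; first exact: (identified_tail kYP kXP iY X1 bg).
have [_ mc _ _] := cmeanYE kYP iY.
exists (fun x => cmeanY kY x - dot (cmeanX kX x) b).
apply: (identifiedI kYP kXP iY X1) => //.
  by apply: measurable_funB => //; exact: measurable_dot_cmeanX.
exact: nearW.
Qed.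

Lemma FsetE : Fset Y Xnc Xc =
  [set g | measurable_fun setT g /\ exists2 b, Bc Y Xnc Xc b &
    \forall x \ae mu, g x = cmeanY kY x - dot (cmeanX kX x) b].
Proof.
apply/seteqP; split => g.
  move=> [b bg]; split; first exact: identified_measurable bg.
  by exists b; [exists g | exact: (identified_cmean kYP kXP iY X1 bg)].
move=> [mg [b /BcP Bb gE]]; exists b; exact: (identifiedI kYP kXP iY X1).
Qed.

Lemma TY_ge0 x a : Y_has_mean kY x -> 0 < a < 1 -> 0 <= TY x a.
Proof.
move=> gY; have gY' := (integrable_kprob _ _ _ _).2 gY.
have icst : (kprob kY x).-integrable setT (EFin \o (fun=> cmeanY kY x)).
  exact: (finite_measure_integrable_cst (kprob kY x)).
apply: (tail_integral_ge0 (integrableB measurableT gY' icst)).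
rewrite (RintegralB measurableT gY' icst) (Rintegral_prob_cst (kprob kY x)).
by rewrite Rintegral_kprob subrr.
Qed.

Lemma Bc0 : Bc Y Xnc Xc 0.
Proof.
apply/BcP; apply: filterS2 X1 (Y_has_mean_ae kYP iY) => x gX gY a a01.
by rewrite -(scale0r 0) (tailXZ gX)// mul0r TY_ge0.
Qed.

Lemma dot_gt0 (b : 'rV[R]_p) : b != 0 -> 0 < dot b b.
Proof.
move=> b0; rewrite lt_def sumr_ge0 ?andbT => [|i _]; last by rewrite -expr2 sqr_ge0.
apply: contra b0 => /eqP; rewrite /dot => /psumr_eq0P h; apply/eqP/rowP => i.
by rewrite mxE; apply/eqP; rewrite -sqrf_eq0 expr2 h// => j _; rewrite -expr2 sqr_ge0.
Qed.

(** The denominator of the ratio is positive because [q] is nonzero and the variance nonsingular,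
    and homogeneity moves [lambda >= 0] inside the tail integral. Lower bounds of an essential
    infimum are exactly the almost-everywhere lower bounds. *)
Lemma le_SbarP q lambda : q != 0 -> 0 <= lambda ->
  (lambda%:E <= Sbar kY kX mu q)%E <-> Bc Y Xnc Xc (lambda *: q).
Proof.
move=> q0 l0.
have key x : has_mean kX x -> (forall i, (\int[kX x]_z (tnth z i ^+ 2)%:E < +oo)%E) ->
    cvarX kX x \in unitmx ->
    (lambda%:E <= inf_ratio (cdfYx kY x) (cdfXxq kX q x))%E <->
    forall a, 0 < a < 1 -> tailX kX x (lambda *: q) a <= TY x a.
  move=> gX s2 V; split=> [h a a01|h].
    have := le_trans h (ereal_inf_lbound (ex_intro2 _ _ a _ erefl)).
    rewrite lee_fin /= in_itv/= => /(_ a01).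
    by rewrite ler_pdivlMr ?tailX_gt0// tailXZ.
  apply: le_ereal_inf_tmp => _ [a + <-]; rewrite /= in_itv/= => a01.
  by rewrite lee_fin ler_pdivlMr ?tailX_gt0// -tailXZ//; exact: h.
split=> [/ess_infP h|/BcP h].
  apply/BcP; apply: filterS2 (filterI X1 X2) (filterI Xns h) => x [gX s2] [V hx].
  exact/key.
apply/ess_infP; apply: filterS2 (filterI X1 X2) (filterI Xns h) => x [gX s2] [V hx].
exact/key.
Qed.

Lemma BcE : Bc Y Xnc Xc = [set b | exists q lambda, [/\ unit_sphere q, 0 <= lambda,
  (lambda%:E <= Sbar kY kX mu q)%E & b = lambda *: q]].
Proof.
have neq0 (q : 'rV[R]_p) : unit_sphere q -> q != 0.
  move=> q1; apply/eqP => q0; move: q1; rewrite /unit_sphere/= q0 /dot.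
  by under eq_bigr do rewrite mxE mul0r; rewrite big1// => /eqP; rewrite eq_sym oner_eq0.
apply/seteqP; split => b; last first.
  by move=> [q [l [q1 l0 lS ->]]]; exact/(le_SbarP (neq0 _ q1) l0).
move=> Bb; have [b0|b0] := eqVneq b 0.
  (* The vector 0 has no direction; any unit vector will do, with [lambda = 0], and [p_gt0] provides
     one. *)
  pose q : 'rV[R]_p := delta_mx 0 (Ordinal p_gt0).
  have q1 : unit_sphere q.
    rewrite /unit_sphere/= /dot (bigD1 (Ordinal p_gt0))//= big1 => [|i i0].
      by rewrite addr0 mxE !eqxx mulr1.
    by rewrite mxE (negbTE i0) andbF mul0r.
  exists q, 0; split => //; last by rewrite scale0r.
  by apply/(le_SbarP (neq0 _ q1) (lexx _)); rewrite scale0r -b0.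
have bb := dot_gt0 b0; pose l := Num.sqrt (dot b b).
have l0 : 0 < l by rewrite sqrtr_gt0.
have q1 : unit_sphere (l^-1 *: b).
  rewrite /unit_sphere/= /dot; under eq_bigr do rewrite !mxE mulrACA.
  rewrite -mulr_sumr -/(dot b b) -(sqr_sqrtr (ltW bb)) -/l expr2.
  by rewrite mulrACA mulVf ?gt_eqF// mulr1.
have bE : b = l *: (l^-1 *: b) by rewrite scalerA mulfV ?gt_eqF// scale1r.
exists (l^-1 *: b), l; split => //; first exact: ltW.
by apply/(le_SbarP (neq0 _ q1) (ltW l0)); rewrite -bE.
Qed.

Lemma convex_Bc : convex_set (Bc Y Xnc Xc).
Proof.
apply/convex_setW => b c /set_mem/BcP Bb /set_mem/BcP Bc k k0 k1; apply/mem_set/BcP.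
apply: filterS2 X1 (filterI Bb Bc) => x gX [bx cx] a a01.
have k1' : 0 <= 1 - k%:num by rewrite subr_ge0 ltW.
apply: le_trans (tailX_sublinear gX b c (ltW k0) k1' a01) _.
have := bx a a01; have := cx a a01; move: (tailX _ _ _ _) (tailX _ _ _ _) (TY _ _) => u v w.
nra.
Qed.

Let M x := \sum_i \int[kprob kX x]_z `|tnth z i - cmeanX kX x 0 i|.

(** The null set of [x] excluded by [BcP] depends on the parameter, so closure points are approached
    along a sequence, for which one null set suffices. At a fixed [x], the tail integral is
    continuous in [b] by sublinearity and [tailX_le_norm]. *)
Lemma closed_Bc : closed (Bc Y Xnc Xc).
Proof.
move=> b clb.
have [bn bnP] : exists bn : nat -> 'rV[R]_p, forall n, Bc Y Xnc Xc (bn n) /\ `|b - bn n| < n.+1%:R^-1.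
  have : forall n, exists c, Bc Y Xnc Xc c /\ `|b - c| < n.+1%:R^-1.
    move=> n; have n0 : 0 < n.+1%:R^-1 :> R by [].
    have [c [Bcc bc]] := clb _ (nbhsx_ballx b _ n0).
    by exists c; split => //; move: bc; rewrite -ball_normE.
  by move=> /choice[f fP]; exists f.
apply/BcP.
have : \forall x \ae mu, forall n, forall a, 0 < a < 1 -> tailX kX x (bn n) a <= TY x a.
  by apply/ae_foralln => n; exact/BcP/(bnP n).1.
apply: filterS2 X1 => x gX bx a a01; apply/ler_addgt0Pr => e e0.
have M0 : 0 <= M x by apply: sumr_ge0 => i _; apply: Rintegral_ge0 => z _.
have [n nM] : exists n : nat, M x / e < n.+1%:R.
  by exists (Num.truncn (M x / e)); rewrite truncnS_gt.
have := tailX_sublinear gX (bn n) (b - bn n) ler01 ler01 a01.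
rewrite !scale1r !mul1r addrC subrK => /le_trans; apply.
have h : tailX kX x (b - bn n) a <= `|b - bn n| * M x by exact: tailX_le_norm.
apply: lerD; [exact: bx | apply: le_trans h _].
have [_ /ltW bn1] := bnP n; apply: le_trans (ler_wpM2r M0 bn1) _.
by rewrite mulrC ler_pdivrMr// mulrC -ler_pdivrMr// ltW.
Qed.

(** An unbounded sequence in the set would satisfy the dominance inequalities simultaneously for
    almost every [x]. A probability has no null complement of a null set, so one such [x] exists;
    coercivity there bounds the whole sequence by [TY x 2^-1 / delta]. *)
Lemma bounded_Bc : bounded_set (Bc Y Xnc Xc).
Proof.
suff [n nP] : exists n : nat, forall b, Bc Y Xnc Xc b -> `|b| <= n%:R.
  exists n%:R; split => // r nr b Bb; apply: le_trans (nP b Bb) _; exact: ltW.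
apply: contrapT => noN.
have [bn bnP] : exists bn : nat -> 'rV[R]_p, forall n, Bc Y Xnc Xc (bn n) /\ n%:R < `|bn n|.
  have : forall n : nat, exists b, Bc Y Xnc Xc b /\ n%:R < `|b|.
    move=> n; apply: contrapT => h; apply: noN; exists n => b Bb.
    by rewrite leNgt; apply/negP => nb; apply: h; exists b.
  by move=> /choice[f fP]; exists f.
have : \forall x \ae mu, forall n, forall a, 0 < a < 1 -> tailX kX x (bn n) a <= TY x a.
  by apply/ae_foralln => n; exact/BcP/(bnP n).1.
move=> /(filterI (filterI X2 Xns))/(filterI X1) H.
have muT : (0 < mu setT)%E by rewrite probability_setT.
have [x [gX [[s2 V] bx]]] := @filter_ex _ _ (ae_properfilter_algebraOfSetsType muT) _ H.
(* A single level is enough for coercivity; [2^-1] is an arbitrary choice in []0, 1[]. *)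
have a01 : 0 < (2^-1 : R) < 1 by rewrite invr_gt0 invf_lt1 ?ltr0n ?ltr1n.
have TD b c : tailX kX x (b + c) 2^-1 <= tailX kX x b 2^-1 + tailX kX x c 2^-1.
  by have := tailX_sublinear gX b c ler01 ler01 a01; rewrite !scale1r !mul1r.
have [delta d0 dP] := @sublinear_coercive R p (fun b => tailX kX x b 2^-1) (M x)
  TD (fun s b s0 => tailXZ gX b s0 a01) (fun b => tailX_le_norm gX b a01)
  (fun b b0 => tailX_gt0 gX s2 V b0 a01).
pose n := (Num.truncn (TY x 2^-1 / delta)).+1.
have nT : TY x 2^-1 / delta < n%:R by rewrite truncnS_gt.
have := le_trans (dP (bn n)) (bx n _ a01).
rewrite mulrC -ler_pdivlMr// leNgt (lt_trans nT)//; exact: (bnP n).2.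
Qed.

Lemma compact_Bc : compact (Bc Y Xnc Xc).
Proof. exact: bounded_closed_compact bounded_Bc closed_Bc. Qed.

End IdentifiedSetShape.

Theorem proposition2 (R : realType) (d : measure_display)
  (Omega : measurableType d) (P : probability Omega R)
  (p m : nat) (p_gt0 : (0 < p)%N)
  (Y : {RV P >-> R}) (Xnc : {RV P >-> p.-tuple R})
  (Xc : {RV P >-> m.-tuple R})
  (kY : R.-pker m.-tuple R ~> R) (kX : R.-pker m.-tuple R ~> p.-tuple R)
  (kYP : is_cond_law P Y Xc kY) (kXP : is_cond_law P Xnc Xc kX)
  (Y2 : (\int[P]_w (Y w ^+ 2)%:E < +oo)%E)
  (X2 : \forall x \ae distribution P Xc, forall i : 'I_p,
    (\int[kX x]_z (tnth z i ^+ 2)%:E < +oo)%E)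
  (Xns : \forall x \ae distribution P Xc, cvarX kX x \in unitmx)
  (f : m.-tuple R -> R) (beta0 : 'rV[R]_p)
  (model : is_cond_exp P Y (fun w => (Xnc w, Xc w))
    (partially_linear beta0 f)) :
  [/\ Bc Y Xnc Xc =
        [set b | exists q lambda, [/\ unit_sphere q, 0 <= lambda,
          (lambda%:E <= Sbar kY kX (distribution P Xc) q)%E &
          b = lambda *: q]],
      Fset Y Xnc Xc =
        [set g | measurable_fun setT g /\ exists2 b, Bc Y Xnc Xc b &
          \forall x \ae distribution P Xc,
            g x = cmeanY kY x - dot (cmeanX kX x) b],
      Bc Y Xnc Xc 0,
      compact (Bc Y Xnc Xc) &
      convex_set (Bc Y Xnc Xc)].
Proof.
have [iY _ _ _] := model.
split.
- exact: BcE.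
- exact: FsetE.
- exact: (Bc0 kYP kXP).
- exact: (compact_Bc kYP kXP iY X2 Xns).
- exact: (convex_Bc kYP kXP).
Qed.
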